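(* Suppose $q,a$ are integers with $0<a<q$ and $(a,q)=1$, let $X\ge1$, and let $f$ be a smooth function on $(0,\infty)$ whose Mellin transform $\widetilde{f}(s)=\int_0^\infty f(x)x^{s}\frac{dx}{x}$ extends to a meromorphic function on $\mathbb{C}$ whose only possible pole is at $s=0$, with rapid decay as $|s|\to\infty$ in every fixed strip $-B\le\operatorname{Re}(s)\le B$. Then for any $\varepsilon>0$, $$S(q,-a;f,X)=\sqrt{\frac{a}{q}}\,S\Big(a,q;f,\frac{aX}{q}\Big)+q^{-1/2}k\Big(\frac{q}{X}\Big)+O\Big(q^{-1/2}\frac{a}{q}\Big(\frac{X}{q}\Big)^{1/2}\Big(1+\frac{X}{q}\Big)(qX)^{\varepsilon}\Big),$$ where the implied constant depends only on $f$ and $\varepsilon$.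
   Context: For a positive integer $r$, an integer $b$ coprime to $r$ and $Y>0$, define $$S(r,b;f,Y)=\mathop{\sum\sum}_{\substack{m,n\ge1\\ n\equiv bm\ (\mathrm{mod}\ r)}}\frac{1}{\sqrt{mn}}f\Big(\frac{mn}{Y}\Big).$$ For $y>0$, $$k(y)=\frac{1}{2\pi i}\int_{(2)}y^{-s}\widetilde{f}(s)\zeta^2(\tfrac12+s)\,ds.$$ *)

(* Defs.v *)
From Stdlib Require Import Reals ZArith Znumtheory.
From Coquelicot Require Import Coquelicot.
Local Open Scope R_scope.

(* x ^ s for a real base x > 0 and a complex exponent s. *)
Definition Rcpow (x : R) (s : C) : C :=
  (exp (Re s * ln x) * cos (Im s * ln x), exp (Re s * ln x) * sin (Im s * ln x)).

Definition CSeries (u : nat -> C) : C :=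
  (Series (fun n => Re (u n)), Series (fun n => Im (u n))).

(* Used only on Re s = 5/2, inside the half-plane Re s > 1 of absolute convergence. *)
Definition zeta (s : C) : C := CSeries (fun n => Rcpow (INR (n + 1)) (- s)%C).

Definition smooth_pos (f : R -> C) : Prop :=
  forall (n : nat) (x : R), 0 < x ->
    ex_derive_n (fun t => Re (f t)) n x /\ ex_derive_n (fun t => Im (f t)) n x.

Definition mellin_integrand (f : R -> C) (s : C) (x : R) : C :=
  (f x * Rcpow x s / RtoC x)%C.

Definition has_mellin (f : R -> C) (s l : C) : Prop :=
  ex_RInt_gen (V := R_NormedModule) (fun x => Cmod (mellin_integrand f s x))
    (at_right 0) (Rbar_locally p_infty) /\
  is_RInt_gen (V := C_R_NormedModule) (mellin_integrand f s)
    (at_right 0) (Rbar_locally p_infty) l.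

Definition holomorphic_at (F : C -> C) (s : C) : Prop :=
  exists d : R, 0 < d /\
    forall z : C, Cmod (z - s) < d ->
      ex_derive (K := C_AbsRing) (V := C_NormedModule) F z.

Definition meromorphic_at (F : C -> C) (s : C) : Prop :=
  exists (N : nat) (g : C -> C) (d : R),
    0 < d /\ holomorphic_at g s /\
    forall z : C, 0 < Cmod (z - s) < d -> F z = (g z / (z - s) ^ N)%C.

Definition rapid_decay_in_strips (F : C -> C) : Prop :=
  forall (B : R) (A : nat), exists K T : R,
    forall s : C, - B <= Re s <= B -> T <= Cmod s -> Cmod s ^ A * Cmod (F s) <= K.

(* F is a meromorphic continuation to C of the Mellin transform of f, the
   integral being required to converge only for Re s sufficiently large. *)
Definition mellin_continuation (f : R -> C) (F : C -> C) : Prop :=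
  (exists s0 : R, forall s : C, s0 < Re s -> has_mellin f s (F s)) /\
  (forall s : C, s <> RtoC 0 -> holomorphic_at F s) /\
  meromorphic_at F (RtoC 0) /\
  rapid_decay_in_strips F.

Definition S_term (r b : Z) (f : R -> C) (Y : R) (m n : nat) : C :=
  if Zdivide_dec r (Z.of_nat n - b * Z.of_nat m)
  then (RtoC (/ sqrt (INR m * INR n)) * f (INR m * INR n / Y)%R)%C
  else RtoC 0.

(* The value of S is meaningful only together with S_converges, under which the
   order of summation is irrelevant. *)
Definition S_sum (r b : Z) (f : R -> C) (Y : R) : C :=
  CSeries (fun m => CSeries (fun n => S_term r b f Y (m + 1) (n + 1))).

Definition S_converges (r b : Z) (f : R -> C) (Y : R) : Prop :=
  exists M : R, forall N : nat,
    sum_n (fun m => sum_n (fun n => Cmod (S_term r b f Y (m + 1) (n + 1))) N) N <= M.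

(* The contour integral over Re s = c, upwards, with s = c + it and ds = i dt. *)
Definition line_integral (c : R) (g : C -> C) : C :=
  (Ci * RInt_gen (V := C_R_CompleteNormedModule) (fun t : R => g (c, t))
          (Rbar_locally m_infty) (Rbar_locally p_infty))%C.

Definition line_integrable (c : R) (g : C -> C) : Prop :=
  ex_RInt_gen (V := R_NormedModule) (fun t : R => Cmod (g (c, t)))
    (Rbar_locally m_infty) (Rbar_locally p_infty) /\
  ex_RInt_gen (V := C_R_NormedModule) (fun t : R => g (c, t))
    (Rbar_locally m_infty) (Rbar_locally p_infty).

Definition k_integrand (F : C -> C) (y : R) (s : C) : C :=
  (Rcpow y (- s) * F s * zeta (RtoC (1 / 2) + s) ^ 2)%C.

Definition k_fun (F : C -> C) (y : R) : C :=
  (/ (RtoC (2 * PI) * Ci) * line_integral 2 (k_integrand F y))%C.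

(* Main.v *)
Require Import Defs.
From Stdlib Require Import Reals ZArith Znumtheory Lra Lia Classical.
From Coquelicot Require Import Coquelicot.
Local Open Scope R_scope.

(** Write the congruence n = -am (mod q) as am + n = ql with l >= 1, and put
    Phi(x) = x^(-1/2) f(x/X), so that S(q,-a; f, X) sums Phi(mn) over these triples.
    If n < am, then mn = (1 - d) qln/a with d = n/(ql), and Phi(qln/a), summed over all
    l, n with n = ql (mod a), is the term with S(a,q). If n >= am, then
    mn = (1 - d) qlm with d = am/(ql), and Phi(qlm), summed over all l, m, is the term
    with k. The difference, and for d >= 1/2 the main term itself, is
    O(d X^(-1/2) (X/x)^(c+1/2)) for every c > 0, which follows from the inverse Mellin
    integral of f over Re s = c. One takes c = 1/2 for the single n <= a in the residue
    class of ql mod a, and c = 3/2 + eps elsewhere.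

    Mellin inversion holds far to the right by Fourier inversion with the Poisson
    kernel, the integral being regularised by exp(-eta |t|); Cauchy's theorem
    moves the line to any c > 0. *)

(** * Integrals of complex-valued functions of a real variable *)

(** Put [r = X/q]. For the family indexed by [(l, n)] the error is [n/(ql) * (ra/(ln))^(c+1/2)] up
    to a constant and [X^(-1/2)]. At [c = 1/2] it equals [(a/q) r / l^2], with no decay in [n], so
    it serves only boundedly many [n] for each [l]; at [c = 3/2 + eps] it is summable in [n], but
    loses a power of [a] at small [n]. The congruence mod [a] resolves the conflict: each block of
    [a] consecutive integers holds at most one admissible [n], and in the [j]-th block, [j >= 1],
    the quantity [ra/(ln)] is at most [r/j].

    The cut at [n = am] is the cut at [d = 1/2], so [ln(1 - d)] stays bounded in both families. The
    main terms beyond the cut have nothing to be compared with; there [d >= 1/2] makes the factor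
    [d] free.

    Regrouping by [l] is done on finite sums cut off at [am + n <= qL], with an error bound
    independent of [L], so no infinite sum is rearranged.

    In the inversion, [F] is integrable on a line, yet the double integral behind it is not
    absolutely convergent before the factor [exp(-eta |t|)] is inserted. *)

Definition Ccont (h : R -> C) (t : R) : Prop :=
  continuous (fun t => Re (h t)) t /\ continuous (fun t => Im (h t)) t.

Definition CInt (h : R -> C) (a b : R) : C :=
  (RInt (fun t => Re (h t)) a b, RInt (fun t => Im (h t)) a b).

Definition Ccont_on (h : R -> C) (a b : R) : Prop :=
  forall t, Rmin a b <= t <= Rmax a b -> Ccont h t.

Lemma C_ext (z w : C) : Re z = Re w -> Im z = Im w -> z = w.
Proof. destruct z, w; simpl; intros -> ->; reflexivity. Qed.

Lemma Re_plus z w : Re (z + w)%C = Re z + Re w. Proof. reflexivity. Qed.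
Lemma Im_plus z w : Im (z + w)%C = Im z + Im w. Proof. reflexivity. Qed.
Lemma Re_minus z w : Re (z - w)%C = Re z - Re w. Proof. reflexivity. Qed.
Lemma Im_minus z w : Im (z - w)%C = Im z - Im w. Proof. reflexivity. Qed.

Lemma im_le_Cmod z : Rabs (Im z) <= Cmod z.
Proof. apply Rle_trans with (2 := Rmax_Cmod z). apply Rmax_r. Qed.

Lemma Cmod_le_sum z : Cmod z <= Rabs (Re z) + Rabs (Im z).
Proof.
  unfold Cmod. pose proof (Rabs_pos (Re z)). pose proof (Rabs_pos (Im z)).
  rewrite <- (sqrt_pow2 (Rabs (Re z) + Rabs (Im z))) by lra.
  apply sqrt_le_1_alt. fold (Re z) (Im z).
  rewrite <- (pow2_abs (Re z)), <- (pow2_abs (Im z)). nra.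
Qed.

Lemma Cmod_minus_sym z w : Cmod (z - w) = Cmod (w - z).
Proof. rewrite <- Cmod_opp. f_equal. ring. Qed.

Lemma Cmod_triangle3 (x y z : C) : Cmod (x - z) <= Cmod (x - y) + Cmod (y - z).
Proof. replace (x - z)%C with ((x - y) + (y - z))%C by ring. apply Cmod_triangle. Qed.

Lemma Cmod_rev_triangle (x y : C) : Cmod x <= Cmod y + Cmod (x - y).
Proof. replace x with (y + (x - y))%C at 1 by ring. apply Cmod_triangle. Qed.

Lemma Cmod_eq_0_le (z : C) (M : R) :
  (forall e, 0 < e -> Cmod z <= M * e) -> z = RtoC 0.
Proof.
  intros H. apply Cmod_eq_0. apply Rle_antisym; [|apply Cmod_ge_0].
  apply Rnot_lt_le. intros Hz.
  destruct (Rle_lt_dec M 0) as [HM|HM].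
  - specialize (H 1 Rlt_0_1). lra.
  - specialize (H (Cmod z / (2 * M))).
    assert (0 < Cmod z / (2 * M)) by (apply Rdiv_lt_0_compat; lra).
    specialize (H H0). replace (M * (Cmod z / (2 * M))) with (Cmod z / 2) in H by (field; lra). lra.
Qed.

Lemma Ccont_continuous_R (g : R -> R) t : continuous g t -> Ccont (fun t => RtoC (g t)) t.
Proof. intros H; split; simpl; [exact H | apply continuous_const]. Qed.

Lemma Ccont_const c t : Ccont (fun _ => c) t.
Proof. split; apply continuous_const. Qed.

Lemma Ccont_plus h g t : Ccont h t -> Ccont g t -> Ccont (fun t => h t + g t)%C t.
Proof.
  intros [H1 H2] [H3 H4]; split; simpl;
  apply (continuous_plus (V := R_NormedModule)); assumption.
Qed.

Lemma Ccont_minus h g t : Ccont h t -> Ccont g t -> Ccont (fun t => h t - g t)%C t.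
Proof.
  intros [H1 H2] [H3 H4]; split; simpl;
  apply (continuous_minus (V := R_NormedModule)); assumption.
Qed.

Lemma Ccont_mult h g t : Ccont h t -> Ccont g t -> Ccont (fun t => h t * g t)%C t.
Proof.
  intros [H1 H2] [H3 H4]; split; simpl.
  - apply (continuous_minus (V := R_NormedModule));
    apply (continuous_mult (K := R_AbsRing)); assumption.
  - apply (continuous_plus (V := R_NormedModule));
    apply (continuous_mult (K := R_AbsRing)); assumption.
Qed.

Lemma continuous_eps (g : R -> R) t :
  (forall e, 0 < e -> exists d, 0 < d /\ forall s, Rabs (s - t) < d -> Rabs (g s - g t) < e) ->
  continuous g t.
Proof.
  intros H. apply filterlim_locally. intros e.
  destruct (H e (cond_pos e)) as (d & Hd & Hs).
  exists (mkposreal d Hd). intros s Hb. apply Hs. exact Hb.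
Qed.

Lemma continuous_eps_inv (g : R -> R) t :
  continuous g t ->
  forall e, 0 < e -> exists d, 0 < d /\ forall s, Rabs (s - t) < d -> Rabs (g s - g t) < e.
Proof.
  intros H e He. apply filterlim_locally with (eps := mkposreal e He) in H.
  destruct H as [d Hd]. exists d. split; [apply cond_pos|]. intros s Hs. apply (Hd s Hs).
Qed.

Lemma Ccont_eps (h : R -> C) t :
  (forall e, 0 < e -> exists d, 0 < d /\ forall s, Rabs (s - t) < d -> Cmod (h s - h t) < e) ->
  Ccont h t.
Proof.
  intros H; split; apply continuous_eps; intros e He; destruct (H e He) as (d & Hd & Hs);
  exists d; (split; [exact Hd|]); intros s Hst.
  - rewrite <- Re_minus. eapply Rle_lt_trans; [apply re_le_Cmod | apply Hs, Hst].
  - rewrite <- Im_minus. eapply Rle_lt_trans; [apply im_le_Cmod | apply Hs, Hst].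
Qed.

Lemma Ccont_eps_inv (h : R -> C) t :
  Ccont h t ->
  forall e, 0 < e -> exists d, 0 < d /\ forall s, Rabs (s - t) < d -> Cmod (h s - h t) < e.
Proof.
  intros [H1 H2] e He.
  destruct (continuous_eps_inv _ _ H1 (e/2)) as (d1 & Hd1 & K1); [lra|].
  destruct (continuous_eps_inv _ _ H2 (e/2)) as (d2 & Hd2 & K2); [lra|].
  exists (Rmin d1 d2). split; [apply Rmin_glb_lt; assumption|]. intros s Hs.
  eapply Rle_lt_trans; [apply Cmod_le_sum|]. rewrite Re_minus, Im_minus.
  specialize (K1 s). specialize (K2 s).
  assert (Rabs (s - t) < d1) by (eapply Rlt_le_trans; [exact Hs | apply Rmin_l]).
  assert (Rabs (s - t) < d2) by (eapply Rlt_le_trans; [exact Hs | apply Rmin_r]).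
  specialize (K1 H). specialize (K2 H0). lra.
Qed.

Lemma Ccont_Cmod h t : Ccont h t -> continuous (fun t => Cmod (h t)) t.
Proof.
  intros H. apply continuous_eps. intros e He.
  destruct (Ccont_eps_inv _ _ H e He) as (d & Hd & K). exists d; split; [exact Hd|].
  intros s Hs. eapply Rle_lt_trans; [|apply K, Hs].
  apply Rabs_le. split.
  - pose proof (Cmod_rev_triangle (h t) (h s)). rewrite Cmod_minus_sym in H0. lra.
  - pose proof (Cmod_rev_triangle (h s) (h t)). lra.
Qed.

Lemma Ccont_on_ex h a b : Ccont_on h a b ->
  ex_RInt (fun t => Re (h t)) a b /\ ex_RInt (fun t => Im (h t)) a b.
Proof.
  intros H; split; apply (ex_RInt_continuous (V := R_CompleteNormedModule)); intros z Hz;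
  apply (H z Hz).
Qed.

Lemma Ccont_on_all h a b : (forall t, Ccont h t) -> Ccont_on h a b.
Proof. intros H t _; apply H. Qed.

Lemma CInt_is_RInt h a b : Ccont_on h a b ->
  is_RInt (V := C_R_NormedModule) h a b (CInt h a b).
Proof.
  intros H. destruct (Ccont_on_ex _ _ _ H) as [H1 H2].
  apply (is_RInt_fct_extend_pair (U := R_NormedModule) (V := R_NormedModule));
  apply (RInt_correct (V := R_CompleteNormedModule)); assumption.
Qed.

Lemma CInt_unique h a b l : is_RInt (V := C_R_NormedModule) h a b l -> CInt h a b = l.
Proof.
  intros H. unfold CInt, Re, Im.
  apply (RInt_fct_extend_pair (U := R_NormedModule) (V := R_NormedModule)
    (@RInt R_CompleteNormedModule) (@RInt R_CompleteNormedModule)) with (f := h) (a := a) (b := b);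
  try (intros f x y z; apply (is_RInt_unique (V := R_CompleteNormedModule))).
  exact H.
Qed.

Lemma norm_C_R (z : C) : norm (V := C_R_NormedModule) z = Cmod z.
Proof.
  change (norm (V := C_R_NormedModule) z) with (sqrt (Rabs (fst z) ^ 2 + Rabs (snd z) ^ 2)).
  rewrite !pow2_abs. reflexivity.
Qed.

Lemma CInt_Chasles h a b c : Ccont_on h a b -> Ccont_on h b c ->
  (CInt h a b + CInt h b c = CInt h a c)%C.
Proof.
  intros H1 H2. destruct (Ccont_on_ex _ _ _ H1). destruct (Ccont_on_ex _ _ _ H2).
  apply C_ext; simpl; apply (RInt_Chasles (V := R_CompleteNormedModule)); assumption.
Qed.

Lemma CInt_ext h g a b : (forall t, Rmin a b < t < Rmax a b -> h t = g t) ->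
  CInt h a b = CInt g a b.
Proof.
  intros H. apply C_ext; simpl; apply RInt_ext; intros x Hx; rewrite H by exact Hx; reflexivity.
Qed.

Lemma CInt_plus h g a b : Ccont_on h a b -> Ccont_on g a b ->
  CInt (fun t => h t + g t)%C a b = (CInt h a b + CInt g a b)%C.
Proof.
  intros H1 H2. destruct (Ccont_on_ex _ _ _ H1). destruct (Ccont_on_ex _ _ _ H2).
  apply C_ext; simpl; apply (RInt_plus (V := R_CompleteNormedModule)); assumption.
Qed.

Lemma CInt_minus h g a b : Ccont_on h a b -> Ccont_on g a b ->
  CInt (fun t => h t - g t)%C a b = (CInt h a b - CInt g a b)%C.
Proof.
  intros H1 H2. destruct (Ccont_on_ex _ _ _ H1). destruct (Ccont_on_ex _ _ _ H2).
  apply C_ext; simpl; apply (RInt_minus (V := R_CompleteNormedModule)); assumption.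
Qed.

Lemma CInt_mult_l c h a b : Ccont_on h a b ->
  CInt (fun t => c * h t)%C a b = (c * CInt h a b)%C.
Proof.
  intros H. destruct (Ccont_on_ex _ _ _ H) as [H1 H2].
  apply C_ext; simpl.
  - etransitivity.
    + apply (RInt_minus (V := R_CompleteNormedModule) (fun t => fst c * Re (h t)) (fun t => snd c * Im (h t)));
      apply (ex_RInt_scal (V := R_NormedModule)); assumption.
    + rewrite (RInt_scal (V := R_CompleteNormedModule) (fun t => Re (h t))) by assumption.
      rewrite (RInt_scal (V := R_CompleteNormedModule) (fun t => Im (h t))) by assumption.
      reflexivity.
  - etransitivity.
    + apply (RInt_plus (V := R_CompleteNormedModule) (fun t => fst c * Im (h t)) (fun t => snd c * Re (h t)));
      apply (ex_RInt_scal (V := R_NormedModule)); assumption.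
    + rewrite (RInt_scal (V := R_CompleteNormedModule) (fun t => Re (h t))) by assumption.
      rewrite (RInt_scal (V := R_CompleteNormedModule) (fun t => Im (h t))) by assumption.
      reflexivity.
Qed.

Lemma CInt_const c a b : CInt (fun _ => c) a b = (c * RtoC (b - a)%R)%C.
Proof.
  apply C_ext; simpl; rewrite RInt_const; unfold scal; simpl; unfold mult; simpl;
  unfold Re, Im; ring.
Qed.

Lemma CInt_id a b : CInt (fun x => RtoC x) a b = RtoC ((b * b - a * a) / 2).
Proof.
  apply C_ext; simpl.
  - apply is_RInt_unique.
    replace ((b * b - a * a) / 2) with (minus (b * b / 2) (a * a / 2))
      by (unfold minus, plus, opp; simpl; field).
    apply (is_RInt_derive (V := R_CompleteNormedModule) (fun x => x * x / 2) (fun x => x)).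
    + intros x _. auto_derive; [trivial|field].
    + intros x _. apply continuous_id.
  - rewrite RInt_const. unfold scal; simpl; unfold mult; simpl. ring.
Qed.

Lemma Cmod_CInt_le h (g : R -> R) a b :
  a <= b -> Ccont_on h a b -> (forall t, a <= t <= b -> continuous g t) ->
  (forall t, a <= t <= b -> Cmod (h t) <= g t) ->
  Cmod (CInt h a b) <= RInt g a b.
Proof.
  intros Hab H1 H2 H3. rewrite <- norm_C_R.
  apply (norm_RInt_le (V := C_R_NormedModule) h g a b).
  - exact Hab.
  - intros x Hx. rewrite norm_C_R. apply H3, Hx.
  - apply CInt_is_RInt, H1.
  - apply (RInt_correct (V := R_CompleteNormedModule)).
    apply (ex_RInt_continuous (V := R_CompleteNormedModule)).
    intros z. rewrite Rmin_left, Rmax_right by exact Hab. apply H2.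
Qed.

Lemma Cmod_CInt_le_const h M a b :
  a <= b -> Ccont_on h a b -> (forall t, a <= t <= b -> Cmod (h t) <= M) ->
  Cmod (CInt h a b) <= (b - a) * M.
Proof.
  intros Hab H1 H3. rewrite <- norm_C_R.
  apply (norm_RInt_le_const (V := C_R_NormedModule) h a b).
  - exact Hab.
  - intros x Hx. rewrite norm_C_R. apply H3, Hx.
  - apply CInt_is_RInt, H1.
Qed.

(** * Cauchy's theorem on rectangles *)

(** Goursat's argument uses nothing but this linear approximation at one point; continuity of the
    derivative never enters. *)
Definition Cdiff (G : C -> C) (z : C) : Prop :=
  exists D : C, forall e, 0 < e -> exists d, 0 < d /\
    forall w, Cmod (w - z) < d -> Cmod (G w - G z - D * (w - z)) <= e * Cmod (w - z).

Lemma Cdiff_cont (G : C -> C) z : Cdiff G z ->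
  forall e, 0 < e -> exists d, 0 < d /\ forall w, Cmod (w - z) < d -> Cmod (G w - G z) < e.
Proof.
  intros [D HD] e He. destruct (HD 1 Rlt_0_1) as (d & Hd & H).
  pose proof (Cmod_ge_0 D).
  exists (Rmin d (e / (Cmod D + 2))).
  assert (0 < e / (Cmod D + 2)) by (apply Rdiv_lt_0_compat; lra).
  split; [apply Rmin_glb_lt; assumption|].
  intros w Hw.
  assert (Cmod (w - z) < d) by (eapply Rlt_le_trans; [exact Hw | apply Rmin_l]).
  assert (Cmod (w - z) < e / (Cmod D + 2)) by (eapply Rlt_le_trans; [exact Hw | apply Rmin_r]).
  specialize (H w H2).
  pose proof (Cmod_rev_triangle (G w - G z) (D * (w - z))).
  rewrite Cmod_mult in H4. pose proof (Cmod_ge_0 (w - z)).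
  assert (Cmod (w - z) * (Cmod D + 2) < e).
  { apply Rmult_lt_compat_r with (r := Cmod D + 2) in H3; [|lra].
    replace (e / (Cmod D + 2) * (Cmod D + 2)) with e in H3 by (field; lra). exact H3. }
  nra.
Qed.

Lemma Cdiff_Ccont_h (G : C -> C) x y : Cdiff G (x, y) -> Ccont (fun x => G (x, y)) x.
Proof.
  intros H. apply Ccont_eps. intros e He. destruct (Cdiff_cont _ _ H e He) as (d & Hd & K).
  exists d; split; [exact Hd|]. intros s Hs. apply K.
  replace ((s, y) - (x, y))%C with (RtoC (s - x)); [rewrite Cmod_R; exact Hs|].
  apply C_ext; simpl; ring.
Qed.

Lemma Cmod_Ci : Cmod Ci = 1.
Proof.
  unfold Cmod; simpl. replace (0 * (0 * 1) + 1 * (1 * 1)) with 1 by ring. rewrite sqrt_1; ring.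
Qed.

Lemma Cdiff_Ccont_v (G : C -> C) x y : Cdiff G (x, y) -> Ccont (fun y => G (x, y)) y.
Proof.
  intros H. apply Ccont_eps. intros e He. destruct (Cdiff_cont _ _ H e He) as (d & Hd & K).
  exists d; split; [exact Hd|]. intros s Hs. apply K.
  replace ((x, s) - (x, y))%C with (Ci * RtoC (s - y))%C by (apply C_ext; simpl; ring).
  rewrite Cmod_mult, Cmod_R, Cmod_Ci, Rmult_1_l. exact Hs.
Qed.

(** Counterclockwise contour integral around the rectangle with lower left corner [(x, y)], width
    [w] and height [h]; the factor [Ci] on the vertical sides is [dz = i dt]. *)
Definition rect_int (G : C -> C) (x y w h : R) : C :=
  (CInt (fun s => G (s, y)) x (x + w)%R + Ci * CInt (fun t => G ((x + w)%R, t)) y (y + h)%R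
   - CInt (fun s => G (s, (y + h)%R)) x (x + w)%R - Ci * CInt (fun t => G (x, t)) y (y + h)%R)%C.

Definition diff_on_rect (G : C -> C) (x y w h : R) : Prop :=
  forall s t, x <= s <= x + w -> y <= t <= y + h -> Cdiff G (s, t).

Lemma diff_on_rect_sub G x y w h x' y' w' h' : diff_on_rect G x y w h ->
  x <= x' -> x' + w' <= x + w -> y <= y' -> y' + h' <= y + h ->
  diff_on_rect G x' y' w' h'.
Proof. intros H ? ? ? ? s t Hs Ht. apply H; lra. Qed.

Lemma diff_Ccont_on_h G x y w h a b t : diff_on_rect G x y w h ->
  x <= a -> a <= b -> b <= x + w -> y <= t <= y + h -> Ccont_on (fun s => G (s, t)) a b.
Proof.
  intros H ? ? ? ? s. rewrite Rmin_left, Rmax_right by assumption. intros Hs.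
  apply Cdiff_Ccont_h, H; lra.
Qed.

Lemma diff_Ccont_on_v G x y w h a b s : diff_on_rect G x y w h ->
  y <= a -> a <= b -> b <= y + h -> x <= s <= x + w -> Ccont_on (fun t => G (s, t)) a b.
Proof.
  intros H ? ? ? ? t. rewrite Rmin_left, Rmax_right by assumption. intros Ht.
  apply Cdiff_Ccont_v, H; lra.
Qed.

Lemma rect_int_split_h G x y w h : 0 <= w -> 0 <= h -> diff_on_rect G x y (w + w) h ->
  rect_int G x y (w + w) h = (rect_int G x y w h + rect_int G (x + w)%R y w h)%C.
Proof.
  intros Hw Hh H. unfold rect_int. replace (x + (w + w)) with (x + w + w) by ring.
  rewrite <- (CInt_Chasles (fun s => G (s, y)) x (x + w) (x + w + w));
    [|apply (diff_Ccont_on_h _ _ _ _ _ _ _ _ H); lra..].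
  rewrite <- (CInt_Chasles (fun s => G (s, y + h)) x (x + w) (x + w + w));
    [|apply (diff_Ccont_on_h _ _ _ _ _ _ _ _ H); lra..].
  ring.
Qed.

Lemma rect_int_split_v G x y w h : 0 <= w -> 0 <= h -> diff_on_rect G x y w (h + h) ->
  rect_int G x y w (h + h) = (rect_int G x y w h + rect_int G x (y + h)%R w h)%C.
Proof.
  intros Hw Hh H. unfold rect_int. replace (y + (h + h)) with (y + h + h) by ring.
  rewrite <- (CInt_Chasles (fun t => G (x, t)) y (y + h) (y + h + h));
    [|apply (diff_Ccont_on_v _ _ _ _ _ _ _ _ H); lra..].
  rewrite <- (CInt_Chasles (fun t => G (x + w, t)) y (y + h) (y + h + h));
    [|apply (diff_Ccont_on_v _ _ _ _ _ _ _ _ H); lra..].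
  ring.
Qed.

Lemma CInt_affine (al be : C) a b :
  CInt (fun s => al + be * RtoC s)%C a b = (al * RtoC (b - a)%R + be * RtoC ((b * b - a * a) / 2)%R)%C.
Proof.
  assert (Hid : Ccont_on (fun s => RtoC s) a b).
  { intros t _. apply Ccont_continuous_R, continuous_id. }
  assert (Hm : Ccont_on (fun s => be * RtoC s)%C a b).
  { intros t Ht. apply Ccont_mult; [apply Ccont_const | apply Hid, Ht]. }
  rewrite CInt_plus; [|intros t _; apply Ccont_const | exact Hm].
  rewrite CInt_const, CInt_mult_l, CInt_id by exact Hid. reflexivity.
Qed.

(** Explicit integration. It allows the linear approximation of [G] at a point to be subtracted
    without changing the contour integral. *)
Lemma rect_int_affine (al be : C) x y w h :
  rect_int (fun z => al + be * z)%C x y w h = RtoC 0.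
Proof.
  unfold rect_int.
  rewrite (CInt_ext (fun s => al + be * (s, y))%C (fun s => (al + be * (Ci * RtoC y)) + be * RtoC s)%C)
    by (intros t _; apply C_ext; simpl; ring).
  rewrite (CInt_ext (fun s => al + be * (s, (y + h)%R))%C (fun s => (al + be * (Ci * RtoC (y + h)%R)) + be * RtoC s)%C)
    by (intros t _; apply C_ext; simpl; ring).
  rewrite (CInt_ext (fun t => al + be * ((x + w)%R, t))%C (fun t => (al + be * RtoC (x + w)%R) + (be * Ci) * RtoC t)%C)
    by (intros t _; apply C_ext; simpl; ring).
  rewrite (CInt_ext (fun t => al + be * (x, t))%C (fun t => (al + be * RtoC x) + (be * Ci) * RtoC t)%C)
    by (intros t _; apply C_ext; simpl; ring).
  rewrite !CInt_affine. apply C_ext; simpl; field.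
Qed.

Lemma Cdiff_affine al be z : Cdiff (fun z => al + be * z)%C z.
Proof.
  exists be. intros e He. exists 1; split; [lra|]. intros w _.
  replace (al + be * w - (al + be * z) - be * (w - z))%C with (RtoC 0) by ring.
  rewrite Cmod_0. pose proof (Cmod_ge_0 (w - z)). nra.
Qed.

Lemma Cdiff_minus F G z : Cdiff F z -> Cdiff G z -> Cdiff (fun z => F z - G z)%C z.
Proof.
  intros [D1 H1] [D2 H2]. exists (D1 - D2)%C. intros e He.
  destruct (H1 (e/2)) as (d1 & Hd1 & K1); [lra|]. destruct (H2 (e/2)) as (d2 & Hd2 & K2); [lra|].
  exists (Rmin d1 d2). split; [apply Rmin_glb_lt; assumption|]. intros w Hw.
  assert (A1 : Cmod (w - z) < d1) by (eapply Rlt_le_trans; [exact Hw | apply Rmin_l]).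
  assert (A2 : Cmod (w - z) < d2) by (eapply Rlt_le_trans; [exact Hw | apply Rmin_r]).
  specialize (K1 w A1). specialize (K2 w A2).
  replace (F w - G w - (F z - G z) - (D1 - D2) * (w - z))%C
    with ((F w - F z - D1 * (w - z)) + - (G w - G z - D2 * (w - z)))%C by ring.
  eapply Rle_trans; [apply Cmod_triangle|]. rewrite Cmod_opp. lra.
Qed.

Lemma rect_int_minus F G x y w h : 0 <= w -> 0 <= h ->
  diff_on_rect F x y w h -> diff_on_rect G x y w h ->
  rect_int (fun z => F z - G z)%C x y w h = (rect_int F x y w h - rect_int G x y w h)%C.
Proof.
  intros Hw Hh HF HG. unfold rect_int.
  rewrite (CInt_minus (fun s => F (s, y)) (fun s => G (s, y)));
    [|apply (diff_Ccont_on_h _ _ _ _ _ _ _ _ HF); lra | apply (diff_Ccont_on_h _ _ _ _ _ _ _ _ HG); lra].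
  rewrite (CInt_minus (fun s => F (s, (y + h)%R)) (fun s => G (s, (y + h)%R)));
    [|apply (diff_Ccont_on_h _ _ _ _ _ _ _ _ HF); lra | apply (diff_Ccont_on_h _ _ _ _ _ _ _ _ HG); lra].
  rewrite (CInt_minus (fun t => F (x, t)) (fun t => G (x, t)));
    [|apply (diff_Ccont_on_v _ _ _ _ _ _ _ _ HF); lra | apply (diff_Ccont_on_v _ _ _ _ _ _ _ _ HG); lra].
  rewrite (CInt_minus (fun t => F ((x + w)%R, t)) (fun t => G ((x + w)%R, t)));
    [|apply (diff_Ccont_on_v _ _ _ _ _ _ _ _ HF); lra | apply (diff_Ccont_on_v _ _ _ _ _ _ _ _ HG); lra].
  ring.
Qed.

Lemma rect_int_bound G x y w h M : 0 <= w -> 0 <= h -> diff_on_rect G x y w h ->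
  (forall s t, x <= s <= x + w -> y <= t <= y + h -> Cmod (G (s, t)) <= M) ->
  Cmod (rect_int G x y w h) <= 2 * (w + h) * M.
Proof.
  intros Hw Hh H HM. unfold rect_int.
  assert (A1 : Cmod (CInt (fun s => G (s, y)) x (x + w)) <= (x + w - x) * M).
  { apply Cmod_CInt_le_const; [lra | apply (diff_Ccont_on_h _ _ _ _ _ _ _ _ H); lra|].
    intros; apply HM; lra. }
  assert (A2 : Cmod (CInt (fun s => G (s, y + h)) x (x + w)) <= (x + w - x) * M).
  { apply Cmod_CInt_le_const; [lra | apply (diff_Ccont_on_h _ _ _ _ _ _ _ _ H); lra|].
    intros; apply HM; lra. }
  assert (A3 : Cmod (CInt (fun t => G (x, t)) y (y + h)) <= (y + h - y) * M).
  { apply Cmod_CInt_le_const; [lra | apply (diff_Ccont_on_v _ _ _ _ _ _ _ _ H); lra|].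
    intros; apply HM; lra. }
  assert (A4 : Cmod (CInt (fun t => G (x + w, t)) y (y + h)) <= (y + h - y) * M).
  { apply Cmod_CInt_le_const; [lra | apply (diff_Ccont_on_v _ _ _ _ _ _ _ _ H); lra|].
    intros; apply HM; lra. }
  unfold Cminus.
  eapply Rle_trans; [apply Cmod_triangle|]. rewrite Cmod_opp, Cmod_mult, Cmod_Ci.
  eapply Rle_trans; [apply Rplus_le_compat_r, Cmod_triangle|]. rewrite Cmod_opp.
  eapply Rle_trans; [apply Rplus_le_compat_r, Rplus_le_compat_r, Cmod_triangle|].
  rewrite Cmod_mult, Cmod_Ci. lra.
Qed.

(** One bisection of the rectangle of sides [w + w], [h + h]: keep a quadrant that carries at least
    a quarter of the contour integral. The decidability of the real order makes this a function,
    with the fourth quadrant as default. *)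
Definition quarter_step (G : C -> C) (w h : R) (p : R * R) : R * R :=
  let big x y := Rle_dec (Cmod (rect_int G (fst p) (snd p) (w + w) (h + h)))
                         (4 * Cmod (rect_int G x y w h)) in
  let (x, y) := p in
  if big x y then (x, y) else if big (x + w) y then (x + w, y)
  else if big x (y + h) then (x, y + h) else (x + w, y + h).

Lemma quarter_step_spec G w h x y : 0 <= w -> 0 <= h -> diff_on_rect G x y (w + w) (h + h) ->
  let p := quarter_step G w h (x, y) in
  (x <= fst p <= x + w /\ y <= snd p <= y + h) /\
  Cmod (rect_int G x y (w + w) (h + h)) <= 4 * Cmod (rect_int G (fst p) (snd p) w h).
Proof.
  intros Hw Hh H.
  assert (E : rect_int G x y (w + w) (h + h) =
    ((rect_int G x y w h + rect_int G x (y + h)%R w h)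
    + (rect_int G (x + w)%R y w h + rect_int G (x + w)%R (y + h)%R w h))%C).
  { rewrite rect_int_split_h by (try assumption; lra).
    rewrite !rect_int_split_v; try assumption; try reflexivity;
    apply (diff_on_rect_sub _ _ _ _ _ _ _ _ _ H); lra. }
  unfold quarter_step, fst, snd.
  repeat destruct Rle_dec; (split; [clear - Hw Hh; lra|]); try assumption.
  (* Only the default quadrant is left: if it too fell short of a quarter, the four contributions
     could not add up to the whole. *)
  apply (f_equal Cmod) in E. revert n n0 n1 E.
  generalize (Cmod (rect_int G x y (w + w) (h + h))).
  generalize (rect_int G x y w h) (rect_int G x (y + h) w h)
    (rect_int G (x + w) y w h) (rect_int G (x + w) (y + h) w h).
  intros c1 c2 c3 c4 r n n0 n1 E.
  pose proof (Cmod_triangle (c1 + c2) (c3 + c4)).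
  pose proof (Cmod_triangle c1 c2).
  pose proof (Cmod_triangle c3 c4).
  lra.
Qed.

Fixpoint quarter_seq (G : C -> C) (x y w h : R) (n : nat) : R * R :=
  match n with
  | O => (x, y)
  | S n => quarter_step G (w / 2 ^ S n) (h / 2 ^ S n) (quarter_seq G x y w h n)
  end.

Lemma half_pow w n : w / 2 ^ n = w / 2 ^ S n + w / 2 ^ S n.
Proof. simpl. field. apply pow_nonzero; lra. Qed.

Lemma quarter_seq_spec G x y w h n : 0 <= w -> 0 <= h -> diff_on_rect G x y w h ->
  let p := quarter_seq G x y w h n in
  (x <= fst p /\ fst p + w / 2 ^ n <= x + w) /\ (y <= snd p /\ snd p + h / 2 ^ n <= y + h) /\
  Cmod (rect_int G x y w h) <= 4 ^ n * Cmod (rect_int G (fst p) (snd p) (w / 2 ^ n) (h / 2 ^ n)).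
Proof.
  intros Hw Hh H. induction n as [|n IH].
  - simpl. rewrite !Rdiv_1_r. repeat split; lra.
  - cbv zeta in IH |- *.
    change (quarter_seq G x y w h (S n)) with
      (quarter_step G (w / 2 ^ S n) (h / 2 ^ S n) (quarter_seq G x y w h n)). destruct (quarter_seq G x y w h n) as [u v].
    simpl fst in IH; simpl snd in IH. destruct IH as (A & B & D).
    assert (0 < 2 ^ S n) by (apply pow_lt; lra).
    assert (0 <= w / 2 ^ S n) by (apply Rdiv_le_0_compat; lra).
    assert (0 <= h / 2 ^ S n) by (apply Rdiv_le_0_compat; lra).
    rewrite (half_pow w n) in *. rewrite (half_pow h n) in *.
    destruct (quarter_step_spec G (w / 2 ^ S n) (h / 2 ^ S n) u v) as [E1 E2]; try assumption.
    { apply (diff_on_rect_sub _ _ _ _ _ _ _ _ _ H); lra. }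
    destruct (quarter_step G (w / 2 ^ S n) (h / 2 ^ S n) (u, v)) as [u' v'].
    cbn [fst snd] in *.
    split; [clear D E2; repeat split; lra|]. split; [clear D E2; repeat split; lra|].
    eapply Rle_trans; [exact D|]. change (4 ^ S n) with (4 * 4 ^ n).
    rewrite (Rmult_comm 4), Rmult_assoc.
    apply Rmult_le_compat_l; [left; apply pow_lt; lra | exact E2].
Qed.

Lemma quarter_seq_step G x y w h n : 0 <= w -> 0 <= h -> diff_on_rect G x y w h ->
  fst (quarter_seq G x y w h n) <= fst (quarter_seq G x y w h (S n))
    /\ fst (quarter_seq G x y w h (S n)) + w / 2 ^ S n <= fst (quarter_seq G x y w h n) + w / 2 ^ n
  /\ snd (quarter_seq G x y w h n) <= snd (quarter_seq G x y w h (S n))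
    /\ snd (quarter_seq G x y w h (S n)) + h / 2 ^ S n <= snd (quarter_seq G x y w h n) + h / 2 ^ n.
Proof.
  intros Hw Hh H. pose proof (quarter_seq_spec G x y w h n Hw Hh H) as P.
  cbv zeta in P. change (quarter_seq G x y w h (S n)) with
      (quarter_step G (w / 2 ^ S n) (h / 2 ^ S n) (quarter_seq G x y w h n)).
  destruct (quarter_seq G x y w h n) as [u v].
  simpl fst in P; simpl snd in P. destruct P as (A & B & D).
  assert (0 < 2 ^ S n) by (apply pow_lt; lra).
  assert (0 <= w / 2 ^ S n) by (apply Rdiv_le_0_compat; lra).
  assert (0 <= h / 2 ^ S n) by (apply Rdiv_le_0_compat; lra).
  rewrite (half_pow w n) in *. rewrite (half_pow h n) in *.
  destruct (quarter_step_spec G (w / 2 ^ S n) (h / 2 ^ S n) u v) as [E1 E2]; try assumption.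
  { apply (diff_on_rect_sub _ _ _ _ _ _ _ _ _ H); lra. }
  destruct (quarter_step G (w / 2 ^ S n) (h / 2 ^ S n) (u, v)) as [u' v'].
  cbn [fst snd] in *. clear D E2. lra.
Qed.

(** Every left endpoint lies below every right endpoint, so the supremum of the left endpoints
    belongs to all the intervals. It is applied to each coordinate of the bisected rectangles. *)
Lemma nested_point (u : nat -> R) (w : R) : 0 <= w ->
  (forall n, u n <= u (S n) /\ u (S n) + w / 2 ^ S n <= u n + w / 2 ^ n) ->
  exists l, forall n, u n <= l <= u n + w / 2 ^ n.
Proof.
  intros Hw H.
  assert (Hp : forall n, 0 <= w / 2 ^ n) by (intros; apply Rdiv_le_0_compat; [lra | apply pow_lt; lra]).
  assert (up : forall n m, u n <= u (n + m)%nat).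
  { intros n m. induction m as [|m IH]; [rewrite Nat.add_0_r; lra|].
    rewrite Nat.add_succ_r. pose proof (H (n + m)%nat). lra. }
  assert (dn : forall n m, u (n + m)%nat + w / 2 ^ (n + m) <= u n + w / 2 ^ n).
  { intros n m. induction m as [|m IH]; [rewrite Nat.add_0_r; lra|].
    rewrite Nat.add_succ_r. pose proof (H (n + m)%nat). lra. }
  assert (Hb : forall n m, u m <= u n + w / 2 ^ n).
  { intros n m. destruct (Nat.le_ge_cases n m) as [L|L].
    - replace m with (n + (m - n))%nat by lia. pose proof (dn n (m - n)%nat).
      pose proof (Hp (n + (m - n))%nat). lra.
    - pose proof (up m (n - m)%nat). replace (m + (n - m))%nat with n in H0 by lia.
      pose proof (Hp n). lra. }
  destruct (completeness (fun x => exists n, x = u n)) as [l [Hl1 Hl2]].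
  - exists (u 0%nat + w / 2 ^ 0). intros x [n ->]. apply Hb.
  - exists (u 0%nat), 0%nat. reflexivity.
  - exists l. intros n. split; [apply Hl1; exists n; reflexivity|].
    apply Hl2. intros x [m ->]. apply Hb.
Qed.

Lemma Cmod_pair_le a b c : Rabs a <= c -> Rabs b <= c -> Cmod (a, b) <= 2 * c.
Proof. intros H1 H2. eapply Rle_trans; [apply Cmod_le_sum|]. simpl. lra. Qed.

(** After [n] bisections the integral has grown by at most [4 ^ n] relative to the small rectangle.
    There, perimeter and approximation error are both of order [2 ^ (-n)], the error with an extra
    factor [e], so the powers cancel and [e] remains. *)
Lemma goursat G x y w h : 0 <= w -> 0 <= h -> diff_on_rect G x y w h ->
  rect_int G x y w h = RtoC 0.
Proof.
  intros Hw Hh H.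
  destruct (nested_point (fun n => fst (quarter_seq G x y w h n)) w Hw) as [lx Hx].
  { intros n. pose proof (quarter_seq_step G x y w h n Hw Hh H). split; apply H0. }
  destruct (nested_point (fun n => snd (quarter_seq G x y w h n)) h Hh) as [ly Hy].
  { intros n. pose proof (quarter_seq_step G x y w h n Hw Hh H). split; apply H0. }
  (* The constant is the perimeter factor [2 (w + h)] times the factor [2 (w + h)] that bounds
     distances to the limit point. *)
  apply Cmod_eq_0_le with (M := 4 * (w + h) ^ 2). intros e He.
  assert (HD : Cdiff G (lx, ly)).
  { apply H.
    - pose proof (Hx 0%nat) as Hx0. simpl in Hx0. lra.
    - pose proof (Hy 0%nat) as Hy0. simpl in Hy0. lra. }
  destruct HD as [D HD]. destruct (HD e He) as (d & Hd & K).
  (* [Cmod_pair_le] bounds distances in the small rectangle by twice the sum of its sides; half of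
     [d] therefore puts it inside the disc of radius [d]. *)
  assert (exists n, (w + h) / 2 ^ n < d / 2) as [n Hn].
  { destruct (pow_lt_1_zero (/ 2) ltac:(rewrite Rabs_pos_eq; lra) (d / (2 * (w + h + 1)))) as [n Hn].
    { apply Rdiv_lt_0_compat; lra. }
    exists n. specialize (Hn n (le_n n)). rewrite pow_inv, Rabs_pos_eq in Hn.
    2:{ left; apply Rinv_0_lt_compat, pow_lt; lra. }
    assert (0 < 2 ^ n) by (apply pow_lt; lra).
    apply Rle_lt_trans with ((w + h + 1) * / 2 ^ n).
    { unfold Rdiv. apply Rmult_le_compat_r; [left; apply Rinv_0_lt_compat; lra | lra]. }
    apply Rmult_lt_compat_l with (r := w + h + 1) in Hn; [|lra].
    replace ((w + h + 1) * (d / (2 * (w + h + 1)))) with (d / 2) in Hn by (field; lra). exact Hn. }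
  specialize (Hx n). specialize (Hy n). cbv beta in Hx, Hy.
  pose proof (quarter_seq_spec G x y w h n Hw Hh H) as P. cbv zeta in P.
  destruct (quarter_seq G x y w h n) as [u v]. cbn [fst snd] in *. destruct P as (A & B & P).
  assert (Hp : 0 < 2 ^ n) by (apply pow_lt; lra).
  assert (Hw' : 0 <= w / 2 ^ n) by (apply Rdiv_le_0_compat; lra).
  assert (Hh' : 0 <= h / 2 ^ n) by (apply Rdiv_le_0_compat; lra).
  replace ((w + h) / 2 ^ n) with (w / 2 ^ n + h / 2 ^ n) in Hn by (field; lra).
  assert (HS : diff_on_rect G u v (w / 2 ^ n) (h / 2 ^ n)).
  { apply (diff_on_rect_sub _ _ _ _ _ _ _ _ _ H); clear P; lra. }
  set (L := fun z : C => ((G (lx, ly) - D * (lx, ly)) + D * z)%C).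
  assert (HL : diff_on_rect L u v (w / 2 ^ n) (h / 2 ^ n)).
  { intros s t _ _. apply Cdiff_affine. }
  assert (E : rect_int G u v (w / 2 ^ n) (h / 2 ^ n)
     = rect_int (fun z => G z - L z)%C u v (w / 2 ^ n) (h / 2 ^ n)).
  { rewrite rect_int_minus by assumption. unfold L. rewrite rect_int_affine. ring. }
  assert (Bd : Cmod (rect_int G u v (w / 2 ^ n) (h / 2 ^ n))
     <= 2 * (w / 2 ^ n + h / 2 ^ n) * (e * (2 * (w / 2 ^ n + h / 2 ^ n)))).
  { rewrite E. apply rect_int_bound; try assumption.
    - intros s t Hs Ht. apply Cdiff_minus; [apply HS | apply HL]; assumption.
    - intros s t Hs Ht.
      assert (Hc : Cmod ((s, t) - (lx, ly)) <= 2 * (w / 2 ^ n + h / 2 ^ n)).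
      { apply Cmod_pair_le; simpl; apply Rabs_le; clear P E; lra. }
      unfold L. replace (G (s, t) - (G (lx, ly) - D * (lx, ly) + D * (s, t)))%C
        with (G (s, t) - G (lx, ly) - D * ((s, t) - (lx, ly)))%C by ring.
      eapply Rle_trans; [apply K; clear P E; lra|]. apply Rmult_le_compat_l; clear P E; lra. }
  eapply Rle_trans; [exact P|].
  apply Rle_trans with (4 ^ n * (2 * (w / 2 ^ n + h / 2 ^ n) * (e * (2 * (w / 2 ^ n + h / 2 ^ n))))).
  { apply Rmult_le_compat_l; [left; apply pow_lt; lra | exact Bd]. }
  replace 4 with (2 * 2) at 1 by ring. rewrite Rpow_mult_distr.
  right. field. lra.
Qed.

(** * Complex powers of positive reals *)

Lemma MVT_origin (g dg : R -> R) (b : R) : (forall x, is_derive g x (dg x)) ->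
  exists c, Rabs c <= Rabs b /\ g b = g 0 + dg c * b.
Proof.
  intros H. destruct (MVT_gen g 0 b dg) as (c & Hc & E).
  - intros x _. apply H.
  - intros x _. apply continuity_pt_filterlim.
    apply (ex_derive_continuous (V := R_NormedModule)). eexists; apply H.
  - exists c. split; [|lra].
    unfold Rmin, Rmax in Hc. destruct Rle_dec; unfold Rabs; destruct (Rcase_abs c), (Rcase_abs b); lra.
Qed.

Lemma Rabs_sin_le x : Rabs (sin x) <= Rabs x.
Proof.
  destruct (MVT_origin sin cos x is_derive_sin) as (c & _ & E). rewrite sin_0 in E.
  replace (sin x) with (cos c * x) by lra. rewrite Rabs_mult.
  pose proof (COS_bound c). assert (Rabs (cos c) <= 1) by (apply Rabs_le; lra).
  pose proof (Rabs_pos x). nra.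
Qed.

Lemma Rabs_cos_sub_1 x : Rabs (cos x - 1) <= Rabs x * Rabs x.
Proof.
  destruct (MVT_origin cos (fun x => - sin x) x is_derive_cos) as (c & Hc & E). rewrite cos_0 in E.
  replace (cos x - 1) with (- sin c * x) by lra. rewrite Rabs_mult, Rabs_Ropp.
  pose proof (Rabs_sin_le c). pose proof (Rabs_pos x). nra.
Qed.

Lemma Rabs_sin_sub_id x : Rabs x <= 1 -> Rabs (sin x - x) <= Rabs x * Rabs x.
Proof.
  intros Hx. destruct (MVT_origin sin cos x is_derive_sin) as (c & Hc & E). rewrite sin_0 in E.
  replace (sin x - x) with ((cos c - 1) * x) by lra. rewrite Rabs_mult.
  pose proof (Rabs_cos_sub_1 c). pose proof (Rabs_pos x). pose proof (Rabs_pos c). nra.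
Qed.

Lemma Rabs_exp_sub_1 x : Rabs x <= 1 -> Rabs (exp x - 1) <= 3 * Rabs x.
Proof.
  intros Hx. destruct (MVT_origin exp exp x is_derive_exp) as (c & Hc & E). rewrite exp_0 in E.
  replace (exp x - 1) with (exp c * x) by lra. rewrite Rabs_mult, (Rabs_pos_eq (exp c)) by (left; apply exp_pos).
  assert (exp c <= 3).
  { apply Rle_trans with (exp 1); [|apply exp_le_3].
    destruct (Req_dec c 1) as [->|]; [lra|]. left; apply exp_increasing.
    pose proof (Rle_abs c). lra. }
  pose proof (Rabs_pos x). nra.
Qed.

Lemma Rabs_exp_sub_lin x : Rabs x <= 1 -> Rabs (exp x - 1 - x) <= 3 * (Rabs x * Rabs x).
Proof.
  intros Hx. destruct (MVT_origin exp exp x is_derive_exp) as (c & Hc & E). rewrite exp_0 in E.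
  replace (exp x - 1 - x) with ((exp c - 1) * x) by lra. rewrite Rabs_mult.
  pose proof (Rabs_exp_sub_1 c). pose proof (Rabs_pos x). pose proof (Rabs_pos c). nra.
Qed.

Lemma Cmod_polar r b : 0 <= r -> Cmod (r * cos b, r * sin b) = r.
Proof.
  intros Hr. unfold Cmod, fst, snd. rewrite <- (sqrt_pow2 r Hr) at 3. f_equal.
  pose proof (sin2_cos2 b) as H. unfold Rsqr in H. nra.
Qed.

Lemma Cmod_Rcpow x s : Cmod (Rcpow x s) = exp (Re s * ln x).
Proof. apply Cmod_polar. left; apply exp_pos. Qed.

Lemma Rcpow_plus x s s' : Rcpow x (s + s') = (Rcpow x s * Rcpow x s')%C.
Proof.
  unfold Rcpow. rewrite Re_plus, Im_plus, !Rmult_plus_distr_r, exp_plus, cos_plus, sin_plus.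
  apply C_ext; simpl; ring.
Qed.

Lemma Rcpow_mult_base x y s : 0 < x -> 0 < y -> Rcpow (x * y) s = (Rcpow x s * Rcpow y s)%C.
Proof.
  intros Hx Hy. unfold Rcpow. rewrite ln_mult by assumption.
  rewrite !Rmult_plus_distr_l, exp_plus, cos_plus, sin_plus.
  apply C_ext; simpl; ring.
Qed.

(** With [a] and [b] the real and imaginary parts of [s ln x], the real part of the error costs
    [3 + 4] and the imaginary part [4 + 3]: here [3] comes from the expansions of [exp], and [4]
    bounds [exp a] in front of those of [cos] and [sin]. *)
Lemma Rcpow_lin_approx x s : Rabs (Re s * ln x) <= 1 -> Rabs (Im s * ln x) <= 1 ->
  Cmod (Rcpow x s - 1 - s * RtoC (ln x)) <= 14 * (Cmod s * Rabs (ln x)) ^ 2.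
Proof.
  intros Ha Hb. set (a := Re s * ln x) in *. set (b := Im s * ln x) in *.
  pose proof (Rabs_exp_sub_lin a Ha) as E1. pose proof (Rabs_exp_sub_1 a Ha) as E2.
  pose proof (Rabs_cos_sub_1 b) as E3. pose proof (Rabs_sin_sub_id b Hb) as E4.
  assert (La : Rabs a <= Cmod s * Rabs (ln x)).
  { unfold a. rewrite Rabs_mult. apply Rmult_le_compat_r; [apply Rabs_pos | apply re_le_Cmod]. }
  assert (Lb : Rabs b <= Cmod s * Rabs (ln x)).
  { unfold b. rewrite Rabs_mult. apply Rmult_le_compat_r; [apply Rabs_pos | apply im_le_Cmod]. }
  set (r := Cmod s * Rabs (ln x)) in *.
  pose proof (Rabs_pos a). pose proof (Rabs_pos b).
  assert (H3 : exp a <= 4) by (pose proof (Rle_abs (exp a - 1)); lra).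
  pose proof (exp_pos a).
  eapply Rle_trans; [apply Cmod_le_sum|].
  replace (Re (Rcpow x s - 1 - s * RtoC (ln x))) with ((exp a - 1 - a) + exp a * (cos b - 1))
    by (unfold a, b; simpl; unfold Re, Im; ring).
  replace (Im (Rcpow x s - 1 - s * RtoC (ln x))) with (exp a * (sin b - b) + (exp a - 1) * b)
    by (unfold a, b; simpl; unfold Re, Im; ring).
  pose proof (Rabs_triang (exp a - 1 - a) (exp a * (cos b - 1))) as T1.
  pose proof (Rabs_triang (exp a * (sin b - b)) ((exp a - 1) * b)) as T2.
  rewrite !Rabs_mult, !(Rabs_pos_eq (exp a)) in * by lra.
  assert (Rabs a * Rabs a <= r * r) by nra.
  assert (Rabs b * Rabs b <= r * r) by nra.
  assert (Rabs a * Rabs b <= r * r) by nra.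
  assert (exp a * Rabs (cos b - 1) <= 4 * (r * r)).
  { pose proof (Rabs_pos (cos b - 1)). nra. }
  assert (exp a * Rabs (sin b - b) <= 4 * (r * r)).
  { pose proof (Rabs_pos (sin b - b)). nra. }
  assert (Rabs (exp a - 1) * Rabs b <= 3 * (r * r)).
  { pose proof (Rabs_pos (exp a - 1)). nra. }
  replace (r ^ 2) with (r * r) by ring. lra.
Qed.

Lemma Cdiff_Rcpow_opp x z : Cdiff (fun s => Rcpow x (- s)) z.
Proof.
  set (L := Rabs (ln x)). pose proof (Rabs_pos (ln x)) as HL. fold L in HL.
  set (P := exp (Re (- z)%C * ln x)). assert (HP : 0 < P) by apply exp_pos.
  exists (- (Rcpow x (- z) * RtoC (ln x)))%C. intros e He.
  (* The first bound brings [s ln x] into the range of [Rcpow_lin_approx]; the second turns its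
     quadratic error into [e] times the increment. [L + 1] replaces [L] because [ln x] may
     vanish. *)
  set (d := Rmin (/ (L + 1)) (e / (14 * P * (L + 1) ^ 2))).
  assert (Hd : 0 < d).
  { apply Rmin_glb_lt; [apply Rinv_0_lt_compat; lra|]. apply Rdiv_lt_0_compat; [lra|].
    repeat apply Rmult_lt_0_compat; lra. }
  exists d. split; [exact Hd|]. intros w Hw.
  set (s := (z - w)%C).
  replace (Rcpow x (- w) - Rcpow x (- z) - - (Rcpow x (- z) * RtoC (ln x)) * (w - z))%C
    with (Rcpow x (- z) * (Rcpow x s - 1 - s * RtoC (ln x)))%C.
  2:{ replace (- w)%C with (- z + s)%C by (unfold s; ring). rewrite Rcpow_plus. unfold s; ring. }
  rewrite Cmod_mult, Cmod_Rcpow. fold P.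
  assert (Hs : Cmod s = Cmod (w - z)) by apply Cmod_minus_sym.
  rewrite <- Hs in *. pose proof (Cmod_ge_0 s) as H0.
  assert (H1 : Cmod s * (L + 1) <= 1).
  { apply Rle_trans with (d * (L + 1)); [apply Rmult_le_compat_r; lra|].
    apply Rle_trans with (/ (L + 1) * (L + 1)); [apply Rmult_le_compat_r; [lra|apply Rmin_l]|].
    right; field; lra. }
  assert (H2 : Cmod s * (14 * P * (L + 1) ^ 2) <= e).
  { assert (0 < 14 * P * (L + 1) ^ 2) by (repeat apply Rmult_lt_0_compat; lra).
    apply Rle_trans with (d * (14 * P * (L + 1) ^ 2)); [apply Rmult_le_compat_r; lra|].
    apply Rle_trans with (e / (14 * P * (L + 1) ^ 2) * (14 * P * (L + 1) ^ 2));
      [apply Rmult_le_compat_r; [lra|apply Rmin_r]|].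
    right; field; lra. }
  pose proof (re_le_Cmod s) as R1. pose proof (im_le_Cmod s) as R2.
  assert (A := Rcpow_lin_approx x s). rewrite !Rabs_mult in A. fold L in A.
  pose proof (Rabs_pos (Re s)). pose proof (Rabs_pos (Im s)).
  specialize (A ltac:(nra) ltac:(nra)).
  apply Rle_trans with (P * (14 * (Cmod s * L) ^ 2)); [apply Rmult_le_compat_l; lra|].
  apply Rle_trans with (Cmod s * (14 * P * (L + 1) ^ 2) * Cmod s); [|apply Rmult_le_compat_r; lra].
  replace (P * (14 * (Cmod s * L) ^ 2)) with ((14 * P * Cmod s ^ 2) * L ^ 2) by ring.
  replace (Cmod s * (14 * P * (L + 1) ^ 2) * Cmod s) with ((14 * P * Cmod s ^ 2) * (L + 1) ^ 2) by ring.
  apply Rmult_le_compat_l; [|nra]. apply Rmult_le_pos; [lra | nra].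
Qed.

Lemma Cdiff_mult F G z : Cdiff F z -> Cdiff G z -> Cdiff (fun z => F z * G z)%C z.
Proof.
  intros HF HG. pose proof (Cdiff_cont _ _ HG) as CG.
  destruct HF as [D1 H1]. destruct HG as [D2 H2].
  exists (D1 * G z + F z * D2)%C. intros e He.
  pose proof (Cmod_ge_0 (F z)) as P1. pose proof (Cmod_ge_0 (G z)) as P2. pose proof (Cmod_ge_0 D1) as P3.
  set (M := Cmod (F z) + Cmod (G z) + Cmod D1 + 2).
  set (e' := e / (3 * M)). assert (He' : 0 < e') by (apply Rdiv_lt_0_compat; unfold M; lra).
  assert (EM : e' * M = e / 3) by (unfold e'; field; unfold M; lra).
  destruct (H1 e' He') as (d1 & Hd1 & K1). destruct (H2 e' He') as (d2 & Hd2 & K2).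
  destruct (CG (Rmin 1 e')) as (d3 & Hd3 & K3); [apply Rmin_glb_lt; lra|].
  exists (Rmin d1 (Rmin d2 d3)). split; [repeat apply Rmin_glb_lt; assumption|]. intros w Hw.
  assert (A1 : Cmod (w - z) < d1) by (eapply Rlt_le_trans; [exact Hw | apply Rmin_l]).
  assert (A23 : Cmod (w - z) < Rmin d2 d3) by (eapply Rlt_le_trans; [exact Hw | apply Rmin_r]).
  assert (A2 : Cmod (w - z) < d2) by (eapply Rlt_le_trans; [exact A23 | apply Rmin_l]).
  assert (A3 : Cmod (w - z) < d3) by (eapply Rlt_le_trans; [exact A23 | apply Rmin_r]).
  specialize (K1 w A1). specialize (K2 w A2). specialize (K3 w A3).
  assert (B1 : Cmod (G w - G z) < 1) by (eapply Rlt_le_trans; [exact K3 | apply Rmin_l]).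
  assert (B2 : Cmod (G w - G z) < e') by (eapply Rlt_le_trans; [exact K3 | apply Rmin_r]).
  replace (F w * G w - F z * G z - (D1 * G z + F z * D2) * (w - z))%C with
    ((F w - F z - D1 * (w - z)) * G w + (F z * (G w - G z - D2 * (w - z))
      + D1 * (w - z) * (G w - G z)))%C by ring.
  eapply Rle_trans; [apply Cmod_triangle|].
  eapply Rle_trans; [apply Rplus_le_compat_l, Cmod_triangle|].
  rewrite !Cmod_mult.
  pose proof (Cmod_rev_triangle (G w) (G z)) as B3.
  revert K1 K2 B1 B2 B3. generalize (Cmod_ge_0 (w - z)) (Cmod_ge_0 (G w)) (Cmod_ge_0 (G w - G z)).
  generalize (Cmod (w - z)) (Cmod (G w)) (Cmod (G w - G z))
    (Cmod (F w - F z - D1 * (w - z))) (Cmod (G w - G z - D2 * (w - z))).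
  intros r gw dg x1 x2 Hr Hgw Hdg K1 K2 B1 B2 B3.
  assert (x1 * gw <= e' * M * r).
  { apply Rle_trans with (e' * r * gw); [apply Rmult_le_compat_r; lra|].
    replace (e' * M * r) with (e' * r * M) by ring. apply Rmult_le_compat_l; [nra | unfold M; lra]. }
  assert (Cmod (F z) * x2 <= e' * M * r).
  { apply Rle_trans with (Cmod (F z) * (e' * r)); [apply Rmult_le_compat_l; lra|].
    replace (e' * M * r) with (M * (e' * r)) by ring. apply Rmult_le_compat_r; [nra | unfold M; lra]. }
  assert (Cmod D1 * r * dg <= e' * M * r).
  { apply Rle_trans with (Cmod D1 * r * e'); [apply Rmult_le_compat_l; nra|].
    replace (e' * M * r) with (M * r * e') by ring. repeat apply Rmult_le_compat_r; try lra. unfold M; lra. }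
  rewrite EM in *. lra.
Qed.

Lemma holomorphic_at_Cdiff F z : holomorphic_at F z -> Cdiff F z.
Proof.
  intros (d & Hd & H). destruct (H z) as [D HD].
  { replace (z - z)%C with (RtoC 0) by ring. rewrite Cmod_0. exact Hd. }
  exists D. intros e He. destruct HD as [_ HD].
  specialize (HD z (fun P HP => HP)). specialize (HD (mkposreal e He)).
  destruct HD as [d' Hd']. exists d'. split; [apply cond_pos|]. intros w Hw.
  specialize (Hd' w Hw).
  unfold norm, minus, plus, opp, scal in Hd'; simpl in Hd'. unfold abs, mult in Hd'; simpl in Hd'.
  replace (F w - F z - D * (w - z))%C with (F w + - F z + - ((w + - z) * D))%C by ring.
  exact Hd'.
Qed.

(** * Integrals over vertical lines *)

(** Only symmetric truncations are considered: these are what a contour shift controls and what the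
    pairing of [t] with [- t] produces. *)
Definition is_line_int (h : R -> C) (l : C) : Prop :=
  forall e, 0 < e -> exists M, forall T, M <= T -> Cmod (CInt h (- T) T - l) <= e.

Lemma is_line_int_unique h l l' : is_line_int h l -> is_line_int h l' -> l = l'.
Proof.
  intros H H'. assert (E : (l - l')%C = RtoC 0).
  { apply Cmod_eq_0_le with (M := 2). intros e He.
    destruct (H e He) as [M HM]. destruct (H' e He) as [M' HM'].
    specialize (HM (Rmax M M') (Rmax_l _ _)). specialize (HM' (Rmax M M') (Rmax_r _ _)).
    pose proof (Cmod_triangle3 l (CInt h (- Rmax M M') (Rmax M M')) l').
    rewrite Cmod_minus_sym in HM. lra. }
  replace l with ((l - l') + l')%C by ring. rewrite E. ring.
Qed.

Lemma atan_le_id y : 0 <= y -> atan y <= y.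
Proof.
  intros Hy. destruct (MVT_origin atan (fun x => / (1 + Rsqr x)) y is_derive_atan) as (c & _ & E).
  rewrite atan_0 in E.
  assert (/ (1 + Rsqr c) <= 1).
  { rewrite <- Rinv_1. apply Rinv_le_contravar; [lra|]. pose proof (Rle_0_sqr c). lra. }
  nra.
Qed.

Lemma atan_tail x : 0 < x -> PI / 2 - atan x <= / x.
Proof.
  intros Hx. pose proof (atan_inv x Hx). pose proof (atan_le_id (/ x)).
  assert (0 < / x) by (apply Rinv_0_lt_compat; lra). lra.
Qed.

Lemma is_RInt_atan a b : is_RInt (fun t => / (1 + t ^ 2)) a b (atan b - atan a).
Proof.
  apply (is_RInt_derive (V := R_CompleteNormedModule) atan (fun t => / (1 + t ^ 2))).
  - intros x _. apply is_derive_Reals, derivable_pt_lim_atan.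
  - intros x _. apply (ex_derive_continuous (V := R_NormedModule)).
    auto_derive. nra.
Qed.

(** The majorant [1 / (1 + t ^ 2)] is used for all line integrals because its primitive is explicit:
    by [atan_tail] the part beyond [M] is at most [/ M], and the whole line contributes [PI]. *)
Lemma Cmod_CInt_atan h K a b : a <= b -> (forall t, Ccont h t) ->
  (forall t, Cmod (h t) <= K * / (1 + t ^ 2)) ->
  Cmod (CInt h a b) <= K * (atan b - atan a).
Proof.
  intros Hab Hc Hb. rewrite <- norm_C_R.
  apply (norm_RInt_le (V := C_R_NormedModule) h (fun t => K * / (1 + t ^ 2)) a b).
  - exact Hab.
  - intros x _. rewrite norm_C_R. apply Hb.
  - apply CInt_is_RInt, Ccont_on_all, Hc.
  - apply (is_RInt_scal (V := R_NormedModule)), is_RInt_atan.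
Qed.

Lemma dominated_cauchy h K M a b a' b' : 0 < M -> (forall t, Ccont h t) -> 0 <= K ->
  (forall t, Cmod (h t) <= K * / (1 + t ^ 2)) ->
  a <= - M -> a' <= - M -> M <= b -> M <= b' ->
  Cmod (CInt h a b - CInt h a' b') <= 2 * K * / M.
Proof.
  intros HM Hc HK Hb.
  assert (half : forall u v, M <= u -> M <= v -> Cmod (CInt h u v) <= K * / M
     /\ Cmod (CInt h (-u) (-v)) <= K * / M).
  { assert (wl : forall u v, M <= u -> u <= v -> Cmod (CInt h u v) <= K * / M
     /\ Cmod (CInt h (-v) (-u)) <= K * / M).
    { intros u v Hu Hv. pose proof (atan_tail u ltac:(lra)). pose proof (atan_bound v).
      assert (/ u <= / M) by (apply Rinv_le_contravar; lra).
      split.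
      - eapply Rle_trans; [apply (Cmod_CInt_atan h K); assumption|]. apply Rmult_le_compat_l; lra.
      - eapply Rle_trans; [apply (Cmod_CInt_atan h K); try assumption; lra|].
        rewrite !atan_opp. apply Rmult_le_compat_l; lra. }
    assert (sw : forall u v, Cmod (CInt h u v) = Cmod (CInt h v u)).
    { intros u v. rewrite <- Cmod_opp. f_equal.
      assert (E : (CInt h u v + CInt h v u = RtoC 0)%C).
      { rewrite CInt_Chasles by (apply Ccont_on_all, Hc).
        apply C_ext; simpl; apply (RInt_point (V := R_CompleteNormedModule)). }
      replace (CInt h v u) with ((CInt h u v + CInt h v u) - CInt h u v)%C by ring.
      rewrite E; ring. }
    intros u v Hu Hv. destruct (Rle_lt_dec u v) as [L|L].
    - rewrite (sw (- u)). apply wl; assumption.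
    - rewrite (sw u v). apply wl; lra. }
  intros Ha Ha' Hb1 Hb1'.
  assert (E : (CInt h a b - CInt h a' b' = CInt h a a' + CInt h b' b)%C).
  { rewrite <- (CInt_Chasles h a a' b), <- (CInt_Chasles h a' b' b) by (apply Ccont_on_all, Hc). ring. }
  rewrite E. eapply Rle_trans; [apply Cmod_triangle|].
  destruct (half (- a) (- a')) as [_ G1]; [lra..|]. rewrite !Ropp_involutive in G1.
  destruct (half b' b) as [G2 _]; [lra..|]. lra.
Qed.

(** The Cauchy criterion on the product filter of the two ends gives one limit that serves twice: as
    the improper integral in which [k_fun] is written, and as the symmetric limit used for contour
    shifts. *)
Lemma dominated_line_int h K : (forall t, Ccont h t) -> 0 <= K ->
  (forall t, Cmod (h t) <= K * / (1 + t ^ 2)) ->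
  exists l, is_RInt_gen (V := C_R_NormedModule) h (Rbar_locally m_infty) (Rbar_locally p_infty) l
    /\ is_line_int h l /\ Cmod l <= K * PI.
Proof.
  intros Hc HK Hb.
  destruct (proj1 (filterlim_locally_cauchy (U := C_R_CompleteNormedModule)
    (F := filter_prod (Rbar_locally m_infty) (Rbar_locally p_infty))
    (fun ab : R * R => CInt h (fst ab) (snd ab)))) as [l Hl].
  - intros eps. set (M := (2 * K + 1) / eps).
    pose proof (cond_pos eps).
    assert (HM : 0 < M) by (apply Rdiv_lt_0_compat; [lra | apply cond_pos]).
    exists (fun ab => fst ab < - M /\ M < snd ab). split.
    + apply Filter_prod with (Q := fun a => a < - M) (R := fun b => M < b).
      * exists (- M). intros x Hx; exact Hx.
      * exists M. intros x Hx; exact Hx.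
      * intros x y Hx Hy; split; assumption.
    + intros [a b] [a' b'] [A1 A2] [B1 B2]; simpl in *.
      pose proof (dominated_cauchy h K M a' b' a b HM Hc HK Hb ltac:(lra) ltac:(lra) ltac:(lra) ltac:(lra)) as D.
      assert (2 * K * / M < eps).
      { unfold M. replace (2 * K * / ((2 * K + 1) / eps)) with (2 * K / (2 * K + 1) * eps) by (field; lra).
        rewrite <- (Rmult_1_l eps) at 2. apply Rmult_lt_compat_r; [lra|].
        apply Rmult_lt_reg_r with (2 * K + 1); [lra|]. unfold Rdiv. rewrite Rmult_assoc, Rinv_l; lra. }
      split.
      * eapply Rle_lt_trans; [|exact H0]. eapply Rle_trans; [|exact D].
        apply (re_le_Cmod (CInt h a' b' - CInt h a b)).
      * eapply Rle_lt_trans; [|exact H0]. eapply Rle_trans; [|exact D].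
        apply (im_le_Cmod (CInt h a' b' - CInt h a b)).
  - assert (L : is_line_int h l).
    { intros e He.
      destruct (proj1 (filterlim_locally (fun ab : R * R => CInt h (fst ab) (snd ab) : C_R_NormedModule) l) Hl
        (mkposreal (e / 2) ltac:(lra))) as [Q1 Q2 [M1 H1] [M2 H2] H].
      exists (Rmax (- M1 + 1) (M2 + 1)). intros T HT.
      pose proof (Rmax_l (- M1 + 1) (M2 + 1)). pose proof (Rmax_r (- M1 + 1) (M2 + 1)).
      specialize (H (- T) T (H1 (- T) ltac:(lra)) (H2 T ltac:(lra))). destruct H as [P1 P2].
      change (Rabs (Re (CInt h (- T) T) - Re l) < e / 2) in P1.
      change (Rabs (Im (CInt h (- T) T) - Im l) < e / 2) in P2.
      eapply Rle_trans; [apply Cmod_le_sum|]. rewrite Re_minus, Im_minus.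
      revert P1 P2. generalize (Rabs (Re (CInt h (- T) T) - Re l)) (Rabs (Im (CInt h (- T) T) - Im l)).
      intros; lra. }
    exists l. split; [|split; [exact L|]].
    + apply (filterlimi_lim_ext (fun ab : R * R => CInt h (fst ab) (snd ab))); [|exact Hl].
      intros ab. apply CInt_is_RInt, Ccont_on_all, Hc.
    + apply Rnot_lt_le. intros Hlt.
      destruct (L ((Cmod l - K * PI) / 2)) as [M HM]; [lra|].
      pose proof (Rmax_l M 0) as Hm1. pose proof (Rmax_r M 0) as Hm2. set (T := Rmax M 0) in *.
      specialize (HM T Hm1).
      pose proof (Cmod_CInt_atan h K (- T) T ltac:(lra) Hc Hb).
      pose proof (atan_bound T). pose proof (atan_bound (- T)).
      pose proof (Cmod_rev_triangle l (CInt h (- T) T)). rewrite Cmod_minus_sym in H2.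
      assert (K * (atan T - atan (- T)) <= K * PI) by (apply Rmult_le_compat_l; lra). lra.
Qed.

Lemma dominated_ex_RInt_gen_Cmod h K : (forall t, Ccont h t) -> 0 <= K ->
  (forall t, Cmod (h t) <= K * / (1 + t ^ 2)) ->
  ex_RInt_gen (V := R_NormedModule) (fun t => Cmod (h t)) (Rbar_locally m_infty) (Rbar_locally p_infty).
Proof.
  intros Hc HK Hb.
  destruct (dominated_line_int (fun t => RtoC (Cmod (h t))) K) as (l & Hl & _).
  - intros t. apply Ccont_continuous_R, Ccont_Cmod, Hc.
  - exact HK.
  - intros t. rewrite Cmod_R, Rabs_pos_eq by apply Cmod_ge_0. apply Hb.
  - exists (Re l). intros P HP.
    assert (HP' : locally (T := C_R_NormedModule) l (fun z => P (Re z))).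
    { destruct HP as [e He]. exists e. intros y Hy. apply He. apply Hy. }
    specialize (Hl _ HP'). unfold filtermapi in *.
    eapply filter_imp; [|exact Hl]. intros ab (y & Hy1 & Hy2). exists (Re y). split; [|exact Hy2].
    apply (is_RInt_fct_extend_fst (U := R_NormedModule) (V := R_NormedModule)) in Hy1. exact Hy1.
Qed.

(** Goursat on the rectangle with corners [c1 - iT] and [c2 + iT]: each horizontal side is at most
    [(c2 - c1) K / T]. The hypothesis [0 < c1] keeps the rectangle in the half-plane where [G] is
    differentiable. *)
Lemma line_shift_aux G c1 c2 : 0 < c1 -> c1 <= c2 -> (forall z, 0 < Re z -> Cdiff G z) ->
  (exists K T0, forall s, c1 <= Re s <= c2 -> T0 <= Cmod s -> Cmod s * Cmod (G s) <= K) ->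
  forall e, 0 < e -> exists M, forall T, M <= T ->
    Cmod (CInt (fun t => G (c2, t)) (- T) T - CInt (fun t => G (c1, t)) (- T) T) <= e.
Proof.
  intros H1 H12 HG (K & T0 & HK) e He.
  exists (Rmax 1 (Rmax T0 (2 * (c2 - c1) * Rmax K 0 / e))). intros T HT.
  assert (A1 : 1 <= T) by (eapply Rle_trans; [|exact HT]; apply Rmax_l).
  assert (A2 : T0 <= T) by (eapply Rle_trans; [|exact HT]; eapply Rle_trans; [|apply Rmax_r]; apply Rmax_l).
  assert (A3 : 2 * (c2 - c1) * Rmax K 0 / e <= T)
    by (eapply Rle_trans; [|exact HT]; eapply Rle_trans; [|apply Rmax_r]; apply Rmax_r).
  assert (HD : diff_on_rect G c1 (- T) (c2 - c1) (2 * T)).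
  { intros s t Hs Ht. apply HG. simpl. lra. }
  pose proof (goursat G c1 (- T) (c2 - c1) (2 * T) ltac:(lra) ltac:(lra) HD) as E.
  unfold rect_int in E. replace (c1 + (c2 - c1)) with c2 in E by ring.
  replace (- T + 2 * T) with T in E by ring.
  assert (hor : forall y, Rabs y = T -> Cmod (CInt (fun s => G (s, y)) c1 c2) <= (c2 - c1) * (Rmax K 0 / T)).
  { intros y Hy. apply Cmod_CInt_le_const; [lra| |].
    - intros s. rewrite Rmin_left, Rmax_right by lra. intros Hs. apply Cdiff_Ccont_h, HG. simpl. lra.
    - intros s Hs. assert (T <= Cmod (s, y)) by (rewrite <- Hy; apply (im_le_Cmod (s, y))).
      specialize (HK (s, y) ltac:(simpl; lra) ltac:(lra)).
      pose proof (Rmax_l K 0). pose proof (Cmod_ge_0 (G (s, y))).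
      apply Rmult_le_reg_r with T; [lra|]. unfold Rdiv. rewrite Rmult_assoc, Rinv_l by lra. nra. }
  pose proof (hor T ltac:(apply Rabs_pos_eq; lra)) as B1.
  pose proof (hor (- T) ltac:(rewrite Rabs_Ropp; apply Rabs_pos_eq; lra)) as B2.
  set (V2 := CInt (fun t => G (c2, t)) (- T) T) in *. set (V1 := CInt (fun t => G (c1, t)) (- T) T) in *.
  set (H2 := CInt (fun s => G (s, T)) c1 c2) in *. set (H0 := CInt (fun s => G (s, - T)) c1 c2) in *.
  assert (E2 : (Ci * (V2 - V1) = H2 - H0)%C).
  { replace (Ci * (V2 - V1))%C with ((H0 + Ci * V2 - H2 - Ci * V1) + (H2 - H0))%C by ring.
    rewrite E. ring. }
  apply (f_equal Cmod) in E2. rewrite Cmod_mult, Cmod_Ci, Rmult_1_l in E2. rewrite E2.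
  pose proof (Cmod_triangle H2 (- H0)) as Tr. rewrite Cmod_opp in Tr. fold (H2 - H0)%C in Tr.
  assert (2 * ((c2 - c1) * (Rmax K 0 / T)) <= e).
  { apply Rmult_le_reg_r with T; [lra|]. apply Rmult_le_compat_r with (r := e) in A3; [|lra].
    unfold Rdiv in *. rewrite Rmult_assoc, Rinv_l, Rmult_1_r in A3 by lra.
    replace (2 * ((c2 - c1) * (Rmax K 0 * / T)) * T) with (2 * (c2 - c1) * Rmax K 0) by (field; lra). lra. }
  lra.
Qed.

Lemma line_shift G c1 c2 l : 0 < c1 -> 0 < c2 -> (forall z, 0 < Re z -> Cdiff G z) ->
  (exists K T0, forall s, Rmin c1 c2 <= Re s <= Rmax c1 c2 -> T0 <= Cmod s -> Cmod s * Cmod (G s) <= K) ->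
  is_line_int (fun t => G (c1, t)) l -> is_line_int (fun t => G (c2, t)) l.
Proof.
  intros H1 H2 HG HK Hl e He.
  destruct (Hl (e / 2)) as [M HM]; [lra|].
  assert (exists M', forall T, M' <= T ->
    Cmod (CInt (fun t => G (c2, t)) (- T) T - CInt (fun t => G (c1, t)) (- T) T) <= e / 2) as [M' HM'].
  { destruct (Rle_lt_dec c1 c2) as [L|L].
    - rewrite Rmin_left, Rmax_right in HK by lra. apply line_shift_aux; try assumption; lra.
    - rewrite Rmin_right, Rmax_left in HK by lra.
      destruct (line_shift_aux G c2 c1 H2 ltac:(lra) HG HK (e / 2) ltac:(lra)) as [M' HM'].
      exists M'. intros T HT. rewrite Cmod_minus_sym. apply HM', HT. }
  exists (Rmax M M'). intros T HT.
  specialize (HM T ltac:(eapply Rle_trans; [apply Rmax_l | exact HT])).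
  specialize (HM' T ltac:(eapply Rle_trans; [apply Rmax_r | exact HT])).
  eapply Rle_trans; [apply (Cmod_triangle3 _ (CInt (fun t => G (c1, t)) (- T) T))|]. lra.
Qed.

(* The fourth power leaves room for the weights |t| and 1 + t^2. *)
Lemma decay_on_line F c : (forall z, 0 < Re z -> Cdiff F z) -> rapid_decay_in_strips F -> 0 < c ->
  exists K, 0 <= K /\ forall t, Cmod (F (c, t)) <= K * / (1 + t ^ 2) ^ 2.
Proof.
  intros HF HR Hc. destruct (HR c 4%nat) as (K & T & HK).
  set (T1 := Rmax 1 T).
  assert (HT1 : 1 <= T1) by apply Rmax_l. assert (HT2 : T <= T1) by apply Rmax_r.
  destruct (continuity_ab_maj (fun t => Cmod (F (c, t))) (- T1) T1) as (t0 & Ht0 & _); [lra| |].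
  { intros t _. apply continuity_pt_filterlim. apply (Ccont_Cmod (fun t => F (c, t))).
    apply Cdiff_Ccont_v, HF. simpl; lra. }
  set (M := Cmod (F (c, t0))) in *. pose proof (Cmod_ge_0 (F (c, t0))) as HM. fold M in HM.
  (* Compactness handles [|t| <= T1]. Beyond it [1 <= t ^ 2] gives [1 + t ^ 2 <= 2 |s|^2], and
     squaring produces the [4]. *)
  set (K1 := Rmax (4 * K) (M * (1 + T1 ^ 2) ^ 2)).
  assert (0 <= M * (1 + T1 ^ 2) ^ 2) by (apply Rmult_le_pos; [lra | apply pow2_ge_0]).
  exists K1. split; [eapply Rle_trans; [|apply Rmax_r]; lra|].
  intros t. assert (P : 0 < (1 + t ^ 2) ^ 2) by (apply pow_lt; nra).
  apply Rmult_le_reg_r with ((1 + t ^ 2) ^ 2); [exact P|].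
  rewrite Rmult_assoc, Rinv_l, Rmult_1_r by lra.
  pose proof (Cmod_ge_0 (F (c, t))) as HFt.
  destruct (Rle_lt_dec (Rabs t) T1) as [L|L].
  - apply Rle_trans with (M * (1 + T1 ^ 2) ^ 2); [|apply Rmax_r].
    assert (t ^ 2 <= T1 ^ 2) by (rewrite <- (pow2_abs t); pose proof (Rabs_pos t); nra).
    apply Rmult_le_compat; try lra.
    + apply Ht0. apply Rabs_le_between in L. lra.
    + apply pow_incr. nra.
  - apply Rle_trans with (4 * K); [|apply Rmax_l].
    assert (L2 : Rabs t <= Cmod (c, t)) by apply (im_le_Cmod (c, t)).
    specialize (HK (c, t) ltac:(simpl; lra) ltac:(lra)).
    assert (t ^ 2 <= Cmod (c, t) ^ 2) by (rewrite <- (pow2_abs t); pose proof (Rabs_pos t); nra).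
    assert (1 <= t ^ 2) by (rewrite <- (pow2_abs t); nra).
    assert ((1 + t ^ 2) ^ 2 <= 4 * Cmod (c, t) ^ 4).
    { replace (4 * Cmod (c, t) ^ 4) with ((2 * Cmod (c, t) ^ 2) ^ 2) by ring. apply pow_incr. nra. }
    nra.
Qed.

(** * Inversion of a cosine transform by Poisson summability *)

Lemma continuous_ln_sub x0 x : 0 < x -> continuous (fun x => ln x - ln x0) x.
Proof.
  intros Hx. apply (ex_derive_continuous (V := R_NormedModule)). auto_derive. exact Hx.
Qed.

Lemma continuity_2d_snd (g : R -> R) x y : continuous g y -> continuity_2d_pt (fun _ v => g v) x y.
Proof.
  intros H. apply (continuity_1d_2d_pt_comp g (fun _ v => v)).
  - apply continuity_pt_filterlim, H.
  - apply continuity_2d_pt_id2.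
Qed.

Lemma continuity_2d_fst (g : R -> R) x y : continuous g x -> continuity_2d_pt (fun u _ => g u) x y.
Proof.
  intros H. apply (continuity_1d_2d_pt_comp g (fun u _ => u)).
  - apply continuity_pt_filterlim, H.
  - apply continuity_2d_pt_id1.
Qed.

Lemma RInt_abs_le (g k : R -> R) a b : a <= b ->
  (forall x, a <= x <= b -> continuous g x) -> (forall x, a <= x <= b -> continuous k x) ->
  (forall x, a <= x <= b -> Rabs (g x) <= k x) -> Rabs (RInt g a b) <= RInt k a b.
Proof.
  intros Hab Hg Hk H.
  apply (norm_RInt_le (V := R_NormedModule) g k a b); try assumption;
  apply (RInt_correct (V := R_CompleteNormedModule)), (ex_RInt_continuous (V := R_CompleteNormedModule));
  intros z; rewrite Rmin_left, Rmax_right by exact Hab; auto.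
Qed.

Lemma ex_RInt_cont (g : R -> R) a b : a <= b ->
  (forall x, a <= x <= b -> continuous g x) -> ex_RInt g a b.
Proof.
  intros Hab Hg. apply (ex_RInt_continuous (V := R_CompleteNormedModule)).
  intros z; rewrite Rmin_left, Rmax_right by exact Hab; auto.
Qed.

Section CosineInversion.

Variables (p : R -> R) (x0 L : R).
Hypothesis Hx0 : 0 < x0.
Hypothesis Hp : forall x, 0 < x -> continuous p x.
Hypothesis HL : forall a b, 0 < a -> a <= b -> RInt (fun x => Rabs (p x)) a b <= L.

(** In the variable [ln (x / x0)] a Mellin transform becomes a Fourier transform centred at [x0].
    The integrals stay in [x], which is why the value to be recovered is [x0 * p x0]. *)
Let w (x : R) : R := ln x - ln x0.

(* Equals the integral of 2 exp(-eta t) cos(t v) over 0 <= t <= T. *)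
Definition poisson_trunc (eta T v : R) : R :=
  2 * (eta + exp (- eta * T) * (v * sin (T * v) - eta * cos (T * v))) / (eta ^ 2 + v ^ 2).

(** The limit of [poisson_trunc] as [T] tends to infinity; it is [2 * PI] times the Poisson kernel
    of the half-plane, hence of total mass [2 * PI] in [v]. *)
Definition poisson (eta v : R) : R := 2 * eta / (eta ^ 2 + v ^ 2).

Lemma is_derive_poisson_trunc eta T v : 0 < eta ->
  is_derive (fun T => poisson_trunc eta T v) T (2 * exp (- eta * T) * cos (T * v)).
Proof.
  intros He. unfold poisson_trunc. assert (eta ^ 2 + v ^ 2 <> 0) by nra.
  auto_derive; [trivial|]. field. nra.
Qed.

Lemma poisson_trunc_0 eta v : poisson_trunc eta 0 v = 0.
Proof. unfold poisson_trunc. rewrite Rmult_0_r, Rmult_0_l, exp_0, sin_0, cos_0. unfold Rdiv. ring. Qed.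

(** The bound is the product of [2], of [exp (- eta * T) <= / (eta * T)] and of [2 / eta] for the
    remaining quotient. It is uniform in [v], so integration against [p] costs only the factor
    [L]. *)
Lemma poisson_trunc_error eta T v : 0 < eta -> 0 < T ->
  Rabs (poisson_trunc eta T v - poisson eta v) <= 4 / (eta ^ 2 * T).
Proof.
  intros He HT. unfold poisson_trunc, poisson.
  assert (Hq : 0 < eta ^ 2 + v ^ 2) by nra.
  replace (2 * (eta + exp (- eta * T) * (v * sin (T * v) - eta * cos (T * v))) / (eta ^ 2 + v ^ 2)
     - 2 * eta / (eta ^ 2 + v ^ 2))
   with (2 * exp (- eta * T) * ((v * sin (T * v) - eta * cos (T * v)) / (eta ^ 2 + v ^ 2))) by (field; lra).
  assert (E1 : exp (- eta * T) <= / (eta * T)).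
  { replace (- eta * T) with (- (eta * T)) by ring. rewrite exp_Ropp.
    assert (0 < eta * T) by nra. apply Rinv_le_contravar; [lra|].
    pose proof (exp_ineq1 (eta * T) ltac:(lra)). lra. }
  assert (E2 : Rabs ((v * sin (T * v) - eta * cos (T * v)) / (eta ^ 2 + v ^ 2)) <= 2 / eta).
  { unfold Rdiv. rewrite Rabs_mult, (Rabs_pos_eq (/ _)) by (left; apply Rinv_0_lt_compat; lra).
    apply Rmult_le_reg_r with (eta ^ 2 + v ^ 2); [lra|].
    rewrite Rmult_assoc, Rinv_l, Rmult_1_r by lra.
    pose proof (Rabs_triang (v * sin (T * v)) (- (eta * cos (T * v)))) as Tr.
    fold (v * sin (T * v) - eta * cos (T * v)) in Tr. rewrite Rabs_Ropp, !Rabs_mult in Tr.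
    assert (Rabs (sin (T * v)) <= 1) by (apply Rabs_le, SIN_bound).
    assert (Rabs (cos (T * v)) <= 1) by (apply Rabs_le, COS_bound).
    rewrite (Rabs_pos_eq eta) in Tr by lra.
    pose proof (Rabs_pos v).
    assert (Rabs v + eta <= 2 * / eta * (eta ^ 2 + v ^ 2)).
    { apply Rmult_le_reg_r with eta; [lra|].
      replace (2 * / eta * (eta ^ 2 + v ^ 2) * eta) with (2 * (eta ^ 2 + v ^ 2)) by (field; lra).
      rewrite <- (pow2_abs v). nra. }
    nra. }
  rewrite Rabs_mult, (Rabs_pos_eq (2 * _)) by (pose proof (exp_pos (- eta * T)); lra).
  replace (4 / (eta ^ 2 * T)) with (2 * / (eta * T) * (2 / eta)) by (field; lra).
  apply Rmult_le_compat; [pose proof (exp_pos (- eta * T)); lra | apply Rabs_pos | lra | exact E2].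
Qed.

Lemma w_continuous x : 0 < x -> continuous w x.
Proof. apply continuous_ln_sub. Qed.

Lemma cont_comp_w (g : R -> R) x : 0 < x -> (forall v, ex_derive g v) -> continuous (fun x => g (w x)) x.
Proof.
  intros Hx Hg. apply continuous_comp; [apply w_continuous, Hx|].
  apply (ex_derive_continuous (V := R_NormedModule)), Hg.
Qed.

Lemma cont_p_comp (g : R -> R) x : 0 < x -> (forall v, ex_derive g v) ->
  continuous (fun x => p x * g (w x)) x.
Proof.
  intros Hx Hg. apply (continuous_mult (K := R_AbsRing)); [apply Hp, Hx | apply cont_comp_w; assumption].
Qed.

Definition cos_transform (a b t : R) : R := RInt (fun x => p x * (2 * cos (t * w x))) a b.

Lemma ex_derive_poisson_trunc_v eta T v : 0 < eta -> ex_derive (fun v => poisson_trunc eta T v) v.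
Proof. intros He. unfold poisson_trunc. auto_derive. nra. Qed.

Lemma ex_derive_poisson_v eta v : 0 < eta -> ex_derive (fun v => poisson eta v) v.
Proof. intros He. unfold poisson. auto_derive. nra. Qed.

Lemma cos_transform_continuous a b t : 0 < a -> a <= b -> continuous (cos_transform a b) t.
Proof.
  intros Ha Hab. apply (ex_derive_continuous (V := R_NormedModule)).
  eexists. unfold cos_transform.
  apply (is_derive_RInt_param (fun t x => p x * (2 * cos (t * w x))) a b t).
  - apply filter_forall. intros u x _. auto_derive. trivial.
  - rewrite Rmin_left, Rmax_right by exact Hab. intros x Hx.
    apply continuity_2d_pt_ext with (f := fun u v => p v * (2 * (- (w v) * sin (u * w v)))).
    { intros u v. symmetry. apply is_derive_unique. auto_derive; [trivial|ring]. }
    apply continuity_2d_pt_mult; [apply continuity_2d_snd, Hp; lra|].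
    apply continuity_2d_pt_mult; [apply continuity_2d_pt_const|].
    apply continuity_2d_pt_mult.
    + apply continuity_2d_pt_opp, continuity_2d_snd, w_continuous; lra.
    + apply (continuity_1d_2d_pt_comp sin).
      * apply continuity_sin.
      * apply continuity_2d_pt_mult; [apply continuity_2d_pt_id1 | apply continuity_2d_snd, w_continuous; lra].
  - apply filter_forall. intros u. apply ex_RInt_cont; [exact Hab|]. intros x Hx.
    apply (cont_p_comp (fun v => 2 * cos (u * v))); [lra|]. intros v. auto_derive. trivial.
Qed.

(* Fubini by differentiation in T: both sides vanish at T = 0. *)
Lemma poisson_fubini eta T a b : 0 < eta -> 0 <= T -> 0 < a -> a <= b ->
  is_RInt (fun t => exp (- eta * t) * cos_transform a b t) 0 T
    (RInt (fun x => p x * poisson_trunc eta T (w x)) a b).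
Proof.
  intros He HT Ha Hab.
  replace (RInt (fun x => p x * poisson_trunc eta T (w x)) a b) with
    (minus (RInt (fun x => p x * poisson_trunc eta T (w x)) a b)
           (RInt (fun x => p x * poisson_trunc eta 0 (w x)) a b)).
  2:{ rewrite (RInt_ext (fun x => p x * poisson_trunc eta 0 (w x)) (fun _ => 0)).
      - rewrite RInt_const. unfold minus, plus, opp, scal; simpl; unfold mult; simpl. ring.
      - intros x _. rewrite poisson_trunc_0. apply Rmult_0_r. }
  apply (is_RInt_derive (V := R_CompleteNormedModule)
    (fun T => RInt (fun x => p x * poisson_trunc eta T (w x)) a b)).
  - intros t _.
    assert (DD : forall u v, is_derive (fun T => p v * poisson_trunc eta T (w v)) u
               (p v * (2 * exp (- eta * u) * cos (u * w v)))).
    { intros u v. apply is_derive_scal. apply is_derive_poisson_trunc, He. }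
    replace (exp (- eta * t) * cos_transform a b t) with
      (RInt (fun x => Derive (fun T => p x * poisson_trunc eta T (w x)) t) a b).
    2:{ unfold cos_transform.
        rewrite (RInt_ext _ (fun x => scal (exp (- eta * t)) (p x * (2 * cos (t * w x))))).
        - rewrite (RInt_scal (V := R_CompleteNormedModule)); [reflexivity|].
          apply ex_RInt_cont; [exact Hab|]. intros x Hx.
          apply (cont_p_comp (fun v => 2 * cos (t * v))); [lra|]. intros v. auto_derive. trivial.
        - intros x _. etransitivity; [apply is_derive_unique, DD|].
          unfold scal; simpl; unfold mult; simpl. ring. }
    apply (is_derive_RInt_param (fun T x => p x * poisson_trunc eta T (w x)) a b t).
    + apply filter_forall. intros u x _. eexists. apply DD.
    + rewrite Rmin_left, Rmax_right by exact Hab. intros x Hx.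
      apply continuity_2d_pt_ext with (f := fun u v => p v * (2 * exp (- eta * u) * cos (u * w v))).
      { intros u v. symmetry. apply is_derive_unique, DD. }
      apply continuity_2d_pt_mult; [apply continuity_2d_snd, Hp; lra|].
      apply continuity_2d_pt_mult.
      * apply (continuity_2d_fst (fun u => 2 * exp (- eta * u))).
        apply (ex_derive_continuous (V := R_NormedModule)). auto_derive. trivial.
      * apply (continuity_1d_2d_pt_comp cos); [apply continuity_cos|].
        apply continuity_2d_pt_mult; [apply continuity_2d_pt_id1 | apply continuity_2d_snd, w_continuous; lra].
    + apply filter_forall. intros u. apply ex_RInt_cont; [exact Hab|]. intros x Hx.
      apply (cont_p_comp (poisson_trunc eta u)); [lra|]. intros v. apply ex_derive_poisson_trunc_v, He.
  - intros t _. apply (continuous_mult (K := R_AbsRing)).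
    + apply (ex_derive_continuous (V := R_NormedModule)). auto_derive. trivial.
    + apply cos_transform_continuous; assumption.
Qed.

Lemma Rabs_p_continuous x : 0 < x -> continuous (fun x => Rabs (p x)) x.
Proof. intros Hx. apply continuous_comp; [apply Hp, Hx | apply continuous_Rabs]. Qed.

Lemma RInt_p_bound (g : R -> R) M a b : 0 < a -> a <= b -> 0 <= M ->
  (forall v, ex_derive g v) -> (forall x, a <= x <= b -> Rabs (g (w x)) <= M) ->
  Rabs (RInt (fun x => p x * g (w x)) a b) <= M * L.
Proof.
  intros Ha Hab HM Hg Hb.
  apply Rle_trans with (RInt (fun x => scal M (Rabs (p x))) a b).
  - apply RInt_abs_le; [exact Hab| | |].
    + intros x Hx. apply cont_p_comp; [lra | exact Hg].
    + intros x Hx. apply (continuous_scal_r (V := R_NormedModule)), Rabs_p_continuous. lra.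
    + intros x Hx. unfold scal; simpl; unfold mult; simpl. rewrite Rabs_mult, Rmult_comm.
      apply Rmult_le_compat_r; [apply Rabs_pos | apply Hb, Hx].
  - rewrite (RInt_scal (V := R_CompleteNormedModule)).
    + apply Rmult_le_compat_l; [exact HM | apply HL; assumption].
    + apply ex_RInt_cont; [exact Hab|]. intros x Hx. apply Rabs_p_continuous. lra.
Qed.

Lemma poisson_integral eta a b : 0 < eta -> 0 < a -> a <= b ->
  is_RInt (fun x => / x * poisson eta (w x)) a b (2 * atan (w b / eta) - 2 * atan (w a / eta)).
Proof.
  intros He Ha Hab.
  apply (is_RInt_derive (V := R_CompleteNormedModule) (fun x => 2 * atan (w x / eta))).
  - rewrite Rmin_left, Rmax_right by exact Hab. intros x Hx. unfold w, poisson.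
    apply is_derive_ext with (f := fun x => 2 * atan ((ln x - ln x0) * / eta)); [reflexivity|].
    auto_derive; [lra|]. unfold w. field.
    pose proof (pow2_ge_0 (ln x - ln x0)). repeat split; try lra; nra.
  - rewrite Rmin_left, Rmax_right by exact Hab. intros x Hx.
    apply (continuous_mult (K := R_AbsRing)).
    + apply (ex_derive_continuous (V := R_NormedModule)). auto_derive. lra.
    + apply cont_comp_w; [lra | intros v; apply ex_derive_poisson_v, He].
Qed.

Lemma poisson_nonneg eta v : 0 < eta -> 0 <= poisson eta v.
Proof. intros He. unfold poisson. apply Rdiv_le_0_compat; nra. Qed.

(** Approximate identity. Away from [x0] the kernel is [O(eta)] and the bound [L] suffices; near
    [x0] the function [x * p x] is almost constant and the kernel has mass [2 * PI] up to [O(eta)].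
    The thresholds do not depend on [a] and [b], which are chosen later. *)
Lemma poisson_approx e : 0 < e -> exists eta0 d, 0 < eta0 /\ 0 < d < x0 /\
  forall eta a b, 0 < eta <= eta0 -> 0 < a <= x0 - d -> x0 + d <= b ->
    Rabs (RInt (fun x => p x * poisson eta (w x)) a b - 2 * PI * (x0 * p x0)) <= e.
Proof.
  intros He. pose proof PI_RGT_0 as HPI.
  assert (Hg : continuous (fun x => x * p x) x0).
  { apply (continuous_mult (K := R_AbsRing)); [apply continuous_id | apply Hp, Hx0]. }
  destruct (continuous_eps_inv _ _ Hg (e / (4 * PI))) as (d0 & Hd0 & Kd); [apply Rdiv_lt_0_compat; lra|].
  set (d := Rmin (d0 / 2) (x0 / 2)).
  assert (Hd : 0 < d) by (apply Rmin_glb_lt; lra).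
  assert (Hdd : d <= d0 / 2) by apply Rmin_l. assert (Hdx : d <= x0 / 2) by apply Rmin_r.
  set (a1 := x0 - d). set (b1 := x0 + d).
  assert (Wa : w a1 < 0). { unfold w. pose proof (ln_increasing a1 x0). unfold a1 in *. lra. }
  assert (Wb : 0 < w b1). { unfold w. pose proof (ln_increasing x0 b1). unfold b1 in *. lra. }
  set (w1 := Rmin (- w a1) (w b1)).
  assert (W1 : 0 < w1) by (apply Rmin_glb_lt; lra).
  assert (W1a : w1 <= - w a1) by apply Rmin_l. assert (W1b : w1 <= w b1) by apply Rmin_r.
  set (g0 := x0 * p x0).
  assert (L0 : 0 <= L).
  { apply Rle_trans with (RInt (fun x => Rabs (p x)) x0 x0); [|apply HL; lra].
    rewrite (RInt_point (V := R_CompleteNormedModule)). right; reflexivity. }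
  (* Coefficients of [eta] in the mass missing near [x0] and in the two outer pieces; the [1] keeps
     [A] positive. *)
  set (A := 4 * Rabs g0 / w1 + 4 * L / w1 ^ 2 + 1).
  assert (HA : 1 <= A).
  { unfold A. assert (0 <= 4 * Rabs g0 / w1) by (apply Rdiv_le_0_compat; [pose proof (Rabs_pos g0)|]; lra).
    assert (0 <= 4 * L / w1 ^ 2) by (apply Rdiv_le_0_compat; [lra|nra]). lra. }
  exists (e / (2 * A)), d. split; [apply Rdiv_lt_0_compat; lra|]. split; [lra|].
  intros eta a b Heta Ha Hb.
  assert (EA : A * eta <= e / 2).
  { apply Rle_trans with (A * (e / (2 * A))); [apply Rmult_le_compat_l; lra | right; field; lra]. }
  assert (Cn : forall x, 0 < x -> continuous (fun x => p x * poisson eta (w x)) x).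
  { intros x Hx. apply cont_p_comp; [exact Hx | intros v; apply ex_derive_poisson_v; lra]. }
  assert (Out : forall x, 0 < x -> x <= a1 \/ b1 <= x -> w1 ^ 2 <= w x ^ 2).
  { intros x Hx [H|H].
    - assert (w x <= w a1). { unfold w. destruct (Req_dec x a1) as [->|]; [lra|].
        pose proof (ln_increasing x a1). lra. }
      nra.
    - assert (w b1 <= w x). { unfold w. destruct (Req_dec x b1) as [->|]; [lra|].
        pose proof (ln_increasing b1 x). unfold b1 in *. lra. }
      nra. }
  assert (OutB : forall u v, 0 < u -> u <= v -> (v <= a1 \/ b1 <= u) ->
     Rabs (RInt (fun x => p x * poisson eta (w x)) u v) <= 2 * eta / w1 ^ 2 * L).
  { intros u v Hu Huv Hor. apply RInt_p_bound; try lra.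
    - apply Rdiv_le_0_compat; nra.
    - intros; apply ex_derive_poisson_v; lra.
    - intros x Hx. rewrite Rabs_pos_eq by (apply poisson_nonneg; lra). unfold poisson.
      assert (w1 ^ 2 <= w x ^ 2) by (apply Out; lra).
      unfold Rdiv. apply Rmult_le_compat_l; [lra|]. apply Rinv_le_contravar; nra. }
  assert (EC : RInt (fun x => p x * poisson eta (w x)) a b =
     RInt (fun x => p x * poisson eta (w x)) a a1 + RInt (fun x => p x * poisson eta (w x)) a1 b1
     + RInt (fun x => p x * poisson eta (w x)) b1 b).
  { etransitivity; [symmetry; apply (RInt_Chasles (V := R_CompleteNormedModule) _ a b1 b)|].
    - apply ex_RInt_cont; [unfold b1; lra|]. intros; apply Cn; lra.
    - apply ex_RInt_cont; [unfold b1; lra|]. intros; apply Cn; unfold b1 in *; lra.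
    - etransitivity; [apply f_equal2; [symmetry; apply (RInt_Chasles (V := R_CompleteNormedModule) _ a a1 b1)|reflexivity]|reflexivity].
      + apply ex_RInt_cont; [unfold a1; lra|]. intros; apply Cn; lra.
      + apply ex_RInt_cont; [unfold a1, b1; lra|]. intros; apply Cn; unfold a1 in *; lra. }
  rewrite EC.
  pose proof (OutB a a1 ltac:(lra) ltac:(unfold a1; lra) ltac:(lra)) as O1.
  pose proof (OutB b1 b ltac:(unfold b1; lra) ltac:(unfold b1; lra) ltac:(lra)) as O2.
  assert (Pa1 : 0 < a1) by (unfold a1; lra). assert (Pab : a1 <= b1) by (unfold a1, b1; lra).
  pose proof (poisson_integral eta a1 b1 ltac:(lra) Pa1 Pab) as PI1.
  set (At := 2 * atan (w b1 / eta) - 2 * atan (w a1 / eta)) in *.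
  assert (At1 : At <= 2 * PI).
  { unfold At. pose proof (atan_bound (w b1 / eta)). pose proof (atan_bound (w a1 / eta)). lra. }
  assert (At2 : 2 * PI - At <= 4 * eta / w1).
  { unfold At. pose proof (atan_tail (w b1 / eta) ltac:(apply Rdiv_lt_0_compat; lra)) as T1.
    pose proof (atan_tail (- w a1 / eta) ltac:(apply Rdiv_lt_0_compat; lra)) as T2.
    replace (- w a1 / eta) with (- (w a1 / eta)) in T2 by (field; lra). rewrite atan_opp in T2.
    assert (U : forall v, w1 <= v -> / (v / eta) <= eta / w1).
    { intros v Hv. replace (/ (v / eta)) with (eta * / v) by (field; lra).
      apply Rmult_le_compat_l; [lra|]. apply Rinv_le_contravar; lra. }
    pose proof (U _ W1b). pose proof (U (- w a1) W1a) as U2.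
    replace (- w a1 / eta) with (- (w a1 / eta)) in U2 by (field; lra).
    replace (4 * eta / w1) with (4 * (eta / w1)) by (field; lra). lra. }
  assert (Mid : Rabs (RInt (fun x => p x * poisson eta (w x)) a1 b1 - g0 * At) <= e / (4 * PI) * At).
  { assert (E2 : is_RInt (fun x => minus (p x * poisson eta (w x)) (scal g0 (/ x * poisson eta (w x)))) a1 b1
      (minus (RInt (fun x => p x * poisson eta (w x)) a1 b1) (scal g0 At))).
    { apply (is_RInt_minus (V := R_NormedModule)).
      - apply (RInt_correct (V := R_CompleteNormedModule)), ex_RInt_cont; [exact Pab|]. intros; apply Cn; lra.
      - apply (is_RInt_scal (V := R_NormedModule)), PI1. }
    pose proof (is_RInt_scal (V := R_NormedModule) _ a1 b1 (e / (4 * PI)) _ PI1) as E3.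
    apply (norm_RInt_le (V := R_NormedModule) _ _ a1 b1 _ _ Pab) with (2 := E2) (3 := E3).
    intros x Hx. unfold norm, minus, plus, opp, scal; simpl; unfold abs, mult; simpl.
    replace (p x * poisson eta (w x) + - (g0 * (/ x * poisson eta (w x))))
      with ((x * p x - g0) * (/ x * poisson eta (w x))) by (field; lra).
    rewrite Rabs_mult, (Rabs_pos_eq (/ x * _)).
    2:{ apply Rmult_le_pos; [left; apply Rinv_0_lt_compat; lra | apply poisson_nonneg; lra]. }
    apply Rmult_le_compat_r.
    { apply Rmult_le_pos; [left; apply Rinv_0_lt_compat; lra | apply poisson_nonneg; lra]. }
    left. apply Kd. apply Rabs_def1; unfold a1, b1 in Hx; lra. }
  assert (Fin : e / (4 * PI) * At <= e / 2).
  { apply Rle_trans with (e / (4 * PI) * (2 * PI)); [apply Rmult_le_compat_l; [|lra] | right; field; lra].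
    left; apply Rdiv_lt_0_compat; lra. }
  assert (Gap : Rabs (g0 * At - 2 * PI * g0) <= Rabs g0 * (4 * eta / w1)).
  { replace (g0 * At - 2 * PI * g0) with (- (g0 * (2 * PI - At))) by ring.
    rewrite Rabs_Ropp, Rabs_mult, (Rabs_pos_eq (2 * PI - At)) by lra.
    apply Rmult_le_compat_l; [apply Rabs_pos | exact At2]. }
  assert (ES : A * eta = eta + Rabs g0 * (4 * eta / w1) + 2 * (2 * eta / w1 ^ 2 * L)).
  { unfold A. field. lra. }
  apply Rabs_le_between in O1. apply Rabs_le_between in O2. apply Rabs_le_between in Mid.
  apply Rabs_le_between in Gap. apply Rabs_le. lra.
Qed.

(** Four errors of [e / 4]: inserting [exp (- eta * t)], replacing [H] by the transform over
    [[a, b]], truncating the kernel at [T], and the approximate identity. The order of choice is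
    essential: [eta] from [e], then [T] from [eta], then [a] and [b] from [T]. *)
Lemma cosine_inversion (H : R -> R) (K : R) : 0 <= K ->
  (forall t, continuous H t) -> (forall t, Rabs (H t) <= K * / (1 + t ^ 2) ^ 2) ->
  (forall e a1 b1, 0 < e -> 0 < a1 -> exists a b, 0 < a <= a1 /\ b1 <= b /\
     forall t, Rabs (H t - cos_transform a b t) <= e) ->
  forall e, 0 < e -> exists M, forall T, M <= T -> Rabs (RInt H 0 T - 2 * PI * (x0 * p x0)) <= e.
Proof.
  intros HK HC HB HT e He. pose proof PI_RGT_0 as HPI.
  destruct (poisson_approx (e / 4) ltac:(lra)) as (eta0 & d & Heta0 & Hd & Happ).
  (* Since [1 - exp (- eta * t) <= eta * t] and [t <= 1 + t ^ 2], inserting the damping costs at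
     most [eta * K * atan T], and [atan T < 2]. *)
  set (eta := Rmin eta0 (e / (4 * (2 * K + 1)))).
  assert (Heta : 0 < eta) by (apply Rmin_glb_lt; [lra | apply Rdiv_lt_0_compat; lra]).
  assert (Heta1 : eta <= eta0) by apply Rmin_l.
  assert (Heta2 : eta * (2 * K) <= e / 4).
  { apply Rle_trans with (e / (4 * (2 * K + 1)) * (2 * K + 1)); [|right; field; lra].
    apply Rmult_le_compat; try lra. apply Rmin_r. }
  assert (L0 : 0 <= L).
  { apply Rle_trans with (RInt (fun x => Rabs (p x)) x0 x0); [|apply HL; lra].
    rewrite (RInt_point (V := R_CompleteNormedModule)). right; reflexivity. }
  (* The second bound brings the truncation error [4 / (eta ^ 2 * T) * L] below [e / 4]. *)
  exists (Rmax 1 (16 * L / (eta ^ 2 * e))). intros T HTM.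
  assert (T1 : 1 <= T) by (eapply Rle_trans; [apply Rmax_l | exact HTM]).
  assert (T0 : 0 <= T) by lra.
  assert (T2 : 4 / (eta ^ 2 * T) * L <= e / 4).
  { assert (16 * L / (eta ^ 2 * e) <= T) by (eapply Rle_trans; [apply Rmax_r | exact HTM]).
    assert (Hee : 0 < eta ^ 2 * e) by (apply Rmult_lt_0_compat; [apply pow_lt|]; lra).
    apply Rmult_le_compat_r with (r := eta ^ 2 * e) in H0; [|lra].
    replace (16 * L / (eta ^ 2 * e) * (eta ^ 2 * e)) with (16 * L) in H0 by (field; lra).
    apply Rmult_le_reg_r with (4 * (eta ^ 2 * T)); [nra|].
    replace (4 / (eta ^ 2 * T) * L * (4 * (eta ^ 2 * T))) with (16 * L) by (field; lra). nra. }
  (* A uniform error [e / (4 * T)] integrates to [e / 4] over [[0, T]]. *)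
  destruct (HT (e / (4 * T)) (x0 - d) (x0 + d)) as (a & b & Ha & Hb & HH);
    [apply Rdiv_lt_0_compat; lra | lra |].
  specialize (Happ eta a b ltac:(lra) ltac:(lra) ltac:(lra)).
  assert (Hab : a <= b) by lra.
  pose proof (poisson_fubini eta T a b Heta ltac:(lra) ltac:(lra) Hab) as Fub.
  apply (is_RInt_unique (V := R_CompleteNormedModule)) in Fub.
  assert (CE : forall t, continuous (fun t => exp (- eta * t)) t).
  { intros t. apply (ex_derive_continuous (V := R_NormedModule)). auto_derive. trivial. }
  assert (CT : forall t, continuous (cos_transform a b) t) by (intros; apply cos_transform_continuous; lra).
  assert (ex1 : ex_RInt H 0 T) by (apply ex_RInt_cont; [lra | intros; apply HC]).
  assert (ex2 : ex_RInt (fun t => exp (- eta * t) * cos_transform a b t) 0 T).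
  { apply ex_RInt_cont; [lra|]. intros; apply (continuous_mult (K := R_AbsRing)); auto. }
  (* H - exp(-eta t) C = (1 - exp(-eta t)) H + exp(-eta t) (H - C) *)
  assert (S1 : Rabs (RInt H 0 T - RInt (fun t => exp (- eta * t) * cos_transform a b t) 0 T)
     <= eta * (2 * K) + e / 4).
  { assert (E : is_RInt (fun t => minus (H t) (exp (- eta * t) * cos_transform a b t)) 0 T
       (minus (RInt H 0 T) (RInt (fun t => exp (- eta * t) * cos_transform a b t) 0 T))).
    { apply (is_RInt_minus (V := R_NormedModule)); apply (RInt_correct (V := R_CompleteNormedModule)); assumption. }
    assert (E2 : is_RInt (fun t => plus (scal (eta * K) (/ (1 + t ^ 2))) (e / (4 * T))) 0 T
       (plus (scal (eta * K) (atan T - atan 0)) (scal (T - 0) (e / (4 * T))))).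
    { apply (is_RInt_plus (V := R_NormedModule)).
      - apply (is_RInt_scal (V := R_NormedModule)), is_RInt_atan.
      - apply (is_RInt_const (V := R_NormedModule)). }
    eapply Rle_trans.
    - apply (norm_RInt_le (V := R_NormedModule) _ _ 0 T _ _ T0) with (2 := E) (3 := E2).
      intros t Ht. unfold norm, minus, plus, opp, scal; simpl; unfold abs, mult; simpl.
      replace (H t + - (exp (- eta * t) * cos_transform a b t)) with
        ((1 - exp (- eta * t)) * H t + exp (- eta * t) * (H t - cos_transform a b t)) by ring.
      eapply Rle_trans; [apply Rabs_triang|]. rewrite !Rabs_mult.
      pose proof (exp_pos (- eta * t)) as E0.
      assert (E1 : exp (- eta * t) <= 1).
      { rewrite <- exp_0. destruct (Req_dec t 0) as [->|]; [rewrite Rmult_0_r; lra|].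
        left; apply exp_increasing. nra. }
      assert (E3 : 1 - exp (- eta * t) <= eta * t).
      { pose proof (exp_ineq1_le (- eta * t)). lra. }
      rewrite (Rabs_pos_eq (1 - _)), (Rabs_pos_eq (exp _)) by lra.
      specialize (HH t). specialize (HB t).
      apply Rplus_le_compat.
      + apply Rle_trans with (eta * t * (K * / (1 + t ^ 2) ^ 2)).
        { apply Rmult_le_compat; try lra. apply Rabs_pos. }
        replace (t * (t * 1)) with (t ^ 2) by ring.
        assert (0 < 1 + t ^ 2) by nra.
        apply Rmult_le_reg_r with ((1 + t ^ 2) ^ 2); [apply pow_lt; lra|].
        replace (eta * t * (K * / (1 + t ^ 2) ^ 2) * (1 + t ^ 2) ^ 2) with (eta * K * t) by (field; lra).
        replace (eta * K * / (1 + t ^ 2) * (1 + t ^ 2) ^ 2) with (eta * K * (1 + t ^ 2)) by (field; lra).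
        apply Rmult_le_compat_l; [apply Rmult_le_pos; lra | nra].
      + pose proof (Rabs_pos (H t - cos_transform a b t)). nra.
    - unfold plus, scal; simpl; unfold mult; simpl. rewrite atan_0, !Rminus_0_r.
      pose proof (atan_bound T). pose proof PI_4.
      replace (T * (e / (4 * T))) with (e / 4) by (field; lra).
      apply Rplus_le_compat_r. rewrite Rmult_assoc. apply Rmult_le_compat_l; [lra|].
      rewrite Rmult_comm. apply Rmult_le_compat_r; lra. }
  assert (S2 : Rabs (RInt (fun x => p x * poisson_trunc eta T (w x)) a b
      - RInt (fun x => p x * poisson eta (w x)) a b) <= e / 4).
  { eapply Rle_trans; [|exact T2].
    assert (Q : RInt (fun x => p x * poisson_trunc eta T (w x)) a b - RInt (fun x => p x * poisson eta (w x)) a b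
      = RInt (fun x => p x * (fun v => poisson_trunc eta T v - poisson eta v) (w x)) a b).
    { symmetry. etransitivity; [apply (RInt_ext _ (fun x => minus (p x * poisson_trunc eta T (w x)) (p x * poisson eta (w x))))|].
      - intros x _. unfold minus, plus, opp; simpl. ring.
      - apply (RInt_minus (V := R_CompleteNormedModule)); (apply ex_RInt_cont; [lra|]); intros x Hx.
        + apply (cont_p_comp (poisson_trunc eta T)); [lra | intros; apply ex_derive_poisson_trunc_v, Heta].
        + apply (cont_p_comp (poisson eta)); [lra | intros; apply ex_derive_poisson_v, Heta]. }
    rewrite Q. clear Q.
    apply (RInt_p_bound (fun v => poisson_trunc eta T v - poisson eta v) (4 / (eta ^ 2 * T)) a b).
    - lra.
    - exact Hab.
    - apply Rdiv_le_0_compat; [lra|]. apply Rmult_lt_0_compat; [apply pow_lt|]; lra.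
    - intros v. apply (ex_derive_minus (V := R_NormedModule));
      [apply ex_derive_poisson_trunc_v, Heta | apply ex_derive_poisson_v, Heta].
    - intros x _. apply poisson_trunc_error; lra. }
  rewrite Fub in S1.
  apply Rabs_le_between in S1. apply Rabs_le_between in S2. apply Rabs_le_between in Happ.
  apply Rabs_le. lra.
Qed.

End CosineInversion.

(** * Mellin inversion *)

Lemma Ccont_ext_pos h g x : 0 < x -> (forall y, 0 < y -> h y = g y) -> Ccont g x -> Ccont h x.
Proof.
  intros Hx E Hg. apply Ccont_eps. intros e He.
  destruct (Ccont_eps_inv _ _ Hg e He) as (d & Hd & K).
  exists (Rmin d x). split; [apply Rmin_glb_lt; assumption|]. intros s Hs.
  pose proof (Rmin_l d x). pose proof (Rmin_r d x).
  assert (0 < s) by (apply Rabs_def2 in Hs; lra).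
  rewrite !E by assumption. apply K. lra.
Qed.

Lemma Ccont_Rcpow x s : 0 < x -> Ccont (fun x => Rcpow x s) x.
Proof.
  intros Hx. split; simpl; apply (ex_derive_continuous (V := R_NormedModule));
  auto_derive; lra.
Qed.

Lemma Ccont_smooth f x : smooth_pos f -> 0 < x -> Ccont f x.
Proof.
  intros Hf Hx. destruct (Hf 1%nat x Hx) as [H1 H2].
  split; apply (ex_derive_continuous (V := R_NormedModule)); assumption.
Qed.

Lemma mellin_integrand_alt f s x : 0 < x ->
  mellin_integrand f s x = (f x * Rcpow x s * RtoC (/ x)%R)%C.
Proof.
  intros Hx. unfold mellin_integrand, Cdiv. rewrite RtoC_inv by lra. reflexivity.
Qed.

Lemma Ccont_mellin f s x : smooth_pos f -> 0 < x -> Ccont (mellin_integrand f s) x.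
Proof.
  intros Hf Hx. apply (Ccont_ext_pos _ (fun x => f x * Rcpow x s * RtoC (/ x)%R)%C); [exact Hx| |].
  - intros y Hy. apply mellin_integrand_alt, Hy.
  - apply Ccont_mult; [apply Ccont_mult; [apply Ccont_smooth; assumption | apply Ccont_Rcpow, Hx]|].
    apply Ccont_continuous_R, (ex_derive_continuous (V := R_NormedModule)). auto_derive. lra.
Qed.

Lemma Cmod_mellin f sg t x : 0 < x ->
  Cmod (mellin_integrand f (sg, t) x) = Cmod (mellin_integrand f (sg, 0) x).
Proof.
  intros Hx. rewrite !mellin_integrand_alt, !Cmod_mult, !Cmod_Rcpow by exact Hx. reflexivity.
Qed.

(** The factor [x0 ^ (-s)] recentres the oscillation at [x0], so that the contributions of [t] and
    [- t] add up to a cosine of [t ln (x / x0)] with a weight free of [t]. *)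
Lemma mellin_twist f sg t x0 x : 0 < x0 -> 0 < x ->
  (mellin_integrand f (sg, t) x * Rcpow x0 (- (sg, t)) =
   f x * RtoC (exp (sg * (ln x - ln x0)) / x)%R
     * (cos (t * (ln x - ln x0))%R, sin (t * (ln x - ln x0))%R))%C.
Proof.
  intros H0 Hx. rewrite mellin_integrand_alt by exact Hx. unfold Rcpow. simpl.
  assert (E : exp (sg * (ln x - ln x0)) = exp (sg * ln x) * exp (- sg * ln x0))
    by (rewrite <- exp_plus; f_equal; ring).
  assert (E1 : cos (t * (ln x - ln x0)) =
     cos (t * ln x) * cos (- t * ln x0) - sin (t * ln x) * sin (- t * ln x0))
    by (rewrite <- cos_plus; f_equal; ring).
  assert (E2 : sin (t * (ln x - ln x0)) =
     sin (t * ln x) * cos (- t * ln x0) + cos (t * ln x) * sin (- t * ln x0))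
    by (rewrite <- sin_plus; f_equal; ring).
  rewrite E, E1, E2. destruct (f x) as [u v]. apply C_ext; simpl; field; lra.
Qed.

Lemma is_RInt_gen_0_oo_C h l : (forall x, 0 < x -> Ccont h x) ->
  is_RInt_gen (V := C_R_NormedModule) h (at_right 0) (Rbar_locally p_infty) l ->
  forall e, 0 < e -> exists d M, 0 < d /\
    forall a b, 0 < a < d -> M < b -> a <= b -> Cmod (CInt h a b - l) <= e.
Proof.
  intros Hc Hl e He.
  assert (HB : locally (T := C_R_NormedModule) l
     (fun y => Rabs (Re y - Re l) < e / 2 /\ Rabs (Im y - Im l) < e / 2)).
  { exists (mkposreal (e / 2) ltac:(lra)). intros y Hy. exact Hy. }
  destruct (Hl _ HB) as [Q1 Q2 [d Hd] [M HM] H].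
  exists d, M. split; [apply cond_pos|]. intros a b Ha Hb Hab.
  destruct (H a b) as (y & Hy1 & Hy2).
  - apply Hd; [|lra]. unfold ball; simpl. unfold AbsRing_ball, abs, minus, plus, opp; simpl.
    rewrite Ropp_0, Rplus_0_r, Rabs_pos_eq; lra.
  - apply HM, Hb.
  - simpl in Hy1. apply CInt_unique in Hy1. rewrite Hy1.
    eapply Rle_trans; [apply Cmod_le_sum|]. rewrite Re_minus, Im_minus. simpl in Hy2.
    destruct Hy2 as [A B]. revert A B.
    generalize (Rabs (Re y - Re l)) (Rabs (Im y - Im l)). intros; lra.
Qed.

Lemma is_RInt_gen_0_oo_R (h : R -> R) l :
  is_RInt_gen (V := R_NormedModule) h (at_right 0) (Rbar_locally p_infty) l ->
  forall e, 0 < e -> exists d M, 0 < d /\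
    forall a b, 0 < a < d -> M < b -> a <= b -> Rabs (RInt h a b - l) <= e.
Proof.
  intros Hl e He.
  assert (HB : locally (T := R_NormedModule) l (fun y => Rabs (y - l) < e)).
  { exists (mkposreal e He). intros y Hy. exact Hy. }
  destruct (Hl _ HB) as [Q1 Q2 [d Hd] [M HM] H].
  exists d, M. split; [apply cond_pos|]. intros a b Ha Hb Hab.
  destruct (H a b) as (y & Hy1 & Hy2).
  - apply Hd; [|lra]. unfold ball; simpl. unfold AbsRing_ball, abs, minus, plus, opp; simpl.
    rewrite Ropp_0, Rplus_0_r, Rabs_pos_eq; lra.
  - apply HM, Hb.
  - simpl in Hy1. apply (is_RInt_unique (V := R_CompleteNormedModule)) in Hy1. rewrite Hy1. left. exact Hy2.
Qed.

Lemma Ccont_comp_opp h t : Ccont h (- t) -> Ccont (fun t => h (- t)) t.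
Proof.
  intros [H1 H2].
  assert (Ho : continuous (fun t : R => - t) t)
    by apply (continuous_opp (V := R_NormedModule)), continuous_id.
  split.
  - apply (continuous_comp (fun t => - t) (fun t => Re (h t))); assumption.
  - apply (continuous_comp (fun t => - t) (fun t => Im (h t))); assumption.
Qed.

Lemma CInt_sym h T : (forall t, Ccont h t) ->
  CInt h (- T) T = CInt (fun t => h t + h (- t)%R)%C 0 T.
Proof.
  intros Hc.
  assert (Hn : forall t, Ccont (fun t => h (- t)) t).
  { intros t. apply Ccont_comp_opp, Hc. }
  rewrite CInt_plus by (apply Ccont_on_all; assumption).
  assert (E : CInt h (- T) 0 = CInt (fun t => h (- t)) 0 T).
  { assert (Q : forall g : R -> R, (forall t, continuous g t) -> RInt g (- T) 0 = RInt (fun t => g (- t)) 0 T).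
    { intros g Hg. symmetry.
      assert (ex : ex_RInt g (- 0) (- T)) by (apply (ex_RInt_continuous (V := R_CompleteNormedModule)); auto).
      pose proof (is_RInt_comp_opp (V := R_NormedModule) g 0 T _ (RInt_correct (V := R_CompleteNormedModule) g _ _ ex)) as I.
      apply (is_RInt_opp (V := R_NormedModule)) in I. rewrite Ropp_0 in I.
      rewrite (opp_RInt_swap (V := R_CompleteNormedModule)) in I.
      2:{ rewrite Ropp_0 in ex. exact ex. }
      apply is_RInt_unique. eapply is_RInt_ext; [|exact I]. intros x _. apply (opp_opp (G := R_AbelianGroup)). }
    exact (C_ext (CInt h (- T) 0) (CInt (fun t => h (- t)) 0 T)
      (Q (fun t => Re (h t)) (fun t => proj1 (Hc t)))
      (Q (fun t => Im (h t)) (fun t => proj2 (Hc t)))). }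
  rewrite <- (CInt_Chasles h (- T) 0 T) by (apply Ccont_on_all, Hc).
  rewrite E. ring.
Qed.

(** * Inversion on a line where the Mellin integral converges absolutely *)

Section LargeAbscissa.

Variables (f : R -> C) (F : C -> C) (sg x0 : R).
Hypothesis Hf : smooth_pos f.
Hypothesis Hx0 : 0 < x0.
Hypothesis Hm : forall t, has_mellin f (sg, t) (F (sg, t)).

Let mu (x : R) : R := Cmod (mellin_integrand f (sg, 0) x).

Lemma mu_continuous x : 0 < x -> continuous mu x.
Proof. intros Hx. apply Ccont_Cmod, Ccont_mellin; assumption. Qed.

Lemma mu_monotone a b a' b' : 0 < a' -> a' <= a -> a <= b -> b <= b' ->
  RInt mu a' b' = RInt mu a' a + RInt mu a b + RInt mu b b'
  /\ 0 <= RInt mu a' a /\ 0 <= RInt mu b b'.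
Proof.
  intros H1 H2 H3 H4.
  assert (ex : forall u v, 0 < u -> u <= v -> ex_RInt mu u v).
  { intros u v Hu Huv. apply ex_RInt_cont; [exact Huv|]. intros; apply mu_continuous; lra. }
  assert (P : forall u v, 0 < u -> u <= v -> 0 <= RInt mu u v).
  { intros u v Hu Huv. apply RInt_ge_0; [exact Huv | apply ex; assumption |]. intros; apply Cmod_ge_0. }
  split; [|split; apply P; lra].
  pose proof (RInt_Chasles (V := R_CompleteNormedModule) mu a' a b
    (ex a' a ltac:(lra) ltac:(lra)) (ex a b ltac:(lra) ltac:(lra))) as C1.
  pose proof (RInt_Chasles (V := R_CompleteNormedModule) mu a' b b'
    (ex a' b ltac:(lra) ltac:(lra)) (ex b b' ltac:(lra) ltac:(lra))) as C2.
  rewrite <- C2, <- C1. reflexivity.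
Qed.

Lemma mu_limit : exists L, (forall a b, 0 < a -> a <= b -> RInt mu a b <= L) /\
  forall e a1 b1, 0 < e -> 0 < a1 -> exists a b, 0 < a <= a1 /\ b1 <= b /\ a <= b /\ L - e <= RInt mu a b.
Proof.
  destruct (Hm 0) as [[L HL] _]. exists L.
  pose proof (is_RInt_gen_0_oo_R _ _ HL) as Lim. fold mu in Lim. split.
  - intros a b Ha Hab. apply Rnot_lt_le. intros Hlt.
    destruct (Lim ((RInt mu a b - L) / 2) ltac:(lra)) as (d & M & Hd & K).
    set (a' := Rmin a (d / 2)). set (b' := Rmax b (M + 1)).
    assert (0 < a') by (apply Rmin_glb_lt; lra).
    assert (a' <= a) by apply Rmin_l. assert (a' <= d / 2) by apply Rmin_r.
    assert (b <= b') by apply Rmax_l. assert (M + 1 <= b') by apply Rmax_r.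
    specialize (K a' b' ltac:(lra) ltac:(lra) ltac:(lra)). apply Rabs_le_between in K.
    pose proof (mu_monotone a b a' b' ltac:(lra) ltac:(lra) ltac:(lra) ltac:(lra)). lra.
  - intros e a1 b1 He Ha1. destruct (Lim e He) as (d & M & Hd & K).
    exists (Rmin a1 (d / 2)), (Rmax a1 (Rmax b1 (M + 1))).
    pose proof (Rmin_l a1 (d / 2)). pose proof (Rmin_r a1 (d / 2)).
    pose proof (Rmax_l a1 (Rmax b1 (M + 1))). pose proof (Rmax_r a1 (Rmax b1 (M + 1))).
    pose proof (Rmax_l b1 (M + 1)). pose proof (Rmax_r b1 (M + 1)).
    assert (0 < Rmin a1 (d / 2)) by (apply Rmin_glb_lt; lra).
    repeat split; try lra.
    specialize (K (Rmin a1 (d / 2)) (Rmax a1 (Rmax b1 (M + 1))) ltac:(lra) ltac:(lra) ltac:(lra)).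
    apply Rabs_le_between in K. lra.
Qed.

Lemma Ccont_on_mellin t a b : 0 < a -> a <= b -> Ccont_on (mellin_integrand f (sg, t)) a b.
Proof.
  intros Ha Hab x. rewrite Rmin_left, Rmax_right by exact Hab. intros Hx. apply Ccont_mellin; [exact Hf|lra].
Qed.

(** The truncated integral misses at most the mass of [mu] outside [[a, b]]. Because [mu] does not
    involve [t], the same [a] and [b] work for all [t], the uniformity that [cosine_inversion]
    requires. *)
Lemma mellin_tail L a b e : (forall a b, 0 < a -> a <= b -> RInt mu a b <= L) ->
  0 < a -> a <= b -> L - e <= RInt mu a b ->
  forall t, Cmod (F (sg, t) - CInt (mellin_integrand f (sg, t)) a b) <= e.
Proof.
  intros HL Ha Hab He t. apply Rnot_lt_le. intros Hlt.
  destruct (Hm t) as [_ Ht].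
  set (r := (Cmod (F (sg, t) - CInt (mellin_integrand f (sg, t)) a b) - e) / 2) in *.
  destruct (is_RInt_gen_0_oo_C _ _ (fun x Hx => Ccont_mellin f (sg, t) x Hf Hx) Ht r ltac:(unfold r; lra))
    as (d & M & Hd & K).
  set (a' := Rmin a (d / 2)). set (b' := Rmax b (M + 1)).
  assert (A1 : 0 < a') by (apply Rmin_glb_lt; lra).
  assert (A2 : a' <= a) by apply Rmin_l. assert (A3 : a' <= d / 2) by apply Rmin_r.
  assert (B1 : b <= b') by apply Rmax_l. assert (B2 : M + 1 <= b') by apply Rmax_r.
  specialize (K a' b' ltac:(lra) ltac:(lra) ltac:(lra)).
  destruct (mu_monotone a b a' b' A1 A2 Hab B1) as (E & P1 & P2).
  pose proof (HL a' b' A1 ltac:(lra)) as U.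
  assert (bd : forall u v, 0 < u -> u <= v -> Cmod (CInt (mellin_integrand f (sg, t)) u v) <= RInt mu u v).
  { intros u v Hu Huv. apply Cmod_CInt_le; [exact Huv | apply Ccont_on_mellin; assumption | |].
    - intros; apply mu_continuous; lra.
    - intros x Hx. rewrite Cmod_mellin by lra. right; reflexivity. }
  pose proof (bd a' a A1 A2) as D1. pose proof (bd b b' ltac:(lra) B1) as D2.
  assert (E2 : (CInt (mellin_integrand f (sg, t)) a' b' - CInt (mellin_integrand f (sg, t)) a b
     = CInt (mellin_integrand f (sg, t)) a' a + CInt (mellin_integrand f (sg, t)) b b')%C).
  { rewrite <- (CInt_Chasles _ a' a b') by (apply Ccont_on_mellin; lra).
    rewrite <- (CInt_Chasles _ a b b') by (apply Ccont_on_mellin; lra). ring. }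
  pose proof (Cmod_triangle (CInt (mellin_integrand f (sg, t)) a' a) (CInt (mellin_integrand f (sg, t)) b b')) as D3.
  rewrite <- E2 in D3.
  pose proof (Cmod_triangle3 (F (sg, t)) (CInt (mellin_integrand f (sg, t)) a' b')
     (CInt (mellin_integrand f (sg, t)) a b)) as D4.
  rewrite (Cmod_minus_sym (F (sg, t)) (CInt _ a' b')) in D4. unfold r in K. lra.
Qed.

(** The weight left in front of the oscillation by [mellin_twist]. It is normalised so that
    [x0 * pc x0 = f x0]. *)
Let pc (x : R) : C := (f x * RtoC (exp (sg * (ln x - ln x0)) / x)%R)%C.

Lemma Ccont_pc x : 0 < x -> Ccont pc x.
Proof.
  intros Hx. apply Ccont_mult; [apply Ccont_smooth; assumption|].
  apply Ccont_continuous_R, (ex_derive_continuous (V := R_NormedModule)). auto_derive. lra.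
Qed.

Lemma Cmod_pc x : 0 < x -> Cmod (pc x) = mu x * exp (- sg * ln x0).
Proof.
  intros Hx. unfold pc, mu. rewrite mellin_integrand_alt by exact Hx.
  rewrite !Cmod_mult, Cmod_Rcpow, !Cmod_R. simpl.
  assert (0 < / x) by (apply Rinv_0_lt_compat; lra).
  rewrite !Rabs_pos_eq; [| lra |].
  2:{ apply Rmult_le_pos; [left; apply exp_pos | lra]. }
  replace (sg * (ln x - ln x0)) with (sg * ln x + - sg * ln x0) by ring. rewrite exp_plus.
  unfold Rdiv. ring.
Qed.

Lemma CInt_pc_cos t a b : 0 < a -> a <= b ->
  (Rcpow x0 (- (sg, t)) * CInt (mellin_integrand f (sg, t)) a b
   + Rcpow x0 (- (sg, (- t)%R)) * CInt (mellin_integrand f (sg, (- t)%R)) a b)%C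
  = (cos_transform (fun x => Re (pc x)) x0 a b t, cos_transform (fun x => Im (pc x)) x0 a b t).
Proof.
  intros Ha Hab. rewrite <- !CInt_mult_l by (apply Ccont_on_mellin; assumption).
  rewrite <- CInt_plus.
  2,3: intros x Hx; apply Ccont_mult; [apply Ccont_const | apply (Ccont_on_mellin _ a b); assumption].
  rewrite (CInt_ext _ (fun x => pc x * RtoC (2 * cos (t * (ln x - ln x0)))%R)%C).
  - unfold CInt, cos_transform. f_equal; apply RInt_ext; intros x _; simpl; unfold Re, Im; ring.
  - rewrite Rmin_left, Rmax_right by exact Hab. intros x Hx.
    rewrite (Cmult_comm (Rcpow x0 (- (sg, t)))), (Cmult_comm (Rcpow x0 (- (sg, (- t)%R)))).
    rewrite !mellin_twist by lra. fold (pc x).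
    replace (- t * (ln x - ln x0)) with (- (t * (ln x - ln x0))) by ring.
    rewrite cos_neg, sin_neg. apply C_ext; simpl; ring.
Qed.

Hypothesis HFc : forall t, Ccont (fun t => F (sg, t)) t.
Variable K : R.
Hypothesis HK : 0 <= K.
Hypothesis HFb : forall t, Cmod (F (sg, t)) <= K * / (1 + t ^ 2) ^ 2.

Let G (t : R) : C := (F (sg, t) * Rcpow x0 (- (sg, t)))%C.

Lemma Ccont_G t : Ccont G t.
Proof.
  apply Ccont_mult; [apply HFc|].
  apply (Cdiff_Ccont_v (fun s => Rcpow x0 (- s)) sg t), Cdiff_Rcpow_opp.
Qed.

(** The symmetric integral folds to the integral of [G t + G (- t)] over [[0, T]], which
    [CInt_pc_cos] identifies, up to a uniform error, with the cosine transforms of the real and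
    imaginary parts of [pc]. The two are inverted separately. *)
Lemma mellin_inversion_large : is_line_int G (RtoC (2 * PI) * f x0).
Proof.
  set (R0 := exp (- sg * ln x0)). assert (HR0 : 0 < R0) by apply exp_pos.
  destruct mu_limit as (L & HL & Happ).
  assert (Hcx : forall t, Ccont (fun t => G t + G (- t)%R)%C t).
  { intros t. apply Ccont_plus; [apply Ccont_G | apply (Ccont_comp_opp G), Ccont_G]. }
  assert (HG1 : forall t, Cmod (G t) <= (K * R0) * / (1 + t ^ 2) ^ 2).
  { intros t. unfold G. rewrite Cmod_mult, Cmod_Rcpow. simpl Re. fold R0.
    replace (K * R0 * / (1 + t ^ 2) ^ 2) with (K * / (1 + t ^ 2) ^ 2 * R0) by ring.
    apply Rmult_le_compat_r; [lra | apply HFb]. }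
  assert (HGb : forall t, Cmod (G t + G (- t)%R) <= 2 * (K * R0) * / (1 + t ^ 2) ^ 2).
  { intros t. eapply Rle_trans; [apply Cmod_triangle|].
    pose proof (HG1 t). pose proof (HG1 (- t)). replace ((- t) ^ 2) with (t ^ 2) in H0 by ring. lra. }
  assert (HLr : forall g : C -> R, (forall z, Rabs (g z) <= Cmod z) ->
     (forall x, 0 < x -> continuous (fun x => g (pc x)) x) ->
     forall a b, 0 < a -> a <= b -> RInt (fun x => Rabs (g (pc x))) a b <= R0 * L).
  { intros g Hg Hgc a b Ha Hab.
    apply Rle_trans with (RInt (fun x => scal R0 (mu x)) a b).
    - apply RInt_le; [exact Hab | | |].
      + apply ex_RInt_cont; [exact Hab|]. intros x Hx.
        apply (continuous_comp (fun x => g (pc x)) Rabs); [apply Hgc; lra | apply continuous_Rabs].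
      + apply ex_RInt_cont; [exact Hab|]. intros x Hx.
        apply (continuous_scal_r (V := R_NormedModule)), mu_continuous; lra.
      + intros x Hx. eapply Rle_trans; [apply Hg|]. rewrite Cmod_pc by lra. right. apply Rmult_comm.
    - rewrite (RInt_scal (V := R_CompleteNormedModule)).
      + apply Rmult_le_compat_l; [lra | apply HL; assumption].
      + apply ex_RInt_cont; [exact Hab|]. intros; apply mu_continuous; lra. }
  assert (Htail : forall e a1 b1, 0 < e -> 0 < a1 -> exists a b, 0 < a <= a1 /\ b1 <= b /\
     forall t, Cmod ((G t + G (- t)%R) - (cos_transform (fun x => Re (pc x)) x0 a b t,
                                        cos_transform (fun x => Im (pc x)) x0 a b t)) <= e).
  { intros e a1 b1 He Ha1.
    destruct (Happ (e / (2 * R0)) a1 b1) as (a & b & Ha & Hb & Hab & Hl); [apply Rdiv_lt_0_compat; lra | exact Ha1 |].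
    exists a, b. split; [exact Ha|]. split; [exact Hb|]. intros t.
    pose proof (mellin_tail L a b _ HL ltac:(lra) Hab Hl) as MT.
    rewrite <- CInt_pc_cos by lra. unfold G.
    match goal with |- Cmod ?z <= _ => replace z with
      (Rcpow x0 (- (sg, t)) * (F (sg, t) - CInt (mellin_integrand f (sg, t)) a b)
       + Rcpow x0 (- (sg, (- t)%R)) * (F (sg, (- t)%R) - CInt (mellin_integrand f (sg, (- t)%R)) a b))%C by ring end.
    eapply Rle_trans; [apply Cmod_triangle|]. rewrite !Cmod_mult, !Cmod_Rcpow. simpl Re. fold R0.
    pose proof (MT t). pose proof (MT (- t)).
    apply Rle_trans with (R0 * (e / (2 * R0)) + R0 * (e / (2 * R0))); [|right; field; lra].
    apply Rplus_le_compat; apply Rmult_le_compat_l; lra. }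
  assert (Pv : (RtoC (2 * PI) * f x0)%C = (2 * PI * (x0 * Re (pc x0)), 2 * PI * (x0 * Im (pc x0)))).
  { unfold pc. replace (ln x0 - ln x0) with 0 by ring. rewrite Rmult_0_r, exp_0.
    destruct (f x0) as [u v]. apply C_ext; simpl; field; lra. }
  assert (HKR : 0 <= 2 * (K * R0)) by (apply Rmult_le_pos; [lra | apply Rmult_le_pos; lra]).
  rewrite Pv. intros e He.
  destruct (cosine_inversion (fun x => Re (pc x)) x0 (R0 * L) Hx0 (fun x Hx => proj1 (Ccont_pc x Hx))
    (HLr Re re_le_Cmod (fun x Hx => proj1 (Ccont_pc x Hx)))
    (fun t => Re (G t + G (- t)%R)%C) (2 * (K * R0)) HKR (fun t => proj1 (Hcx t))
    (fun t => Rle_trans _ _ _ (re_le_Cmod _) (HGb t))) with (e := e / 2) as [M1 HM1].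
  { intros e' a1 b1 He' Ha1. destruct (Htail e' a1 b1 He' Ha1) as (a & b & Ha & Hb & Ht).
    exists a, b. split; [exact Ha|]. split; [exact Hb|]. intros t.
    exact (Rle_trans _ _ _ (re_le_Cmod _) (Ht t)). }
  { lra. }
  destruct (cosine_inversion (fun x => Im (pc x)) x0 (R0 * L) Hx0 (fun x Hx => proj2 (Ccont_pc x Hx))
    (HLr Im im_le_Cmod (fun x Hx => proj2 (Ccont_pc x Hx)))
    (fun t => Im (G t + G (- t)%R)%C) (2 * (K * R0)) HKR (fun t => proj2 (Hcx t))
    (fun t => Rle_trans _ _ _ (im_le_Cmod _) (HGb t))) with (e := e / 2) as [M2 HM2].
  { intros e' a1 b1 He' Ha1. destruct (Htail e' a1 b1 He' Ha1) as (a & b & Ha & Hb & Ht).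
    exists a, b. split; [exact Ha|]. split; [exact Hb|]. intros t.
    exact (Rle_trans _ _ _ (im_le_Cmod _) (Ht t)). }
  { lra. }
  exists (Rmax M1 M2). intros T HT.
  specialize (HM1 T ltac:(eapply Rle_trans; [apply Rmax_l | exact HT])).
  specialize (HM2 T ltac:(eapply Rle_trans; [apply Rmax_r | exact HT])).
  rewrite CInt_sym by apply Ccont_G.
  eapply Rle_trans; [apply Cmod_le_sum|]. rewrite Re_minus, Im_minus. simpl Re at 2. simpl Im at 2.
  unfold CInt at 1 2. simpl Re at 1. simpl Im at 1.
  eapply Rle_trans; [apply Rplus_le_compat; [exact HM1 | exact HM2]|]. lra.
Qed.

End LargeAbscissa.

Lemma mellin_continuation_diff f F z : mellin_continuation f F -> 0 < Re z -> Cdiff F z.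
Proof.
  intros (_ & H & _) Hz. apply holomorphic_at_Cdiff, H. intros ->. simpl in Hz. lra.
Qed.

(** The Mellin integral represents [F] only far to the right, so the formula is first obtained
    there; the decay of [F] in strips then moves the line to [c], without meeting the possible pole
    at [0]. *)
Lemma mellin_inversion f F c x : smooth_pos f -> mellin_continuation f F -> 0 < c -> 0 < x ->
  is_line_int (fun t => F (c, t) * Rcpow x (- (c, t)))%C (RtoC (2 * PI) * f x).
Proof.
  intros Hf HM Hc Hx.
  pose proof (fun z => mellin_continuation_diff f F z HM) as HD.
  destruct HM as ((s0 & Hs0) & _ & _ & HR).
  (* [s0] may be negative: the maximum puts the starting line both to the right of [s0] and inside
     the half-plane of holomorphy. *)
  set (sg := Rmax 1 (s0 + 1)).
  assert (Hsg : 1 <= sg) by apply Rmax_l. assert (Hsg2 : s0 + 1 <= sg) by apply Rmax_r.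
  apply (line_shift (fun s => F s * Rcpow x (- s))%C sg c); [lra | exact Hc | | |].
  - intros z Hz. apply Cdiff_mult; [apply HD, Hz | apply Cdiff_Rcpow_opp].
  - set (B := Rmax sg c). destruct (HR B 1%nat) as (K & T & HK).
    exists (Rmax K 0 * exp (B * Rabs (ln x))), T. intros s Hs HT.
    assert (0 < Rmin sg c) by (apply Rmin_glb_lt; lra).
    specialize (HK s ltac:(unfold B in *; lra) HT). simpl pow in HK. rewrite Rmult_1_r in HK.
    rewrite Cmod_mult, Cmod_Rcpow, <- Rmult_assoc.
    apply Rmult_le_compat.
    + apply Rmult_le_pos; apply Cmod_ge_0.
    + left; apply exp_pos.
    + eapply Rle_trans; [exact HK | apply Rmax_l].
    + assert (E : Re (- s)%C * ln x <= B * Rabs (ln x)).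
      { replace (Re (- s)%C) with (- Re s) by reflexivity.
        apply Rle_trans with (Re s * Rabs (ln x)).
        - pose proof (Rle_abs (- ln x)). rewrite Rabs_Ropp in H0.
          replace (- Re s * ln x) with (Re s * - ln x) by ring. apply Rmult_le_compat_l; lra.
        - apply Rmult_le_compat_r; [apply Rabs_pos | apply Hs]. }
      destruct E as [E|E]; [left; apply exp_increasing, E | right; rewrite E; reflexivity].
  - destruct (decay_on_line F sg HD HR ltac:(lra)) as (K & HK0 & HK).
    apply (mellin_inversion_large f F sg x Hf Hx) with (K := K).
    + intros t. apply Hs0. simpl. lra.
    + intros t. apply Cdiff_Ccont_v, HD. simpl. lra.
    + exact HK0.
    + exact HK.
Qed.

(** * Bounds for f from its Mellin transform *)

Lemma is_line_int_ext h g l : (forall t, h t = g t) -> is_line_int h l -> is_line_int g l.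
Proof.
  intros E H e He. destruct (H e He) as [M HM]. exists M. intros T HT.
  rewrite <- (CInt_ext h g) by (intros; apply E). apply HM, HT.
Qed.

Lemma is_line_int_plus h g l m : (forall t, Ccont h t) -> (forall t, Ccont g t) ->
  is_line_int h l -> is_line_int g m -> is_line_int (fun t => h t + g t)%C (l + m).
Proof.
  intros Ch Cg H1 H2 e He. destruct (H1 (e / 2) ltac:(lra)) as [M1 K1].
  destruct (H2 (e / 2) ltac:(lra)) as [M2 K2].
  exists (Rmax M1 M2). intros T HT.
  specialize (K1 T ltac:(eapply Rle_trans; [apply Rmax_l | exact HT])).
  specialize (K2 T ltac:(eapply Rle_trans; [apply Rmax_r | exact HT])).
  rewrite CInt_plus by (apply Ccont_on_all; assumption).
  replace (CInt h (- T) T + CInt g (- T) T - (l + m))%C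
    with ((CInt h (- T) T - l) + (CInt g (- T) T - m))%C by ring.
  eapply Rle_trans; [apply Cmod_triangle|]. lra.
Qed.

Lemma is_line_int_mult c h l : (forall t, Ccont h t) ->
  is_line_int h l -> is_line_int (fun t => c * h t)%C (c * l).
Proof.
  intros Ch H e He. pose proof (Cmod_ge_0 c).
  destruct (H (e / (Cmod c + 1)) ltac:(apply Rdiv_lt_0_compat; lra)) as [M K].
  exists M. intros T HT. specialize (K T HT).
  rewrite CInt_mult_l by (apply Ccont_on_all; assumption).
  replace (c * CInt h (- T) T - c * l)%C with (c * (CInt h (- T) T - l))%C by ring.
  rewrite Cmod_mult.
  apply Rle_trans with ((Cmod c + 1) * (e / (Cmod c + 1))); [|right; field; lra].
  apply Rmult_le_compat; try lra. apply Cmod_ge_0.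
Qed.

Lemma is_line_int_minus h g l m : (forall t, Ccont h t) -> (forall t, Ccont g t) ->
  is_line_int h l -> is_line_int g m -> is_line_int (fun t => h t - g t)%C (l - m).
Proof.
  intros Ch Cg H1 H2.
  apply (is_line_int_ext (fun t => h t + (- (1)) * g t)%C); [intros t; ring|].
  replace (l - m)%C with (l + - (1) * m)%C by ring.
  apply is_line_int_plus; try assumption.
  - intros t. apply Ccont_mult; [apply Ccont_const | apply Cg].
  - apply is_line_int_mult; assumption.
Qed.

Lemma is_line_int_bound h l K : (forall t, Ccont h t) -> 0 <= K ->
  (forall t, Cmod (h t) <= K * / (1 + t ^ 2)) -> is_line_int h l -> Cmod l <= K * PI.
Proof.
  intros Hc HK Hb H. destruct (dominated_line_int h K Hc HK Hb) as (l' & _ & H' & B).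
  rewrite (is_line_int_unique h l l' H H'). exact B.
Qed.

Lemma Ccont_Rcpow_line x c t : Ccont (fun t => Rcpow x (- (c, t))) t.
Proof. apply (Cdiff_Ccont_v (fun s => Rcpow x (- s)) c t), Cdiff_Rcpow_opp. Qed.

Lemma Rpower_exp_Rcpow x c t : Cmod (Rcpow x (- (c, t))) = Rpower x (- c).
Proof. rewrite Cmod_Rcpow. reflexivity. Qed.

Lemma inv_sq_le t : / (1 + t ^ 2) ^ 2 <= / (1 + t ^ 2).
Proof. apply Rinv_le_contravar; nra. Qed.

Lemma mellin_bound f F c : smooth_pos f -> mellin_continuation f F -> 0 < c ->
  exists A, 0 <= A /\ forall x, 0 < x -> Cmod (f x) <= A * Rpower x (- c).
Proof.
  intros Hf HM Hc. pose proof (fun z => mellin_continuation_diff f F z HM) as HD.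
  destruct (decay_on_line F c HD ltac:(apply HM) Hc) as (K & HK0 & HK).
  exists K. split; [exact HK0|]. intros x Hx.
  pose proof (mellin_inversion f F c x Hf HM Hc Hx) as I.
  assert (Px : 0 < Rpower x (- c)) by apply exp_pos. pose proof PI_RGT_0.
  apply (is_line_int_bound _ _ (K * Rpower x (- c))) in I.
  - rewrite Cmod_mult, Cmod_R, Rabs_pos_eq in I by lra.
    pose proof (Cmod_ge_0 (f x)). apply Rmult_le_reg_r with PI; [lra|]. nra.
  - intros t. apply Ccont_mult; [|apply Ccont_Rcpow_line].
    apply Cdiff_Ccont_v, HD. simpl. exact Hc.
  - nra.
  - intros t. rewrite Cmod_mult, Rpower_exp_Rcpow. pose proof (inv_sq_le t). specialize (HK t).
    replace (K * Rpower x (- c) * / (1 + t ^ 2)) with (K * / (1 + t ^ 2) * Rpower x (- c)) by ring.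
    apply Rmult_le_compat_r; [lra|]. nra.
Qed.

Lemma inv_sqrt_Rcpow y : 0 < y -> RtoC (/ sqrt y) = Rcpow y (- RtoC (1 / 2)).
Proof.
  intros Hy. rewrite <- Rpower_sqrt by exact Hy. rewrite <- Rpower_Ropp.
  unfold Rpower, Rcpow. apply C_ext; simpl.
  - rewrite Ropp_0, Rmult_0_l, cos_0, Rmult_1_r. f_equal. field.
  - rewrite Ropp_0, Rmult_0_l, sin_0. ring.
Qed.

Lemma ln_one_minus_bound d : 0 <= d <= 1 / 2 -> 0 <= - ln (1 - d) <= 2 * d.
Proof.
  intros Hd. split.
  - assert (ln (1 - d) <= 0); [|lra]. rewrite <- ln_1. destruct (Req_dec d 0) as [->|].
    + rewrite Rminus_0_r. lra.
    + left; apply ln_increasing; lra.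
  - rewrite <- ln_Rinv by lra.
    apply Rle_trans with (/ (1 - d) - 1).
    + pose proof (exp_ineq1_le (ln (/ (1 - d)))) as E.
      rewrite exp_ln in E by (apply Rinv_0_lt_compat; lra). lra.
    + apply Rmult_le_reg_r with (1 - d); [lra|].
      replace ((/ (1 - d) - 1) * (1 - d)) with d by (field; lra). nra.
Qed.

(** With [tau = - ln (1 - d)], which lies between [0] and [2 * d], the modulus [exp (b * tau)]
    deviates from [1] by at most [2 * b * exp b * d], and the cosine and sine contribute
    [2 * d * |t|] each. *)
Lemma Rcpow_near_one b t d : 0 <= b -> 0 <= d <= 1 / 2 ->
  Cmod (Rcpow (1 - d) (- (b, t)) - 1) <= (2 * (b * exp b) + 4) * d * (1 + Rabs t).
Proof.
  intros Hb Hd. pose proof (ln_one_minus_bound d Hd) as Ht. unfold Rcpow. simpl.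
  set (tau := - ln (1 - d)) in *.
  replace (- b * ln (1 - d)) with (b * tau) by (unfold tau; ring).
  replace (- t * ln (1 - d)) with (t * tau) by (unfold tau; ring).
  pose proof (Rabs_pos t) as Pt.
  assert (E1 : 0 <= exp (b * tau) - 1 <= b * exp b * (2 * d)).
  { destruct (MVT_origin exp exp (b * tau) is_derive_exp) as (c & Hc & E). rewrite exp_0 in E.
    assert (0 <= b * tau <= b) by nra.
    rewrite (Rabs_pos_eq (b * tau)) in Hc by lra. pose proof (Rle_abs c).
    assert (exp c <= exp b).
    { destruct (Req_dec c b) as [->|]; [lra|]. left; apply exp_increasing; lra. }
    pose proof (exp_pos c). pose proof (exp_pos b).
    replace (exp (b * tau) - 1) with (exp c * (b * tau)) by lra. split; [apply Rmult_le_pos; lra|].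
    apply Rle_trans with (exp b * (b * (2 * d))); [|right; ring].
    apply Rmult_le_compat; try lra. apply Rmult_le_compat_l; lra. }
  assert (E2 : Rabs (cos (t * tau) - 1) <= Rabs t * (2 * d)).
  { destruct (MVT_origin cos (fun x => - sin x) (t * tau) is_derive_cos) as (c & _ & E). rewrite cos_0 in E.
    replace (cos (t * tau) - 1) with (- sin c * (t * tau)) by lra.
    rewrite !Rabs_mult, Rabs_Ropp, (Rabs_pos_eq tau) by lra.
    assert (Rabs (sin c) <= 1) by (apply Rabs_le, SIN_bound). pose proof (Rabs_pos (sin c)).
    assert (0 <= Rabs t * tau <= Rabs t * (2 * d)) by nra. nra. }
  assert (E3 : Rabs (sin (t * tau)) <= Rabs t * (2 * d)).
  { eapply Rle_trans; [apply Rabs_sin_le|]. rewrite Rabs_mult, (Rabs_pos_eq tau) by lra. nra. }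
  match goal with |- Cmod ?z <= _ => replace z with
    (((cos (t * tau) - 1)%R, sin (t * tau))
      + RtoC (exp (b * tau) - 1)%R * (cos (t * tau), sin (t * tau)))%C
    by (apply C_ext; simpl; ring) end.
  eapply Rle_trans; [apply Cmod_triangle|].
  rewrite Cmod_mult, Cmod_R, (Rabs_pos_eq (exp _ - 1)) by lra.
  pose proof (Cmod_polar 1 (t * tau) ltac:(lra)) as P. rewrite !Rmult_1_l in P. rewrite P, Rmult_1_r.
  pose proof (Cmod_le_sum (cos (t * tau) - 1, sin (t * tau))) as Q. simpl in Q.
  assert (0 <= b * exp b * (2 * d) * Rabs t).
  { apply Rmult_le_pos; [lra | exact Pt]. }
  nra.
Qed.

(** On the line, the two inverse Mellin integrands differ by the factor [(1 - d)^(-(1/2 + s)) - 1],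
    and this factor supplies the gain [d]. The weight [/ sqrt (1 - d)] moves the exponent to the
    abscissa [b = 1/2 + c]. *)
Lemma mellin_comparison f F c : smooth_pos f -> mellin_continuation f F -> 0 < c ->
  exists A, 0 <= A /\ forall x d, 0 < x -> 0 <= d <= 1 / 2 ->
    Cmod (RtoC (/ sqrt (1 - d)) * f (x * (1 - d))%R - f x) <= A * d * Rpower x (- c).
Proof.
  intros Hf HM Hc. pose proof (fun z => mellin_continuation_diff f F z HM) as HD.
  destruct (decay_on_line F c HD ltac:(apply HM) Hc) as (K & HK0 & HK).
  set (b := 1 / 2 + c). set (B := 2 * (b * exp b) + 4).
  assert (Hb : 0 < b) by (unfold b; lra).
  assert (HB : 0 <= B) by (unfold B; pose proof (exp_pos b); nra).
  exists (2 * K * B). split; [nra|]. intros x d Hx Hd.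
  assert (Hy : 0 < 1 - d) by lra.
  pose proof (mellin_inversion f F c x Hf HM Hc Hx) as I1.
  pose proof (mellin_inversion f F c (x * (1 - d)) Hf HM Hc ltac:(nra)) as I2.
  assert (CF : forall t, Ccont (fun t => F (c, t)) t)
    by (intros; apply Cdiff_Ccont_v, HD; simpl; exact Hc).
  assert (C1 : forall y t, Ccont (fun t => F (c, t) * Rcpow y (- (c, t)))%C t)
    by (intros; apply Ccont_mult; [apply CF | apply Ccont_Rcpow_line]).
  apply (is_line_int_mult (RtoC (/ sqrt (1 - d)))) in I2; [|apply C1].
  pose proof (is_line_int_minus _ _ _ _
    (fun t => Ccont_mult _ _ t (Ccont_const (RtoC (/ sqrt (1 - d))) t) (C1 (x * (1 - d)) t))
    (C1 x) I2 I1) as I.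
  assert (Px : 0 < Rpower x (- c)) by apply exp_pos. pose proof PI_RGT_0.
  set (KK := 2 * K * B * d * Rpower x (- c)).
  assert (HKK : 0 <= KK) by (unfold KK; repeat apply Rmult_le_pos; lra).
  apply (is_line_int_bound _ _ KK) in I.
  - replace (RtoC (/ sqrt (1 - d)) * (RtoC (2 * PI) * f (x * (1 - d))%R) - RtoC (2 * PI) * f x)%C
      with (RtoC (2 * PI) * (RtoC (/ sqrt (1 - d)) * f (x * (1 - d))%R - f x))%C in I by ring.
    rewrite Cmod_mult, Cmod_R, Rabs_pos_eq in I by lra.
    pose proof (Cmod_ge_0 (RtoC (/ sqrt (1 - d)) * f (x * (1 - d))%R - f x)).
    fold KK. apply Rmult_le_reg_r with PI; [lra|]. nra.
  - intros t. apply Ccont_minus; [apply Ccont_mult; [apply Ccont_const|]|]; apply C1.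
  - exact HKK.
  - intros t. rewrite inv_sqrt_Rcpow, Rcpow_mult_base by lra.
    replace (Rcpow (1 - d) (- RtoC (1 / 2)) * (F (c, t) * (Rcpow x (- (c, t)) * Rcpow (1 - d) (- (c, t))))
        - F (c, t) * Rcpow x (- (c, t)))%C
      with (F (c, t) * Rcpow x (- (c, t)) * (Rcpow (1 - d) (- RtoC (1 / 2)) * Rcpow (1 - d) (- (c, t)) - 1))%C by ring.
    rewrite <- Rcpow_plus.
    replace (- RtoC (1 / 2) + - (c, t))%C with (- (b, t))%C by (unfold b; apply C_ext; simpl; ring).
    rewrite !Cmod_mult, Rpower_exp_Rcpow.
    pose proof (Rcpow_near_one b t d ltac:(lra) Hd) as N. fold B in N.
    (* The growth [1 + |t|] uses up one factor [1 + t ^ 2] of the decay of [F]; the other remains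
       for convergence. *)
    assert (Q : Cmod (F (c, t)) * (1 + Rabs t) <= 2 * K * / (1 + t ^ 2)).
    { specialize (HK t). assert (0 < 1 + t ^ 2) by nra.
      apply Rle_trans with (K * / (1 + t ^ 2) ^ 2 * (2 * (1 + t ^ 2))).
      - apply Rmult_le_compat; [apply Cmod_ge_0 | pose proof (Rabs_pos t); lra | exact HK |].
        rewrite <- (pow2_abs t). pose proof (Rabs_pos t). nra.
      - right. field. lra. }
    apply Rle_trans with (Cmod (F (c, t)) * Rpower x (- c) * (B * d * (1 + Rabs t))).
    { apply Rmult_le_compat_l; [|exact N]. apply Rmult_le_pos; [apply Cmod_ge_0 | lra]. }
    replace (Cmod (F (c, t)) * Rpower x (- c) * (B * d * (1 + Rabs t)))
      with (Cmod (F (c, t)) * (1 + Rabs t) * (B * d * Rpower x (- c))) by ring.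
    apply Rle_trans with (2 * K * / (1 + t ^ 2) * (B * d * Rpower x (- c))).
    + apply Rmult_le_compat_r; [|exact Q]. repeat apply Rmult_le_pos; lra.
    + right. unfold KK. ring.
Qed.

(** * Finite sums *)

Fixpoint Rsum (u : nat -> R) (n : nat) : R :=
  match n with O => 0 | S n => Rsum u n + u n end.

Fixpoint Csum (u : nat -> C) (n : nat) : C :=
  match n with O => RtoC 0 | S n => (Csum u n + u n)%C end.

Lemma Rsum_sum_n u n : Rsum u (S n) = sum_n u n.
Proof.
  induction n as [|n IH]; [rewrite sum_O; simpl; ring|].
  rewrite sum_Sn, <- IH. reflexivity.
Qed.

Lemma Rsum_le u v n : (forall k, (k < n)%nat -> u k <= v k) -> Rsum u n <= Rsum v n.
Proof.
  induction n as [|n IH]; intros H; simpl; [lra|].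
  apply Rplus_le_compat; [apply IH; intros; apply H; lia | apply H; lia].
Qed.

Lemma Rsum_ext u v n : (forall k, (k < n)%nat -> u k = v k) -> Rsum u n = Rsum v n.
Proof.
  induction n as [|n IH]; intros H; simpl; [reflexivity|].
  rewrite IH by (intros; apply H; lia). rewrite H by lia. reflexivity.
Qed.

Lemma Rsum_nonneg u n : (forall k, (k < n)%nat -> 0 <= u k) -> 0 <= Rsum u n.
Proof.
  induction n as [|n IH]; intros H; simpl; [lra|].
  apply Rplus_le_le_0_compat; [apply IH; intros; apply H; lia | apply H; lia].
Qed.

Lemma Rsum_scal c u n : Rsum (fun k => c * u k) n = c * Rsum u n.
Proof. induction n as [|n IH]; simpl; [ring|]. rewrite IH. ring. Qed.

Lemma Rsum_mono u n m : (forall k, 0 <= u k) -> (n <= m)%nat -> Rsum u n <= Rsum u m.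
Proof. intros H L. induction L; simpl; [lra|]. pose proof (H m). lra. Qed.

Lemma Rsum_prod u v n m : Rsum (fun i => Rsum (fun j => u i * v j) m) n = Rsum u n * Rsum v m.
Proof.
  induction n as [|n IH]; simpl; [ring|]. rewrite IH, Rsum_scal. ring.
Qed.

Lemma Csum_ext u v n : (forall k, (k < n)%nat -> u k = v k) -> Csum u n = Csum v n.
Proof.
  induction n as [|n IH]; intros H; simpl; [reflexivity|].
  rewrite IH by (intros; apply H; lia). rewrite H by lia. reflexivity.
Qed.

Lemma Csum_0 n : Csum (fun _ => RtoC 0) n = RtoC 0.
Proof. induction n as [|n IH]; simpl; [reflexivity|]. rewrite IH. ring. Qed.

Lemma Csum_plus u v n : Csum (fun k => u k + v k)%C n = (Csum u n + Csum v n)%C.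
Proof. induction n as [|n IH]; simpl; [ring|]. rewrite IH. ring. Qed.

Lemma Csum_minus u v n : Csum (fun k => u k - v k)%C n = (Csum u n - Csum v n)%C.
Proof. induction n as [|n IH]; simpl; [ring|]. rewrite IH. ring. Qed.

Lemma Csum_mult c u n : Csum (fun k => c * u k)%C n = (c * Csum u n)%C.
Proof. induction n as [|n IH]; simpl; [ring|]. rewrite IH. ring. Qed.

Lemma Csum_swap (u : nat -> nat -> C) n m :
  Csum (fun i => Csum (u i) m) n = Csum (fun j => Csum (fun i => u i j) n) m.
Proof.
  induction n as [|n IH]; simpl; [symmetry; apply Csum_0|]. rewrite IH, Csum_plus. reflexivity.
Qed.

Lemma Cmod_Csum u n : Cmod (Csum u n) <= Rsum (fun k => Cmod (u k)) n.
Proof.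
  induction n as [|n IH]; simpl; [rewrite Cmod_0; lra|].
  eapply Rle_trans; [apply Cmod_triangle|]. lra.
Qed.

Lemma Csum_single (u : nat -> C) n k : (k < n)%nat ->
  (forall j, (j < n)%nat -> j <> k -> u j = RtoC 0) -> Csum u n = u k.
Proof.
  induction n as [|n IH]; intros Hk H; [lia|]. simpl.
  destruct (Nat.eq_dec k n) as [->|Hne].
  - rewrite (Csum_ext u (fun _ => RtoC 0)), Csum_0; [ring|]. intros j Hj. apply H; lia.
  - rewrite IH; [|lia | intros; apply H; lia]. rewrite (H n) by lia. ring.
Qed.

Lemma Re_Csum u n : Re (Csum u n) = Rsum (fun k => Re (u k)) n.
Proof. induction n as [|n IH]; simpl; [reflexivity|]. rewrite <- IH. reflexivity. Qed.

Lemma Im_Csum u n : Im (Csum u n) = Rsum (fun k => Im (u k)) n.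
Proof. induction n as [|n IH]; simpl; [reflexivity|]. rewrite <- IH. reflexivity. Qed.

Lemma Csum_diff_le u b n m : (forall k, Cmod (u k) <= b k) -> (n <= m)%nat ->
  Cmod (Csum u m - Csum u n) <= Rsum b m - Rsum b n.
Proof.
  intros H L. induction L as [|m L IH].
  - replace (Csum u n - Csum u n)%C with (RtoC 0) by ring. rewrite Cmod_0. lra.
  - simpl. replace (Csum u m + u m - Csum u n)%C with ((Csum u m - Csum u n) + u m)%C by ring.
    eapply Rle_trans; [apply Cmod_triangle|]. pose proof (H m). lra.
Qed.

Lemma Rsum_lim_Series u : (exists B, forall n, Rsum (fun k => Rabs (u k)) n <= B) ->
  forall e, 0 < e -> exists N, forall n, (N <= n)%nat -> Rabs (Rsum u n - Series u) <= e.
Proof.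
  intros [B HB] e He.
  assert (ex : ex_series (fun k => Rabs (u k))).
  { destruct (ex_finite_lim_seq_incr (sum_n (fun k => Rabs (u k))) B) as [l Hl].
    - intros n. rewrite sum_Sn. unfold plus; simpl. pose proof (Rabs_pos (u (S n))). lra.
    - intros n. rewrite <- Rsum_sum_n. apply HB.
    - exists l. exact Hl. }
  apply ex_series_Rabs in ex. apply Series_correct in ex.
  assert (L : is_lim_seq (sum_n u) (Series u)) by exact ex.
  apply is_lim_seq_spec in L. destruct (L (mkposreal e He)) as [N HN].
  exists (S N). intros n Hn. destruct n as [|n]; [lia|].
  rewrite Rsum_sum_n. left. apply (HN n). lia.
Qed.

Lemma Csum_lim_CSeries u B : (forall n, Rsum (fun k => Cmod (u k)) n <= B) ->
  forall e, 0 < e -> exists N, forall n, (N <= n)%nat -> Cmod (Csum u n - CSeries u) <= e.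
Proof.
  intros HB e He.
  destruct (Rsum_lim_Series (fun k => Re (u k))) with (e := e / 2) as [N1 H1]; [|lra|].
  { exists B. intros n. eapply Rle_trans; [|apply (HB n)]. apply Rsum_le. intros; apply re_le_Cmod. }
  destruct (Rsum_lim_Series (fun k => Im (u k))) with (e := e / 2) as [N2 H2]; [|lra|].
  { exists B. intros n. eapply Rle_trans; [|apply (HB n)]. apply Rsum_le. intros; apply im_le_Cmod. }
  exists (max N1 N2). intros n Hn. specialize (H1 n ltac:(lia)). specialize (H2 n ltac:(lia)).
  eapply Rle_trans; [apply Cmod_le_sum|]. rewrite Re_minus, Im_minus, Re_Csum, Im_Csum.
  unfold CSeries. simpl. lra.
Qed.

Lemma le_of_eps a b : (forall e, 0 < e -> a <= b + e) -> a <= b.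
Proof. intros H. apply Rnot_lt_le. intros L. specialize (H ((a - b) / 2) ltac:(lra)). lra. Qed.

Lemma CSeries_tail u b B : (forall k, Cmod (u k) <= b k) -> (forall n, Rsum b n <= B) ->
  forall n, Cmod (CSeries u - Csum u n) <= B - Rsum b n.
Proof.
  intros H HB n. apply le_of_eps. intros e He.
  destruct (Csum_lim_CSeries u B) with (e := e) as [N HN]; [|exact He|].
  { intros m. eapply Rle_trans; [|apply (HB m)]. apply Rsum_le. intros; apply H. }
  specialize (HN (max N n) ltac:(lia)).
  pose proof (Csum_diff_le u b n (max N n) H ltac:(lia)). pose proof (HB (max N n)).
  pose proof (Cmod_triangle3 (CSeries u) (Csum u (max N n)) (Csum u n)).
  rewrite Cmod_minus_sym in HN. lra.
Qed.

Lemma Rsum_sup b B : (forall k, 0 <= b k) -> (forall n, Rsum b n <= B) ->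
  exists B', (forall n, Rsum b n <= B') /\
    forall e, 0 < e -> exists N, forall n, (N <= n)%nat -> B' - e <= Rsum b n.
Proof.
  intros Hb HB.
  destruct (completeness (fun x => exists n, x = Rsum b n)) as [l [H1 H2]].
  - exists B. intros x [n ->]. apply HB.
  - exists (Rsum b 0), 0%nat. reflexivity.
  - exists l. split; [intros n; apply H1; exists n; reflexivity|].
    intros e He. apply NNPP. intros Hn.
    assert (l <= l - e); [|lra]. apply H2. intros x [n ->].
    apply Rnot_lt_le. intros L. apply Hn. exists n. intros m Hm.
    pose proof (Rsum_mono b n m Hb Hm). lra.
Qed.

(** Integral comparison in telescoping form: by the mean value theorem each term after the first is
    at most the decrease of [x^(-eps) / eps] over the preceding unit interval. The [1] is the first
    term. *)
Lemma pseries_bound eps n : 0 < eps ->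
  Rsum (fun j => Rpower (INR (j + 1)) (- (1 + eps))) n <= 1 + / eps.
Proof.
  intros He.
  assert (Dp : forall x, 0 < x -> is_derive (fun x => Rpower x (- eps)) x (- eps * Rpower x (- eps - 1)))
    by (intros x Hx; apply is_derive_Reals, derivable_pt_lim_power, Hx).
  assert (St : forall j, (0 < j)%nat -> Rpower (INR (j + 1)) (- (1 + eps))
     <= / eps * (Rpower (INR j) (- eps) - Rpower (INR (j + 1)) (- eps))).
  { intros j Hj. assert (Pj : 0 < INR j) by (apply lt_0_INR; lia).
    rewrite plus_INR. simpl (INR 1).
    destruct (MVT_gen (fun x => Rpower x (- eps)) (INR j) (INR j + 1)
      (fun x => - eps * Rpower x (- eps - 1))) as (c & Hc & E).
    - rewrite Rmin_left, Rmax_right by lra. intros x Hx.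
      apply (Dp x). lra.
    - rewrite Rmin_left, Rmax_right by lra. intros x Hx.
      apply continuity_pt_filterlim,
        (ex_derive_continuous (V := R_NormedModule) (fun x => Rpower x (- eps)) x).
      exists (- eps * Rpower x (- eps - 1)). apply (Dp x). lra.
    - rewrite Rmin_left, Rmax_right in Hc by lra.
      assert (M : Rpower (INR j + 1) (- (1 + eps)) <= Rpower c (- eps - 1)).
      { replace (- eps - 1) with (- (1 + eps)) by ring. rewrite !Rpower_Ropp.
        apply Rinv_le_contravar; [apply exp_pos|]. apply Rle_Rpower_l; lra. }
      apply Rmult_le_reg_l with eps; [lra|].
      rewrite <- Rmult_assoc, Rinv_r, Rmult_1_l by lra. nra. }
  destruct n as [|n]; [simpl; pose proof (Rinv_0_lt_compat eps He); lra|].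
  assert (Q : Rsum (fun j => Rpower (INR (j + 1)) (- (1 + eps))) (S n)
    <= 1 + / eps * (1 - Rpower (INR (S n)) (- eps))).
  { induction n as [|n IH].
    - simpl. unfold Rpower. rewrite ln_1, !Rmult_0_r, exp_0. lra.
    - change (Rsum (fun j => Rpower (INR (j + 1)) (- (1 + eps))) (S (S n))) with
        (Rsum (fun j => Rpower (INR (j + 1)) (- (1 + eps))) (S n) + Rpower (INR (S n + 1)) (- (1 + eps))).
      pose proof (St (S n) ltac:(lia)) as S1.
      replace (INR (S (S n))) with (INR (S n + 1)) by (f_equal; lia). lra. }
  pose proof (exp_pos (- eps * ln (INR (S n)))) as P.
  change (exp (- eps * ln (INR (S n)))) with (Rpower (INR (S n)) (- eps)) in P.
  pose proof (Rinv_0_lt_compat eps He). nra.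
Qed.

(** * Absolutely convergent double series *)

Lemma Csum_trunc u N K : (N <= K)%nat ->
  Csum u N = Csum (fun k => if (k <? N)%nat then u k else RtoC 0) K.
Proof.
  intros L. induction L as [|K L IH].
  - apply Csum_ext. intros k Hk. apply Nat.ltb_lt in Hk. rewrite Hk. reflexivity.
  - simpl. rewrite <- IH. replace (K <? N)%nat with false by (symmetry; apply Nat.ltb_ge; exact L). ring.
Qed.

Lemma Rsum_trunc u N K : (N <= K)%nat ->
  Rsum u N = Rsum (fun k => if (k <? N)%nat then u k else 0) K.
Proof.
  intros L. induction L as [|K L IH].
  - apply Rsum_ext. intros k Hk. apply Nat.ltb_lt in Hk. rewrite Hk. reflexivity.
  - simpl. rewrite <- IH. replace (K <? N)%nat with false by (symmetry; apply Nat.ltb_ge; exact L). ring.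
Qed.

Lemma Rsum_0 n : Rsum (fun _ => 0) n = 0.
Proof. induction n as [|n IH]; simpl; lra. Qed.

Definition box_abs (w : nat -> nat -> C) (N : nat) : R :=
  Rsum (fun m => Rsum (fun n => Cmod (w m n)) N) N.

Lemma box_abs_trunc w N K : (N <= K)%nat -> box_abs w N =
  Rsum (fun m => Rsum (fun n => if andb (m <? N)%nat (n <? N)%nat then Cmod (w m n) else 0) K) K.
Proof.
  intros L. unfold box_abs. rewrite (Rsum_trunc _ N K L). apply Rsum_ext. intros m _.
  destruct (m <? N)%nat; simpl; [apply Rsum_trunc, L | symmetry; apply Rsum_0].
Qed.

Lemma rect_sum_trunc (w : nat -> nat -> C) (P : nat -> nat -> bool) N1 N2 K : (N1 <= K)%nat -> (N2 <= K)%nat ->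
  Csum (fun m => Csum (fun n => if P m n then w m n else RtoC 0) N2) N1 =
  Csum (fun m => Csum (fun n => if andb (m <? N1)%nat (andb (n <? N2)%nat (P m n)) then w m n else RtoC 0) K) K.
Proof.
  intros L1 L2. rewrite (Csum_trunc _ N1 K L1). apply Csum_ext. intros m _.
  destruct (m <? N1)%nat; simpl; [|symmetry; apply Csum_0].
  rewrite (Csum_trunc _ N2 K L2). apply Csum_ext. intros n _. destruct (n <? N2)%nat; reflexivity.
Qed.

(** Terms inside the box [N0] cancel because [P] holds there; every other term of the larger box
    occurs at most once, whatever [P] says. *)
Lemma rect_sum_near_box (w : nat -> nat -> C) (P : nat -> nat -> bool) N0 N1 N2 K :
  (N0 <= N1)%nat -> (N0 <= N2)%nat -> (N1 <= K)%nat -> (N2 <= K)%nat ->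
  (forall m n, (m < N0)%nat -> (n < N0)%nat -> P m n = true) ->
  Cmod (Csum (fun m => Csum (fun n => if P m n then w m n else RtoC 0) N2) N1
        - Csum (fun m => Csum (w m) N0) N0) <= box_abs w K - box_abs w N0.
Proof.
  intros L1 L2 K1 K2 HP.
  rewrite (rect_sum_trunc w P N1 N2 K K1 K2).
  assert (E : Csum (fun m => Csum (w m) N0) N0 = Csum (fun m => Csum (fun n =>
    if andb (m <? N0)%nat (andb (n <? N0)%nat true) then w m n else RtoC 0) K) K)
    by (apply (rect_sum_trunc w (fun _ _ => true)); lia).
  rewrite E. clear E.
  rewrite <- Csum_minus.
  eapply Rle_trans; [apply Cmod_Csum|].
  rewrite (box_abs_trunc w N0 K) by lia. unfold box_abs.
  assert (Q : forall u v n, Rsum u n - Rsum v n = Rsum (fun k => u k - v k) n).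
  { intros u v n. induction n as [|n IH]; simpl; [ring|]. rewrite <- IH. ring. }
  rewrite Q. apply Rsum_le. intros m Hm. rewrite Q, <- Csum_minus.
  eapply Rle_trans; [apply Cmod_Csum|]. apply Rsum_le. intros n Hn.
  destruct (Nat.ltb_spec m N0) as [A|A]; destruct (Nat.ltb_spec n N0) as [B|B];
    simpl; rewrite ?Bool.andb_false_r; simpl.
  - rewrite HP by assumption.
    replace (m <? N1)%nat with true by (symmetry; apply Nat.ltb_lt; lia).
    replace (n <? N2)%nat with true by (symmetry; apply Nat.ltb_lt; lia). simpl.
    replace (w m n - w m n)%C with (RtoC 0) by ring. rewrite Cmod_0. lra.
  - destruct (andb _ _); unfold Cminus; replace (- RtoC 0)%C with (RtoC 0) by ring; rewrite Cplus_0_r; [lra|].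
    rewrite Cmod_0. pose proof (Cmod_ge_0 (w m n)). lra.
  - destruct (andb _ _); unfold Cminus;
      replace (- RtoC 0)%C with (RtoC 0) by ring; rewrite Cplus_0_r; [lra|].
    rewrite Cmod_0. pose proof (Cmod_ge_0 (w m n)). lra.
  - destruct (andb _ _); unfold Cminus;
      replace (- RtoC 0)%C with (RtoC 0) by ring; rewrite Cplus_0_r; [lra|].
    rewrite Cmod_0. pose proof (Cmod_ge_0 (w m n)). lra.
Qed.

Lemma rect_le_box w N1 N2 K : (N1 <= K)%nat -> (N2 <= K)%nat ->
  Rsum (fun m => Rsum (fun n => Cmod (w m n)) N2) N1 <= box_abs w K.
Proof.
  intros L1 L2. unfold box_abs. apply Rle_trans with (Rsum (fun m => Rsum (fun n => Cmod (w m n)) K) N1).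
  - apply Rsum_le. intros m _. apply Rsum_mono; [intros; apply Cmod_ge_0 | exact L2].
  - apply Rsum_mono; [|exact L1]. intros m. apply Rsum_nonneg. intros; apply Cmod_ge_0.
Qed.

Lemma Csum_lim (v : nat -> nat -> C) (r : nat -> C) M :
  (forall m e, 0 < e -> exists N, forall n, (N <= n)%nat -> Cmod (v m n - r m) <= e) ->
  forall e, 0 < e -> exists N, forall n, (N <= n)%nat -> Cmod (Csum (fun m => v m n) M - Csum r M) <= e.
Proof.
  intros H. induction M as [|M IH]; intros e He.
  - exists 0%nat. intros n _. simpl. replace (RtoC 0 - RtoC 0)%C with (RtoC 0) by ring. rewrite Cmod_0. lra.
  - destruct (IH (e / 2) ltac:(lra)) as [N1 H1]. destruct (H M (e / 2) ltac:(lra)) as [N2 H2].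
    exists (max N1 N2). intros n Hn. specialize (H1 n ltac:(lia)). specialize (H2 n ltac:(lia)). simpl.
    replace (Csum (fun m => v m n) M + v M n - (Csum r M + r M))%C with
      ((Csum (fun m => v m n) M - Csum r M) + (v M n - r M))%C by ring.
    eapply Rle_trans; [apply Cmod_triangle|]. lra.
Qed.

(** The free predicate [P] is needed because the cutoff [am + n <= qL] is not a rectangle. Any
    region containing the box [N0] gives the iterated series up to [e]. *)
Lemma double_series (w : nat -> nat -> C) (B : R) : (forall N, box_abs w N <= B) ->
  forall e, 0 < e -> exists N0, forall N1 N2 (P : nat -> nat -> bool),
    (N0 <= N1)%nat -> (N0 <= N2)%nat ->
    (forall m n, (m < N0)%nat -> (n < N0)%nat -> P m n = true) ->
    Cmod (Csum (fun m => Csum (fun n => if P m n then w m n else RtoC 0) N2) N1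
          - CSeries (fun m => CSeries (w m))) <= e.
Proof.
  intros HB e He.
  assert (Row : forall m n, Rsum (fun k => Cmod (w m k)) n <= B).
  { intros m n. eapply Rle_trans; [|apply (HB (max (S m) n))].
    eapply Rle_trans; [|apply (rect_le_box w (S m) n); lia]. simpl.
    assert (0 <= Rsum (fun m => Rsum (fun n => Cmod (w m n)) n) m).
    { apply Rsum_nonneg. intros; apply Rsum_nonneg; intros; apply Cmod_ge_0. }
    lra. }
  pose proof (fun m => Csum_lim_CSeries (w m) B (Row m)) as RL.
  assert (RB : forall M, Rsum (fun m => Cmod (CSeries (w m))) M <= B).
  { intros M. apply le_of_eps. intros d Hd.
    assert (forall M d, 0 < d -> exists N, forall n, (N <= n)%nat ->
       Rsum (fun m => Cmod (CSeries (w m))) M <= Rsum (fun m => Rsum (fun k => Cmod (w m k)) n) M + d) as Q.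
    { clear M d Hd. induction M as [|M IH]; intros d Hd.
      - exists 0%nat. intros n _. simpl. lra.
      - destruct (IH (d / 2) ltac:(lra)) as [N1 H1]. destruct (RL M (d / 2) ltac:(lra)) as [N2 H2].
        exists (max N1 N2). intros n Hn. specialize (H1 n ltac:(lia)). specialize (H2 n ltac:(lia)). simpl.
        pose proof (Cmod_Csum (w M) n). pose proof (Cmod_rev_triangle (CSeries (w M)) (Csum (w M) n)).
        rewrite Cmod_minus_sym in H2. lra. }
    destruct (Q M d Hd) as [N HN]. specialize (HN N (le_n N)).
    pose proof (rect_le_box w M N (max M N) ltac:(lia) ltac:(lia)). pose proof (HB (max M N)). lra. }
  pose proof (Csum_lim_CSeries (fun m => CSeries (w m)) B RB) as TL.
  (* Choosing [N0] by the absolute mass outside its box makes it work for all regions at once. *)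
  assert (exists N0, forall K, (N0 <= K)%nat -> box_abs w K - box_abs w N0 <= e / 4) as [N0 HN0].
  { destruct (completeness (fun x => exists n, x = box_abs w n)) as [l [H1 H2]].
    - exists B. intros x [n ->]. apply HB.
    - exists (box_abs w 0), 0%nat. reflexivity.
    - apply NNPP. intros Hn. assert (l <= l - e / 4); [|lra]. apply H2. intros x [n ->].
      apply Rnot_lt_le. intros L. apply Hn. exists n. intros K HK.
      assert (box_abs w K <= l) by (apply H1; exists K; reflexivity). lra. }
  exists N0. intros N1 N2 P L1 L2 HP.
  pose proof (rect_sum_near_box w P N0 N1 N2 (max N1 N2) L1 L2 ltac:(lia) ltac:(lia) HP) as D1.
  pose proof (HN0 (max N1 N2) ltac:(lia)) as D1'.
  (* The iterated series is reached through an auxiliary rectangle: first enough rows [M], then a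
     row length [N4] that depends on [M]. *)
  destruct (TL (e / 4) ltac:(lra)) as [M1 HM1].
  specialize (HM1 (max M1 N0) ltac:(lia)). set (M := max M1 N0) in *.
  destruct (Csum_lim (fun m n => Csum (w m) n) (fun m => CSeries (w m)) M RL (e / 4) ltac:(lra)) as [N3 H3].
  specialize (H3 (max N3 N0) ltac:(lia)). set (N4 := max N3 N0) in *.
  assert (D2 : Cmod (Csum (fun m => Csum (w m) N4) M - Csum (fun m => Csum (w m) N0) N0)
    <= box_abs w (max M N4) - box_abs w N0)
    by (apply (rect_sum_near_box w (fun _ _ => true)); try reflexivity; lia).
  pose proof (HN0 (max M N4) ltac:(lia)) as D2'.
  set (S1 := Csum (fun m => Csum (fun n => if P m n then w m n else RtoC 0) N2) N1) in *.
  set (S0 := Csum (fun m => Csum (w m) N0) N0) in *.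
  set (S2 := Csum (fun m => Csum (w m) N4) M) in *.
  set (S3 := Csum (fun m => CSeries (w m)) M) in *.
  pose proof (Cmod_triangle3 S1 S0 (CSeries (fun m => CSeries (w m)))) as T1.
  pose proof (Cmod_triangle3 S0 S2 (CSeries (fun m => CSeries (w m)))) as T2.
  pose proof (Cmod_triangle3 S2 S3 (CSeries (fun m => CSeries (w m)))) as T3.
  rewrite (Cmod_minus_sym S2 S0) in D2.
  clear - D1 D1' D2 D2' H3 HM1 T1 T2 T3. lra.
Qed.

(** * The function k as a double series *)

Definition k_term (f : R -> C) (y : R) (l m : nat) : C :=
  (RtoC (/ sqrt (INR (l + 1) * INR (m + 1))) * f (INR (l + 1) * INR (m + 1) * y)%R)%C.

Definition zeta_partial (N : nat) (t : R) : C :=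
  Csum (fun n => Rcpow (INR (n + 1)) (- (RtoC (1 / 2) + (2, t)))%C) N.

Lemma INR_add_1_pos n : 0 < INR (n + 1).
Proof. apply lt_0_INR. lia. Qed.

(** The terms on the line have modulus independent of [t], so one numerical series dominates all of
    them. This uniformity permits both the continuity of [zeta] there and the passage to the limit
    under the integral. *)
Lemma zeta_partial_approx : exists B, 0 <= B /\ forall e, 0 < e -> exists N0, forall N t, (N0 <= N)%nat ->
  Cmod (zeta (RtoC (1 / 2) + (2, t)) - zeta_partial N t) <= e /\
  Cmod (zeta_partial N t) <= B /\ Cmod (zeta (RtoC (1 / 2) + (2, t))) <= B.
Proof.
  (* [1 + 3 / 2] is the real part [1 / 2 + 2], written in the form that [pseries_bound] accepts. *)
  set (b := fun n => Rpower (INR (n + 1)) (- (1 + 3 / 2))).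
  assert (Hb : forall k, 0 <= b k) by (intros; left; apply exp_pos).
  destruct (Rsum_sup b (1 + / (3 / 2)) Hb) as (B & HB & Hl).
  { intros n. apply pseries_bound. lra. }
  assert (Hu : forall t k, Cmod (Rcpow (INR (k + 1)) (- (RtoC (1 / 2) + (2, t)))%C) <= b k).
  { intros t k. rewrite Cmod_Rcpow. right. unfold b, Rpower. f_equal. simpl. field. }
  exists B. split; [apply (HB 0%nat)|]. intros e He. destruct (Hl e He) as [N0 HN0].
  exists N0. intros N t HN. pose proof (CSeries_tail _ b B (Hu t) HB) as CT. split; [|split].
  - eapply Rle_trans; [apply CT|]. pose proof (HN0 N HN). lra.
  - eapply Rle_trans; [apply Cmod_Csum|]. eapply Rle_trans; [|apply (HB N)].
    apply Rsum_le. intros; apply Hu.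
  - pose proof (CT 0%nat) as CT0. simpl in CT0.
    replace (CSeries (fun n => Rcpow (INR (n + 1)) (- (RtoC (1 / 2) + (2, t)))) - RtoC 0)%C
      with (zeta (RtoC (1 / 2) + (2, t))) in CT0 by (unfold zeta; ring). lra.
Qed.

Lemma Ccont_Csum (h : nat -> R -> C) N t : (forall k, Ccont (h k) t) ->
  Ccont (fun t => Csum (fun k => h k t) N) t.
Proof.
  intros H. induction N as [|N IH]; simpl; [apply Ccont_const|]. apply Ccont_plus; [exact IH | apply H].
Qed.

Lemma Rcpow_half_line x t : Rcpow x (- (RtoC (1 / 2) + (2, t))) =
  (Rcpow x (- RtoC (1 / 2)) * Rcpow x (- (2, t)))%C.
Proof. rewrite <- Rcpow_plus. f_equal. ring. Qed.

Lemma Ccont_zeta_partial N t : Ccont (zeta_partial N) t.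
Proof.
  apply (Ccont_Csum (fun n t => Rcpow (INR (n + 1)) (- (RtoC (1 / 2) + (2, t)))%C)). intros k.
  apply Ccont_eps. intros e He.
  assert (H : Ccont (fun t => Rcpow (INR (k + 1)) (- RtoC (1 / 2)) * Rcpow (INR (k + 1)) (- (2, t)))%C t).
  { apply Ccont_mult; [apply Ccont_const | apply Ccont_Rcpow_line]. }
  destruct (Ccont_eps_inv _ _ H e He) as (d & Hd & K). exists d. split; [exact Hd|].
  intros s Hs. rewrite !Rcpow_half_line. apply K, Hs.
Qed.

Lemma Ccont_zeta t : Ccont (fun t => zeta (RtoC (1 / 2) + (2, t))) t.
Proof.
  destruct zeta_partial_approx as (B & _ & HZ).
  apply Ccont_eps. intros e He. destruct (HZ (e / 4) ltac:(lra)) as [N HN].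
  destruct (Ccont_eps_inv _ _ (Ccont_zeta_partial N t) (e / 4) ltac:(lra)) as (d & Hd & K).
  exists d. split; [exact Hd|]. intros s Hs. specialize (K s Hs).
  destruct (HN N s (le_n N)) as [A1 _]. destruct (HN N t (le_n N)) as [A2 _].
  rewrite (Cmod_minus_sym (zeta (RtoC (1 / 2) + (2, t)))) in A2.
  pose proof (Cmod_triangle3 (zeta (RtoC (1 / 2) + (2, s))) (zeta_partial N s) (zeta (RtoC (1 / 2) + (2, t)))).
  pose proof (Cmod_triangle3 (zeta_partial N s) (zeta_partial N t) (zeta (RtoC (1 / 2) + (2, t)))). lra.
Qed.

Lemma is_line_int_Csum (h : nat -> R -> C) (l : nat -> C) N :
  (forall k t, Ccont (h k) t) -> (forall k, is_line_int (h k) (l k)) ->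
  is_line_int (fun t => Csum (fun k => h k t) N) (Csum l N).
Proof.
  intros Hc H. induction N as [|N IH].
  - intros e He. exists 0. intros T _. simpl. rewrite CInt_const.
    replace (RtoC 0 * RtoC (T - - T) - RtoC 0)%C with (RtoC 0) by ring. rewrite Cmod_0. lra.
  - simpl. apply is_line_int_plus; [|apply Hc | exact IH | apply H].
    intros t. apply Ccont_Csum. intros; apply Hc.
Qed.

Lemma Csum_product (u v : nat -> C) N M :
  (Csum u N * Csum v M)%C = Csum (fun i => Csum (fun j => u i * v j)%C M) N.
Proof.
  induction N as [|N IH]; simpl; [ring|]. rewrite <- IH, Csum_mult. ring.
Qed.

(** With partial sums in place of [zeta], the integrand is a finite combination of inverse Mellin
    integrands and gives exactly the double sum of [k_term]. The replacement error is uniformly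
    small against the integrable [F], which controls the difference from [k_fun]. *)
Lemma k_fun_limit f F y : smooth_pos f -> mellin_continuation f F -> 0 < y ->
  line_integrable 2 (k_integrand F y) /\
  forall e, 0 < e -> exists N0, forall N M, (N0 <= N)%nat -> (N0 <= M)%nat ->
    Cmod (Csum (fun l => Csum (k_term f y l) M) N - k_fun F y) <= e.
Proof.
  intros Hf HM Hy. pose proof (fun z => mellin_continuation_diff f F z HM) as HD.
  destruct (decay_on_line F 2 HD ltac:(apply HM) ltac:(lra)) as (K & HK0 & HK).
  destruct zeta_partial_approx as (B & HB0 & HZ).
  set (P := Rpower y (- (2))). assert (HP : 0 < P) by apply exp_pos.
  assert (CF : forall t, Ccont (fun t => F (2, t)) t)
    by (intros; apply Cdiff_Ccont_v, HD; simpl; lra).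
  assert (C1 : forall x t, Ccont (fun t => F (2, t) * Rcpow x (- (2, t)))%C t)
    by (intros; apply Ccont_mult; [apply CF | apply Ccont_Rcpow_line]).
  set (h := fun t => k_integrand F y (2, t)).
  assert (Eh : forall t, h t = (F (2, t) * Rcpow y (- (2, t))
     * (zeta (RtoC (1 / 2) + (2, t)) * zeta (RtoC (1 / 2) + (2, t))))%C).
  { intros t. unfold h, k_integrand. simpl. ring. }
  assert (Bd : forall t, Cmod (F (2, t) * Rcpow y (- (2, t))) <= (K * P) * / (1 + t ^ 2)).
  { intros t. rewrite Cmod_mult, Rpower_exp_Rcpow. fold P. pose proof (inv_sq_le t). specialize (HK t).
    replace (K * P * / (1 + t ^ 2)) with (K * / (1 + t ^ 2) * P) by ring.
    apply Rmult_le_compat_r; [lra|]. nra. }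
  assert (Hc : forall t, Ccont h t).
  { intros t. apply Ccont_eps. intros e He.
    assert (H : Ccont (fun t => F (2, t) * Rcpow y (- (2, t))
      * (zeta (RtoC (1 / 2) + (2, t)) * zeta (RtoC (1 / 2) + (2, t))))%C t).
    { apply Ccont_mult; [apply C1 | apply Ccont_mult; apply Ccont_zeta]. }
    destruct (Ccont_eps_inv _ _ H e He) as (d & Hd & Q). exists d. split; [exact Hd|].
    intros s Hs. rewrite !Eh. apply Q, Hs. }
  assert (HPt : forall t, 0 < / (1 + t ^ 2)) by (intros; apply Rinv_0_lt_compat; nra).
  assert (HKP : 0 <= K * P) by (apply Rmult_le_pos; lra).
  assert (Hb : forall t, Cmod (h t) <= (K * P * (B * B)) * / (1 + t ^ 2)).
  { intros t. destruct (HZ 1 Rlt_0_1) as [N HN]. destruct (HN N t (le_n N)) as (_ & _ & Hz).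
    rewrite Eh, !Cmod_mult, <- Cmod_mult.
    replace (K * P * (B * B) * / (1 + t ^ 2)) with (K * P * / (1 + t ^ 2) * (B * B)) by ring.
    apply Rmult_le_compat; [apply Cmod_ge_0 | apply Rmult_le_pos; apply Cmod_ge_0 | apply Bd |].
    apply Rmult_le_compat; try apply Cmod_ge_0; exact Hz. }
  assert (HKB : 0 <= K * P * (B * B)) by (apply Rmult_le_pos; nra).
  destruct (dominated_line_int h _ Hc HKB Hb) as (l & Hl1 & Hl2 & _).
  split.
  { split; [exact (dominated_ex_RInt_gen_Cmod h _ Hc HKB Hb) | exists l; exact Hl1]. }
  assert (Ek : (RtoC (2 * PI) * k_fun F y)%C = l).
  { unfold k_fun, line_integral. fold h.
    rewrite (is_RInt_gen_unique (V := C_R_CompleteNormedModule) h l Hl1).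
    pose proof PI_RGT_0. assert (RtoC (2 * PI) <> RtoC 0).
    { intros E. apply RtoC_inj in E. lra. }
    assert (Ci <> RtoC 0). { intros E. apply (f_equal Im) in E. simpl in E. lra. }
    field. split; assumption. }
  assert (LN : forall N M, is_line_int (fun t => F (2, t) * Rcpow y (- (2, t)) * (zeta_partial N t * zeta_partial M t))%C
    (RtoC (2 * PI) * Csum (fun l => Csum (k_term f y l) M) N)).
  { intros N M.
    rewrite <- Csum_mult.
    rewrite (Csum_ext _ (fun l => Csum (fun m => RtoC (/ sqrt (INR (l + 1) * INR (m + 1)))
       * (RtoC (2 * PI) * f (INR (l + 1) * INR (m + 1) * y)%R))%C M)).
    2:{ intros i _. rewrite <- Csum_mult. apply Csum_ext. intros j _. unfold k_term. ring. }
    apply (is_line_int_ext (fun t => Csum (fun i => Csum (fun j =>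
      RtoC (/ sqrt (INR (i + 1) * INR (j + 1)))
        * (F (2, t) * Rcpow (INR (i + 1) * INR (j + 1) * y) (- (2, t))))%C M) N)).
    - intros t. unfold zeta_partial. rewrite Csum_product, <- Csum_mult.
      apply Csum_ext. intros i _. rewrite <- Csum_mult. apply Csum_ext. intros j _.
      pose proof (INR_add_1_pos i). pose proof (INR_add_1_pos j).
      assert (0 < INR (i + 1) * INR (j + 1)) by (apply Rmult_lt_0_compat; assumption).
      rewrite inv_sqrt_Rcpow, !Rcpow_half_line by assumption.
      rewrite !Rcpow_mult_base by assumption. ring.
    - apply (is_line_int_Csum (fun i t => Csum (fun j => RtoC (/ sqrt (INR (i + 1) * INR (j + 1)))
        * (F (2, t) * Rcpow (INR (i + 1) * INR (j + 1) * y) (- (2, t))))%C M)).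
      + intros i t. apply (Ccont_Csum (fun j t => RtoC (/ sqrt (INR (i + 1) * INR (j + 1)))
          * (F (2, t) * Rcpow (INR (i + 1) * INR (j + 1) * y) (- (2, t))))%C).
        intros j. apply Ccont_mult; [apply Ccont_const | apply C1].
      + intros i. apply (is_line_int_Csum (fun j t => RtoC (/ sqrt (INR (i + 1) * INR (j + 1)))
          * (F (2, t) * Rcpow (INR (i + 1) * INR (j + 1) * y) (- (2, t))))%C).
        * intros j t. apply Ccont_mult; [apply Ccont_const | apply C1].
        * intros j. apply is_line_int_mult; [apply C1|].
          apply (mellin_inversion f F 2 (INR (i + 1) * INR (j + 1) * y)); try assumption; [lra|].
          pose proof (INR_add_1_pos i). pose proof (INR_add_1_pos j).
          repeat apply Rmult_lt_0_compat; assumption. }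
  (* Writing [z * z - zN * zM] as [(z - zN) * zM + z * (z - zM)] bounds it by [2 * B * e1], and [e1]
     compensates the remaining constants. *)
  intros e He. set (e1 := e / (K * P * (2 * B) + 1)).
  assert (0 < K * P * (2 * B) + 1) by nra.
  assert (He1 : 0 < e1) by (apply Rdiv_lt_0_compat; lra).
  destruct (HZ e1 He1) as [N0 HN0]. exists N0. intros N M HN HMM.
  set (SN := Csum (fun l => Csum (k_term f y l) M) N).
  assert (CN : forall t, Ccont (fun t => F (2, t) * Rcpow y (- (2, t)) * (zeta_partial N t * zeta_partial M t))%C t).
  { intros t. apply Ccont_mult; [apply C1 | apply Ccont_mult; apply Ccont_zeta_partial]. }
  pose proof (is_line_int_minus _ _ _ _ CN Hc (LN N M) Hl2) as D. fold SN in D.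
  rewrite <- Ek in D.
  set (KK := K * P * (2 * B * e1)).
  assert (HKK : 0 <= KK) by (unfold KK; apply Rmult_le_pos; nra).
  apply (is_line_int_bound _ _ KK) in D.
  - replace (RtoC (2 * PI) * SN - RtoC (2 * PI) * k_fun F y)%C with (RtoC (2 * PI) * (SN - k_fun F y))%C in D by ring.
    pose proof PI_RGT_0. rewrite Cmod_mult, Cmod_R, Rabs_pos_eq in D by lra.
    pose proof (Cmod_ge_0 (SN - k_fun F y)).
    assert (E : KK <= e).
    { unfold KK. apply Rle_trans with ((K * P * (2 * B) + 1) * e1); [nra|]. right. unfold e1. field. lra. }
    apply Rmult_le_reg_r with PI; [lra|]. nra.
  - intros t. apply Ccont_minus; [apply CN | apply Hc].
  - exact HKK.
  - intros t. rewrite Eh.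
    set (z := zeta (RtoC (1 / 2) + (2, t))). set (zN := zeta_partial N t). set (zM := zeta_partial M t).
    replace (F (2, t) * Rcpow y (- (2, t)) * (zN * zM) - F (2, t) * Rcpow y (- (2, t)) * (z * z))%C
      with (F (2, t) * Rcpow y (- (2, t)) * - ((z - zN) * zM + z * (z - zM)))%C by ring.
    rewrite Cmod_mult, Cmod_opp.
    destruct (HN0 N t HN) as (A1 & A2 & A3). destruct (HN0 M t HMM) as (B1 & B2 & _).
    fold z zN in A1, A3. fold zN in A2. fold z zM in B1. fold zM in B2.
    replace (KK * / (1 + t ^ 2)) with (K * P * / (1 + t ^ 2) * (2 * B * e1)) by (unfold KK; ring).
    apply Rmult_le_compat; [apply Cmod_ge_0 | apply Cmod_ge_0 | apply Bd |].
    eapply Rle_trans; [apply Cmod_triangle|]. rewrite !Cmod_mult.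
    pose proof (Cmod_ge_0 (z - zN)). pose proof (Cmod_ge_0 zM). pose proof (Cmod_ge_0 z). pose proof (Cmod_ge_0 (z - zM)).
    nra.
Qed.

(** * Reindexing along a m + n = q l *)

(* The summand of S(q,-a; f, X) at mn = x; the summands of the other two terms
   of the reciprocity formula are its values at non-integral x. *)
Definition Phi (f : R -> C) (X x : R) : C := (RtoC (/ sqrt x) * f (x / X)%R)%C.

Lemma Csum_indicator (p : nat -> bool) (v : C) n :
  (forall i j, (i < n)%nat -> (j < n)%nat -> p i = true -> p j = true -> i = j) ->
  (exists k, (k < n)%nat /\ p k = true) -> Csum (fun k => if p k then v else RtoC 0) n = v.
Proof.
  intros H (k & Hk & Pk). rewrite (Csum_single _ n k Hk).
  - rewrite Pk. reflexivity.
  - intros j Hj Hne. destruct (p j) eqn:E; [|reflexivity]. exfalso. apply Hne. apply H; assumption.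
Qed.

Section Reindex.

Variables (a q : nat) (f : R -> C) (X : R).
Hypothesis Ha : (0 < a)%nat.
Hypothesis Haq : (a < q)%nat.

Let hit (l m n : nat) : bool := (a * (m + 1) + (n + 1) =? q * (l + 1))%nat.

(** The triples with [n < am], solved for [m = (ql - n) / a]; under [am + n = ql] the inequality
    reads [2n < ql]. The value [0] elsewhere leaves the main term alone, where it is estimated by
    itself. All indices are shifted by one. *)
Definition near_n (l n : nat) : C :=
  if Zdivide_dec (Z.of_nat a) (Z.of_nat (n + 1) - Z.of_nat q * Z.of_nat (l + 1)) then
    if (2 * (n + 1) <? q * (l + 1))%nat
    then Phi f X (INR (n + 1) * ((INR q * INR (l + 1) - INR (n + 1)) / INR a)) else RtoC 0
  else RtoC 0.

(** The complementary triples, solved for [n = ql - am]. The tie [n = am] is counted here. *)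
Definition near_m (l m : nat) : C :=
  if (2 * (a * (m + 1)) <=? q * (l + 1))%nat
  then Phi f X (INR (m + 1) * (INR q * INR (l + 1) - INR a * INR (m + 1))) else RtoC 0.

Let trip (l m n : nat) : C :=
  if hit l m n then Phi f X (INR (m + 1) * INR (n + 1)) else RtoC 0.

(** Since [q > 0], given [m] and [n] admit at most one [l]; it exists exactly under the congruence,
    and the cutoff [am + n <= qL] is precisely its membership in the range. *)
Lemma sum_over_l L m n :
  (if (a * (m + 1) + (n + 1) <=? q * L)%nat
   then S_term (Z.of_nat q) (- Z.of_nat a) f X (m + 1) (n + 1) else RtoC 0)
  = Csum (fun l => trip l m n) L.
Proof.
  unfold trip, hit.
  assert (U : forall i j : nat, (i < L)%nat -> (j < L)%nat ->
     (a * (m + 1) + (n + 1) =? q * (i + 1))%nat = true ->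
     (a * (m + 1) + (n + 1) =? q * (j + 1))%nat = true -> i = j).
  { intros i j _ _ E1 E2. apply Nat.eqb_eq in E1. apply Nat.eqb_eq in E2. nia. }
  assert (Z0 : (forall l, (l < L)%nat -> (a * (m + 1) + (n + 1) =? q * (l + 1))%nat = false) ->
    Csum (fun l => if (a * (m + 1) + (n + 1) =? q * (l + 1))%nat
                   then Phi f X (INR (m + 1) * INR (n + 1)) else RtoC 0) L = RtoC 0).
  { intros H. rewrite (Csum_ext _ (fun _ => RtoC 0)); [apply Csum_0|].
    intros k Hk. rewrite H by exact Hk. reflexivity. }
  unfold S_term. destruct (Nat.leb_spec (a * (m + 1) + (n + 1)) (q * L)) as [Hle|Hgt].
  - destruct Zdivide_dec as [[z Hz]|Hnd].
    + assert (Hz0 : (0 < z)%Z) by nia.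
      rewrite (Csum_indicator (fun l => (a * (m + 1) + (n + 1) =? q * (l + 1))%nat)).
      * reflexivity.
      * exact U.
      * exists (Z.to_nat (z - 1)). split.
        -- nia.
        -- apply Nat.eqb_eq. apply Nat2Z.inj. rewrite Nat2Z.inj_mul, !Nat2Z.inj_add, Z2Nat.id by lia.
           rewrite Nat2Z.inj_mul. nia.
    + symmetry. apply Z0. intros l Hl. apply Nat.eqb_neq. intros E. apply Hnd.
      exists (Z.of_nat (l + 1)). nia.
  - symmetry. apply Z0. intros l Hl. apply Nat.eqb_neq. nia.
Qed.

Lemma sum_over_m L l n : (l < L)%nat ->
  Csum (fun m => if (n + 1 <? a * (m + 1))%nat then trip l m n else RtoC 0) (q * L) = near_n l n.
Proof.
  intros Hl. unfold near_n.
  assert (Z0 : (forall m, (n + 1 < a * (m + 1))%nat -> hit l m n = false) ->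
    Csum (fun m => if (n + 1 <? a * (m + 1))%nat then trip l m n else RtoC 0) (q * L) = RtoC 0).
  { intros H. rewrite (Csum_ext _ (fun _ => RtoC 0)); [apply Csum_0|].
    intros k Hk. destruct (Nat.ltb_spec (n + 1) (a * (k + 1))); [|reflexivity].
    unfold trip. rewrite H by assumption. reflexivity. }
  destruct Zdivide_dec as [[z Hz]|Hnd].
  - destruct (Nat.ltb_spec (2 * (n + 1)) (q * (l + 1))) as [Hlt|Hge].
    + assert (Hz0 : (z < 0)%Z) by nia.
      set (k := Z.to_nat (- z - 1)).
      assert (Hk : (a * (k + 1) + (n + 1) = q * (l + 1))%nat).
      { unfold k. apply Nat2Z.inj. rewrite Nat2Z.inj_add, !Nat2Z.inj_mul, (Nat2Z.inj_add (Z.to_nat _)), Z2Nat.id by lia. nia. }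
      (* The range [q * L] of [m] loses no solution, because [a >= 1] forces [m <= qL]. *)
      assert (KL : (k < q * L)%nat).
      { assert (a * (k + 1) <= q * L)%nat by nia. nia. }
      rewrite (Csum_single _ _ k KL).
      * replace (n + 1 <? a * (k + 1))%nat with true by (symmetry; apply Nat.ltb_lt; lia).
        unfold trip, hit. rewrite (proj2 (Nat.eqb_eq _ _) Hk). f_equal. rewrite Rmult_comm. f_equal.
        apply (f_equal INR) in Hk. rewrite plus_INR, !mult_INR in Hk.
        assert (0 < INR a) by (apply lt_0_INR; exact Ha).
        apply Rmult_eq_reg_r with (INR a); [|lra].
        unfold Rdiv. rewrite Rmult_assoc, Rinv_l by lra. lra.
      * intros j Hj Hne. destruct (n + 1 <? a * (j + 1))%nat; [|reflexivity].
        unfold trip, hit. destruct (Nat.eqb_spec (a * (j + 1) + (n + 1)) (q * (l + 1))) as [E|]; [|reflexivity].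
        exfalso. apply Hne. nia.
    + apply Z0. intros m Hm. apply Nat.eqb_neq. lia.
  - apply Z0. intros m Hm. apply Nat.eqb_neq. intros E. apply Hnd.
    exists (- Z.of_nat (m + 1))%Z. nia.
Qed.

Lemma sum_over_n L l m : (l < L)%nat ->
  Csum (fun n => if (n + 1 <? a * (m + 1))%nat then RtoC 0 else trip l m n) (q * L) = near_m l m.
Proof.
  intros Hl. unfold near_m.
  destruct (Nat.leb_spec (2 * (a * (m + 1))) (q * (l + 1))) as [Hle|Hgt].
  - set (k := (q * (l + 1) - a * (m + 1) - 1)%nat).
    assert (Hk : (a * (m + 1) + (k + 1) = q * (l + 1))%nat) by (unfold k; nia).
    assert (KL : (k < q * L)%nat) by (unfold k; nia).
    rewrite (Csum_single _ _ k KL).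
    + replace (k + 1 <? a * (m + 1))%nat with false by (symmetry; apply Nat.ltb_ge; lia).
      unfold trip, hit. rewrite (proj2 (Nat.eqb_eq _ _) Hk). f_equal. f_equal.
      apply (f_equal INR) in Hk. rewrite plus_INR, !mult_INR in Hk. lra.
    + intros j Hj Hne. destruct (j + 1 <? a * (m + 1))%nat; [reflexivity|].
      unfold trip, hit. destruct (Nat.eqb_spec (a * (m + 1) + (j + 1)) (q * (l + 1))) as [E|]; [|reflexivity].
      exfalso. apply Hne. lia.
  - rewrite (Csum_ext _ (fun _ => RtoC 0)); [apply Csum_0|].
    intros k Hk. destruct (Nat.ltb_spec (k + 1) (a * (m + 1))); [reflexivity|].
    unfold trip, hit. destruct (Nat.eqb_spec (a * (m + 1) + (k + 1)) (q * (l + 1))) as [E|]; [lia|reflexivity].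
Qed.

(** An exact finite identity without boundary terms: the ranges [q * L] of [m] and [n] contain every
    solution with [l < L]. *)
Lemma reindex L :
  Csum (fun m => Csum (fun n => if (a * (m + 1) + (n + 1) <=? q * L)%nat
     then S_term (Z.of_nat q) (- Z.of_nat a) f X (m + 1) (n + 1) else RtoC 0) (q * L)) (q * L)
  = Csum (fun l => Csum (near_n l) (q * L) + Csum (near_m l) (q * L))%C L.
Proof.
  transitivity (Csum (fun m => Csum (fun l => Csum (fun n => trip l m n) (q * L)) L) (q * L)).
  { apply Csum_ext. intros m _. rewrite <- Csum_swap. apply Csum_ext. intros n _. apply sum_over_l. }
  rewrite Csum_swap. apply Csum_ext. intros l Hl.
  rewrite (Csum_ext (fun m => Csum (fun n => trip l m n) (q * L)) (fun m =>
    Csum (fun n => if (n + 1 <? a * (m + 1))%nat then trip l m n else RtoC 0) (q * L)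
    + Csum (fun n => if (n + 1 <? a * (m + 1))%nat then RtoC 0 else trip l m n) (q * L))%C).
  2:{ intros m _. rewrite <- Csum_plus. apply Csum_ext. intros n _.
      destruct (n + 1 <? a * (m + 1))%nat; ring. }
  rewrite Csum_plus. f_equal.
  - rewrite Csum_swap. apply Csum_ext. intros n _. apply (sum_over_m L); exact Hl.
  - apply Csum_ext. intros m _. apply (sum_over_n L); exact Hl.
Qed.

End Reindex.

(** * Sums over a residue class *)

Lemma Rsum_at_most_one (p : nat -> bool) h n : 0 <= h ->
  (forall i j, (i < n)%nat -> (j < n)%nat -> p i = true -> p j = true -> i = j) ->
  Rsum (fun i => if p i then h else 0) n <= h.
Proof.
  intros Hh. induction n as [|n IH]; intros H; simpl; [lra|].
  destruct (p n) eqn:E.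
  - rewrite (Rsum_ext _ (fun _ => 0)); [rewrite Rsum_0; lra|].
    intros k Hk. destruct (p k) eqn:E'; [|reflexivity].
    exfalso. assert (k = n) by (apply H; try assumption; lia). lia.
  - assert (Rsum (fun i => if p i then h else 0) n <= h); [|lra].
    apply IH. intros; apply H; try assumption; lia.
Qed.

Lemma Rsum_split u n k : Rsum u (n + k) = Rsum u n + Rsum (fun i => u (n + i)%nat) k.
Proof.
  induction k as [|k IH]; simpl; [rewrite Nat.add_0_r; ring|].
  rewrite Nat.add_succ_r. simpl. rewrite IH. ring.
Qed.

Lemma Rsum_shift u n : Rsum u (S n) = u 0%nat + Rsum (fun k => u (S k)) n.
Proof. induction n as [|n IH]; simpl in *; [ring|]. rewrite IH. ring. Qed.

(** [n / a] numbers the blocks of length [a], and two members of one residue class in the same block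
    coincide. A weight depending only on the block is thus counted at most once per block. *)
Lemma class_sum (a : nat) (r : Z) (H : nat -> R) N : (0 < a)%nat -> (forall j, 0 <= H j) ->
  Rsum (fun n => if Zdivide_dec (Z.of_nat a) (Z.of_nat (n + 1) - r) then H (n / a)%nat else 0) N
  <= Rsum H N.
Proof.
  intros Ha HH.
  set (p := fun n => if Zdivide_dec (Z.of_nat a) (Z.of_nat (n + 1) - r) then true else false).
  rewrite (Rsum_ext _ (fun n => if p n then H (n / a)%nat else 0)).
  2:{ intros k _. unfold p. destruct Zdivide_dec; reflexivity. }
  assert (B : forall J, Rsum (fun n => if p n then H (n / a)%nat else 0) (a * J) <= Rsum H J).
  { induction J as [|J IH]; [rewrite Nat.mul_0_r; simpl; lra|].
    replace (a * S J)%nat with (a * J + a)%nat by lia. rewrite Rsum_split. simpl.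
    apply Rplus_le_compat; [exact IH|].
    rewrite (Rsum_ext _ (fun i => if p (a * J + i)%nat then H J else 0)).
    - apply (Rsum_at_most_one (fun i => p (a * J + i)%nat)); [apply HH|].
      intros i j Hi Hj. unfold p.
      destruct Zdivide_dec as [[z1 E1]|]; [|discriminate].
      destruct Zdivide_dec as [[z2 E2]|]; [|discriminate]. intros _ _.
      assert (E : (Z.of_nat i - Z.of_nat j = (z1 - z2) * Z.of_nat a)%Z) by lia.
      assert (z1 - z2 = 0)%Z by nia. nia.
    - intros i Hi. replace ((a * J + i) / a)%nat with J; [reflexivity|].
      apply (Nat.div_unique (a * J + i) a J i Hi). reflexivity. }
  (* Enlarging the range from [N] to [a * N] only adds nonnegative terms and makes all blocks
     complete. *)
  eapply Rle_trans; [|apply (B N)]. apply Rsum_mono; [|nia].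
  intros k. destruct (p k); [apply HH | lra].
Qed.

(** * The error term *)

Lemma inv_sqrt_mult_Rpower x X c : 0 < x -> 0 < X ->
  / sqrt x * Rpower (x / X) (- c) = / sqrt X * Rpower (X / x) (c + 1 / 2).
Proof.
  intros Hx HX. rewrite <- !Rpower_sqrt, <- !Rpower_Ropp by assumption.
  unfold Rpower. rewrite <- !exp_plus, !ln_div by assumption. f_equal. field.
Qed.

(** For small [d] the gain comes from [mellin_comparison]. For [d >= 1/2] the size bound alone
    suffices, since inserting the factor [d] costs at most [2]; hence [2 * A1]. *)
Lemma Phi_compare f F c : smooth_pos f -> mellin_continuation f F -> 0 < c ->
  exists A, 0 <= A /\ forall X x d, 0 < X -> 0 < x -> 0 < d ->
    (d <= 1 / 2 -> Cmod (Phi f X (x * (1 - d)) - Phi f X x)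
       <= A * (d * Rpower (X / x) (c + 1 / 2)) * / sqrt X) /\
    (1 / 2 <= d -> Cmod (Phi f X x) <= A * (d * Rpower (X / x) (c + 1 / 2)) * / sqrt X).
Proof.
  intros Hf HM Hc.
  destruct (mellin_bound f F c Hf HM Hc) as (A1 & HA1 & B1).
  destruct (mellin_comparison f F c Hf HM Hc) as (A2 & HA2 & B2).
  exists (2 * A1 + A2). split; [lra|]. intros X x d HX Hx Hd.
  pose proof (inv_sqrt_mult_Rpower x X c Hx HX) as E.
  assert (Hu : 0 < x / X) by (apply Rdiv_lt_0_compat; assumption).
  assert (Hs : 0 < / sqrt x) by (apply Rinv_0_lt_compat, sqrt_lt_R0, Hx).
  assert (Hs' : 0 < / sqrt X) by (apply Rinv_0_lt_compat, sqrt_lt_R0, HX).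
  set (R1 := Rpower (x / X) (- c)) in *. set (R2 := Rpower (X / x) (c + 1 / 2)) in *.
  assert (P1 : 0 < R1) by apply exp_pos.
  assert (Q : 0 < / sqrt X * R2) by (rewrite <- E; nra).
  replace ((2 * A1 + A2) * (d * R2) * / sqrt X) with ((2 * A1 + A2) * d * (/ sqrt X * R2)) by ring.
  rewrite <- E. split; intros Hdd.
  - replace (Phi f X (x * (1 - d)) - Phi f X x)%C with
      (RtoC (/ sqrt x) * (RtoC (/ sqrt (1 - d)) * f (x / X * (1 - d))%R - f (x / X)%R))%C.
    2:{ unfold Phi. rewrite sqrt_mult, Rinv_mult, RtoC_mult by lra.
        replace (x * (1 - d) / X) with (x / X * (1 - d)) by (field; lra). ring. }
    rewrite Cmod_mult, Cmod_R, Rabs_pos_eq by lra.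
    specialize (B2 (x / X) d Hu ltac:(lra)). fold R1 in B2.
    apply Rle_trans with (/ sqrt x * (A2 * d * R1)); [apply Rmult_le_compat_l; lra|].
    assert (0 <= / sqrt x * R1) by nra.
    replace (/ sqrt x * (A2 * d * R1)) with (A2 * d * (/ sqrt x * R1)) by ring.
    apply Rmult_le_compat_r; [lra|]. nra.
  - unfold Phi. rewrite Cmod_mult, Cmod_R, Rabs_pos_eq by lra.
    specialize (B1 (x / X) Hu). fold R1 in B1.
    apply Rle_trans with (/ sqrt x * (A1 * R1)); [apply Rmult_le_compat_l; lra|].
    assert (0 <= / sqrt x * R1) by nra.
    replace (/ sqrt x * (A1 * R1)) with (A1 * (/ sqrt x * R1)) by ring.
    apply Rmult_le_compat_r; [lra|]. nra.
Qed.

(** Two of the [2 + eps] powers of [y] are paired with [d] and give [k / j]; the remaining [y ^ eps]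
    gives [(r / j) ^ eps], just enough to make the sum over [j] converge. *)
Lemma power_weight d y r j k eps : 0 < eps -> 0 < d -> 0 < y -> 0 < r -> 0 < j ->
  y <= r / j -> d * y ^ 2 <= k / j ->
  d * Rpower y (2 + eps) <= k * Rpower r eps * Rpower j (- (1 + eps)).
Proof.
  intros He Hd Hy Hr Hj H1 H2.
  assert (E1 : Rpower y (2 + eps) = y ^ 2 * Rpower y eps).
  { rewrite Rpower_plus. f_equal. rewrite <- (Rpower_pow 2 y Hy). reflexivity. }
  assert (E2 : Rpower j (- (1 + eps)) = / j * Rpower j (- eps)).
  { replace (- (1 + eps)) with (- (1) + - eps) by ring. rewrite Rpower_plus, Rpower_Ropp, Rpower_1 by exact Hj. reflexivity. }
  assert (M : Rpower y eps <= Rpower r eps * Rpower j (- eps)).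
  { apply Rle_trans with (Rpower (r / j) eps).
    - apply Rle_Rpower_l; lra.
    - right. unfold Rpower. rewrite ln_div, <- exp_plus by assumption. f_equal. ring. }
  rewrite E1, E2, <- Rmult_assoc.
  replace (k * Rpower r eps * (/ j * Rpower j (- eps))) with (k / j * (Rpower r eps * Rpower j (- eps)))
    by (unfold Rdiv; ring).
  apply Rmult_le_compat; [nra | left; apply exp_pos | exact H2 | exact M].
Qed.

Lemma inv_square_sum n : Rsum (fun l => / INR (l + 1) ^ 2) n <= 2.
Proof.
  eapply Rle_trans; [|eapply Rle_trans; [apply (pseries_bound 1 n Rlt_0_1) | lra]].
  right. apply Rsum_ext. intros k _. pose proof (INR_add_1_pos k).
  replace (- (1 + 1)) with (- INR 2) by (simpl; ring). rewrite Rpower_Ropp, Rpower_pow by assumption. reflexivity.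
Qed.

Section ErrorTerm.

Variables (f : R -> C) (F : C -> C) (eps : R).
Hypothesis Hf : smooth_pos f.
Hypothesis HM : mellin_continuation f F.
Hypothesis Heps : 0 < eps.

Definition main_n (a q : nat) (X : R) (l n : nat) : C :=
  if Zdivide_dec (Z.of_nat a) (Z.of_nat (n + 1) - Z.of_nat q * Z.of_nat (l + 1))
  then Phi f X (INR q * INR (l + 1) * INR (n + 1) / INR a) else RtoC 0.

Definition main_m (q : nat) (X : R) (l m : nat) : C := Phi f X (INR q * INR (l + 1) * INR (m + 1)).

Lemma error_bound : exists K, 0 <= K /\ forall (a q : nat) (X : R) (L : nat),
  (0 < a)%nat -> (a < q)%nat -> 0 < X ->
  Rsum (fun l => Rsum (fun n => Cmod (near_n a q f X l n - main_n a q X l n)) (q * L)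
               + Rsum (fun m => Cmod (near_m a q f X l m - main_m q X l m)) (q * L)) L
  <= K * (/ sqrt X * (INR a / INR q) * (X / INR q + (X / INR q) ^ 2 * Rpower (X / INR q) eps)).
Proof.
  destruct (Phi_compare f F (1 / 2) Hf HM ltac:(lra)) as (A1 & HA1 & B1).
  destruct (Phi_compare f F (3 / 2 + eps) Hf HM ltac:(lra)) as (A2 & HA2 & B2).
  pose proof (Rinv_0_lt_compat eps Heps) as Hie.
  (* The outer [2] bounds the sum of [1 / l ^ 2]. [A1] belongs to the block [n <= a];
     [A2 * (1 + / eps)] occurs once for the later blocks of [n] and once for the sum over [m]. *)
  exists (2 * (A1 + 2 * A2 * (1 + / eps))).
  split; [apply Rmult_le_pos; [lra|]; apply Rplus_le_le_0_compat; [|apply Rmult_le_pos]; lra|].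
  intros a q X L Ha Haq HX.
  assert (Pa : 0 < INR a) by (apply lt_0_INR; exact Ha).
  assert (Pq : 0 < INR q) by (apply lt_0_INR; lia).
  assert (HsX0 : 0 < sqrt X) by apply sqrt_lt_R0, HX.
  assert (HsX : 0 < / sqrt X) by apply Rinv_0_lt_compat, HsX0.
  set (r := X / INR q). assert (Hr : 0 < r) by (apply Rdiv_lt_0_compat; assumption).
  assert (EX : X = r * INR q) by (unfold r; field; lra).
  set (al := INR a / INR q). assert (Hal : 0 < al) by (apply Rdiv_lt_0_compat; assumption).
  set (T1 := al * r). set (T2 := al * r ^ 2 * Rpower r eps).
  assert (HT1 : 0 < T1) by (apply Rmult_lt_0_compat; assumption).
  assert (HT2 : 0 < T2)
    by (unfold T2; apply Rmult_lt_0_compat; [apply Rmult_lt_0_compat; [|apply pow_lt]; assumption | apply exp_pos]).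
  assert (ET1 : T1 = al * r) by reflexivity.
  assert (ET2 : T2 = al * r ^ 2 * Rpower r eps) by reflexivity.
  assert (Eal : al = INR a / INR q) by reflexivity.
  clearbody T1 T2 al r.
  assert (Half : 1 / 2 + 1 / 2 = 1) by field.
  assert (Thr : 3 / 2 + eps + 1 / 2 = 2 + eps) by field.
  (* The exponent is left free because the same term is estimated with exponent [1] in the first
     block and [2 + eps] in the others. *)
  assert (Dn : forall l n A c, 0 <= A ->
    (forall x d, 0 < x -> 0 < d ->
      (d <= 1 / 2 -> Cmod (Phi f X (x * (1 - d)) - Phi f X x) <= A * (d * Rpower (X / x) c) * / sqrt X) /\
      (1 / 2 <= d -> Cmod (Phi f X x) <= A * (d * Rpower (X / x) c) * / sqrt X)) ->
    Cmod (near_n a q f X l n - main_n a q X l n) <=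
      if Zdivide_dec (Z.of_nat a) (Z.of_nat (n + 1) - Z.of_nat q * Z.of_nat (l + 1))
      then A * (INR (n + 1) / (INR q * INR (l + 1))
             * Rpower (r * INR a / (INR (l + 1) * INR (n + 1))) c) * / sqrt X
      else 0).
  { intros l n A c HA HB. pose proof (INR_add_1_pos l) as Pl. pose proof (INR_add_1_pos n) as Pn.
    unfold near_n, main_n. destruct Zdivide_dec as [_|_].
    2:{ replace (RtoC 0 - RtoC 0)%C with (RtoC 0) by ring. rewrite Cmod_0. lra. }
    set (x := INR q * INR (l + 1) * INR (n + 1) / INR a).
    set (d := INR (n + 1) / (INR q * INR (l + 1))).
    assert (Pql : 0 < INR q * INR (l + 1)) by (apply Rmult_lt_0_compat; assumption).
    assert (Hx : 0 < x) by (apply Rdiv_lt_0_compat; [apply Rmult_lt_0_compat|]; assumption).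
    assert (Hd : 0 < d) by (apply Rdiv_lt_0_compat; assumption).
    assert (EXx : X / x = r * INR a / (INR (l + 1) * INR (n + 1))).
    { unfold x. rewrite EX at 1. field. repeat split; lra. }
    rewrite <- EXx. destruct (HB x d Hx Hd) as [HB1 HB2].
    assert (Ed : d * (INR q * INR (l + 1)) = INR (n + 1)) by (unfold d; field; split; lra).
    destruct (Nat.ltb_spec (2 * (n + 1)) (q * (l + 1))) as [Hlt|Hge].
    - apply lt_INR in Hlt. rewrite !mult_INR in Hlt. simpl (INR 2) in Hlt.
      replace (INR (n + 1) * ((INR q * INR (l + 1) - INR (n + 1)) / INR a)) with (x * (1 - d)).
      + apply HB1. apply Rmult_le_reg_r with (INR q * INR (l + 1)); [exact Pql|]. lra.
      + unfold x, d. field. repeat split; lra.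
    - apply le_INR in Hge. rewrite !mult_INR in Hge. simpl (INR 2) in Hge.
      replace (RtoC 0 - Phi f X x)%C with (- Phi f X x)%C by ring. rewrite Cmod_opp.
      apply HB2. apply Rmult_le_reg_r with (INR q * INR (l + 1)); [exact Pql|]. lra. }
  assert (Sn : forall l, Rsum (fun n => Cmod (near_n a q f X l n - main_n a q X l n)) (q * L)
     <= / INR (l + 1) ^ 2 * (/ sqrt X * (A1 * T1 + A2 * T2 * (1 + / eps)))).
  { intros l. pose proof (INR_add_1_pos l) as Pl.
    assert (Pl1 : 1 <= INR (l + 1)) by (rewrite plus_INR; simpl; pose proof (pos_INR l); lra).
    assert (Pw : 0 < / INR (l + 1) ^ 2) by (apply Rinv_0_lt_compat, pow_lt; exact Pl).
    (* A weight by blocks: in block [0] exponent [1] cancels [n] altogether, while in block [j >= 1]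
       the inequality [n >= ja] turns [ra / (ln)] into at most [r / j]. *)
    set (H := fun j => match j with
       | O => / INR (l + 1) ^ 2 * (/ sqrt X * (A1 * T1))
       | S j => / INR (l + 1) ^ 2 * (/ sqrt X * (A2 * T2)) * Rpower (INR (j + 1)) (- (1 + eps))
       end).
    assert (HH : forall j, 0 <= H j).
    { intros [|j]; unfold H.
      - repeat apply Rmult_le_pos; lra.
      - repeat apply Rmult_le_pos; try lra. left; apply exp_pos. }
    apply Rle_trans with (Rsum H (q * L)).
    - eapply Rle_trans; [|apply (class_sum a (Z.of_nat q * Z.of_nat (l + 1)) H (q * L) Ha HH)].
      apply Rsum_le. intros n _. pose proof (INR_add_1_pos n) as Pn.
      pose proof (Dn l n A1 _ HA1 (fun x d => B1 X x d HX)) as D1.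
      pose proof (Dn l n A2 _ HA2 (fun x d => B2 X x d HX)) as D2.
      rewrite Half in D1. rewrite Thr in D2.
      destruct Zdivide_dec as [_|_]; [|exact D1].
      destruct (n / a)%nat as [|j] eqn:Ej.
      + eapply Rle_trans; [exact D1|]. unfold H.
        rewrite Rpower_1 by (apply Rdiv_lt_0_compat; apply Rmult_lt_0_compat; assumption).
        right. rewrite ET1, Eal. field. repeat split; lra.
      + eapply Rle_trans; [exact D2|]. unfold H.
        assert (Hja : INR (S j) * INR a <= INR (n + 1)).
        { rewrite <- mult_INR. apply le_INR. pose proof (Nat.div_mod n a ltac:(lia)). nia. }
        replace (j + 1)%nat with (S j) by lia.
        assert (Pj : 0 < INR (S j)) by (apply lt_0_INR; lia).
        assert (PW : INR (n + 1) / (INR q * INR (l + 1)) * Rpower (r * INR a / (INR (l + 1) * INR (n + 1))) (2 + eps)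
           <= (al * r ^ 2 * / INR (l + 1) ^ 2) * Rpower r eps * Rpower (INR (S j)) (- (1 + eps))).
        { apply power_weight; try assumption.
          - apply Rdiv_lt_0_compat; [|apply Rmult_lt_0_compat]; assumption.
          - apply Rdiv_lt_0_compat; apply Rmult_lt_0_compat; assumption.
          - unfold Rdiv. rewrite Rmult_assoc. apply Rmult_le_compat_l; [lra|].
            apply Rmult_le_reg_r with (INR (S j) * (INR (l + 1) * INR (n + 1)));
              [repeat apply Rmult_lt_0_compat; assumption|].
            replace (INR a * / (INR (l + 1) * INR (n + 1)) * (INR (S j) * (INR (l + 1) * INR (n + 1))))
              with (INR (S j) * INR a) by (field; split; lra).
            replace (/ INR (S j) * (INR (S j) * (INR (l + 1) * INR (n + 1))))
              with (INR (l + 1) * INR (n + 1)) by (field; lra).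
            nra.
          - replace (INR (n + 1) / (INR q * INR (l + 1)) * (r * INR a / (INR (l + 1) * INR (n + 1))) ^ 2)
              with ((al * r ^ 2 * / INR (l + 1) ^ 2) * (INR a / (INR (l + 1) * INR (n + 1))))
              by (rewrite Eal; field; repeat split; lra).
            unfold Rdiv. apply Rmult_le_compat_l.
            { repeat apply Rmult_le_pos; lra. }
            apply Rmult_le_reg_r with (INR (S j) * (INR (l + 1) * INR (n + 1)));
              [repeat apply Rmult_lt_0_compat; assumption|].
            replace (INR a * / (INR (l + 1) * INR (n + 1)) * (INR (S j) * (INR (l + 1) * INR (n + 1))))
              with (INR (S j) * INR a) by (field; split; lra).
            replace (/ INR (S j) * (INR (S j) * (INR (l + 1) * INR (n + 1))))
              with (INR (l + 1) * INR (n + 1)) by (field; lra).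
            nra. }
        apply Rle_trans with (A2 * (al * r ^ 2 * / INR (l + 1) ^ 2 * Rpower r eps * Rpower (INR (S j)) (- (1 + eps))) * / sqrt X).
        * apply Rmult_le_compat_r; [lra|]. apply Rmult_le_compat_l; assumption.
        * right. rewrite ET2. ring.
    - destruct (q * L)%nat as [|N].
      + change (Rsum H 0) with 0. apply Rmult_le_pos; [lra|]. apply Rmult_le_pos; [lra|].
        apply Rplus_le_le_0_compat; repeat apply Rmult_le_pos; lra.
      + rewrite Rsum_shift. unfold H. rewrite Rsum_scal.
        pose proof (pseries_bound eps N Heps) as PB.
        replace (/ INR (l + 1) ^ 2 * (/ sqrt X * (A1 * T1 + A2 * T2 * (1 + / eps))))
          with (/ INR (l + 1) ^ 2 * (/ sqrt X * (A1 * T1)) + / INR (l + 1) ^ 2 * (/ sqrt X * (A2 * T2)) * (1 + / eps)) by ring.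
        apply Rplus_le_compat_l, Rmult_le_compat_l; [|exact PB].
        repeat apply Rmult_le_pos; lra. }
  (* No second exponent is needed here: [X / x = r / (lm)] contains no factor [a], so the bound is
     summable from [m = 1] on. *)
  assert (Sm : forall l, Rsum (fun m => Cmod (near_m a q f X l m - main_m q X l m)) (q * L)
     <= / INR (l + 1) ^ 2 * (/ sqrt X * (A2 * T2 * (1 + / eps)))).
  { intros l. pose proof (INR_add_1_pos l) as Pl.
    assert (Pl1 : 1 <= INR (l + 1)) by (rewrite plus_INR; simpl; pose proof (pos_INR l); lra).
    assert (Pw : 0 < / INR (l + 1) ^ 2) by (apply Rinv_0_lt_compat, pow_lt; exact Pl).
    apply Rle_trans with (Rsum (fun m => / INR (l + 1) ^ 2 * (/ sqrt X * (A2 * T2)) * Rpower (INR (m + 1)) (- (1 + eps))) (q * L)).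
    - apply Rsum_le. intros m _. pose proof (INR_add_1_pos m) as Pm.
      unfold near_m, main_m.
      set (x := INR q * INR (l + 1) * INR (m + 1)).
      set (d := INR a * INR (m + 1) / (INR q * INR (l + 1))).
      assert (Pql : 0 < INR q * INR (l + 1)) by (apply Rmult_lt_0_compat; assumption).
      assert (Hx : 0 < x) by (apply Rmult_lt_0_compat; assumption).
      assert (Hd : 0 < d) by (apply Rdiv_lt_0_compat; [apply Rmult_lt_0_compat|]; assumption).
      assert (EXx : X / x = r / (INR (l + 1) * INR (m + 1))).
      { unfold x. rewrite EX at 1. field. repeat split; lra. }
      destruct (B2 X x d HX Hx Hd) as [HB1 HB2]. rewrite Thr in HB1, HB2.
      assert (Ed : d * (INR q * INR (l + 1)) = INR a * INR (m + 1)) by (unfold d; field; split; lra).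
      assert (PW : d * Rpower (X / x) (2 + eps)
           <= (al * r ^ 2 * / INR (l + 1) ^ 2) * Rpower r eps * Rpower (INR (m + 1)) (- (1 + eps))).
      { rewrite EXx.
        assert (Q1 : / (INR (l + 1) * INR (m + 1)) <= / INR (m + 1)).
        { apply Rinv_le_contravar; [exact Pm|]. nra. }
        apply power_weight; try assumption.
        - apply Rdiv_lt_0_compat; [|apply Rmult_lt_0_compat]; assumption.
        - unfold Rdiv. apply Rmult_le_compat_l; [lra | exact Q1].
        - replace (d * (r / (INR (l + 1) * INR (m + 1))) ^ 2)
            with ((al * r ^ 2 * / INR (l + 1) ^ 2) * / (INR (l + 1) * INR (m + 1)))
            by (rewrite Eal; unfold d; field; repeat split; lra).
          unfold Rdiv. apply Rmult_le_compat_l; [|exact Q1].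
          repeat apply Rmult_le_pos; lra. }
      apply Rle_trans with (A2 * (d * Rpower (X / x) (2 + eps)) * / sqrt X).
      + destruct (Nat.leb_spec (2 * (a * (m + 1))) (q * (l + 1))) as [Hle|Hgt].
        * apply le_INR in Hle. rewrite !mult_INR in Hle. simpl (INR 2) in Hle.
          replace (INR (m + 1) * (INR q * INR (l + 1) - INR a * INR (m + 1))) with (x * (1 - d)).
          -- apply HB1. apply Rmult_le_reg_r with (INR q * INR (l + 1)); [exact Pql|]. lra.
          -- unfold x, d. field. split; lra.
        * apply lt_INR in Hgt. rewrite !mult_INR in Hgt. simpl (INR 2) in Hgt.
          replace (RtoC 0 - Phi f X x)%C with (- Phi f X x)%C by ring. rewrite Cmod_opp.
          apply HB2. apply Rmult_le_reg_r with (INR q * INR (l + 1)); [exact Pql|]. lra.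
      + apply Rle_trans with (A2 * (al * r ^ 2 * / INR (l + 1) ^ 2 * Rpower r eps * Rpower (INR (m + 1)) (- (1 + eps))) * / sqrt X).
        * apply Rmult_le_compat_r; [lra|]. apply Rmult_le_compat_l; assumption.
        * right. rewrite ET2. ring.
    - rewrite Rsum_scal. pose proof (pseries_bound eps (q * L) Heps) as PB.
      replace (/ INR (l + 1) ^ 2 * (/ sqrt X * (A2 * T2 * (1 + / eps))))
        with (/ INR (l + 1) ^ 2 * (/ sqrt X * (A2 * T2)) * (1 + / eps)) by ring.
      apply Rmult_le_compat_l; [|exact PB]. repeat apply Rmult_le_pos; lra. }
  set (E0 := / sqrt X * (A1 * T1 + 2 * (A2 * T2 * (1 + / eps)))).
  assert (HE0 : 0 <= E0).
  { unfold E0. apply Rmult_le_pos; [lra|]. apply Rplus_le_le_0_compat; repeat apply Rmult_le_pos; lra. }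
  apply Rle_trans with (Rsum (fun l => E0 * / INR (l + 1) ^ 2) L).
  - apply Rsum_le. intros l _. eapply Rle_trans; [apply Rplus_le_compat; [apply Sn | apply Sm]|].
    right. unfold E0. ring.
  - rewrite Rsum_scal. apply Rle_trans with (E0 * 2).
    + apply Rmult_le_compat_l; [exact HE0 | apply inv_square_sum].
    + replace (2 * (A1 + 2 * A2 * (1 + / eps)) * (/ sqrt X * al * (r + r ^ 2 * Rpower r eps)))
        with (2 * / sqrt X * ((A1 + 2 * A2 * (1 + / eps)) * (T1 + T2))) by (rewrite ET1, ET2; ring).
      replace (E0 * 2) with (2 * / sqrt X * (A1 * T1 + 2 * A2 * (1 + / eps) * T2)) by (unfold E0; ring).
      apply Rmult_le_compat_l; [lra|].
      assert (0 <= 2 * A2 * (1 + / eps)) by (repeat apply Rmult_le_pos; lra). nra.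
Qed.

(** The decay of [f] of order [2] bounds each term by [A * Y ^ 2 / (mn) ^ 2], congruence or not, and
    the double sum factors. *)
Lemma S_converges_box r b Y : 0 < Y ->
  exists B, forall N, box_abs (fun m n => S_term r b f Y (m + 1) (n + 1)) N <= B.
Proof.
  intros HY. destruct (mellin_bound f F 2 Hf HM ltac:(lra)) as (A & HA & HB).
  exists (A * Y ^ 2 * (2 * 2)). intros N. unfold box_abs.
  assert (HAY : 0 <= A * Y ^ 2) by (apply Rmult_le_pos; [lra | apply pow2_ge_0]).
  apply Rle_trans with (Rsum (fun m => Rsum (fun n =>
     (A * Y ^ 2 * / INR (m + 1) ^ 2) * / INR (n + 1) ^ 2) N) N).
  - apply Rsum_le. intros m _. apply Rsum_le. intros n _.
    pose proof (INR_add_1_pos m) as Pm. pose proof (INR_add_1_pos n) as Pn.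
    assert (0 < / INR (m + 1) ^ 2) by (apply Rinv_0_lt_compat, pow_lt; exact Pm).
    assert (0 < / INR (n + 1) ^ 2) by (apply Rinv_0_lt_compat, pow_lt; exact Pn).
    unfold S_term. destruct Zdivide_dec as [_|_].
    2:{ rewrite Cmod_0. repeat apply Rmult_le_pos; lra. }
    assert (P : 0 < INR (m + 1) * INR (n + 1)) by (apply Rmult_lt_0_compat; assumption).
    assert (P1 : 1 <= INR (m + 1) * INR (n + 1)).
    { assert (1 <= INR (m + 1)) by (rewrite plus_INR; simpl; pose proof (pos_INR m); lra).
      assert (1 <= INR (n + 1)) by (rewrite plus_INR; simpl; pose proof (pos_INR n); lra). nra. }
    rewrite Cmod_mult, Cmod_R, Rabs_pos_eq by (left; apply Rinv_0_lt_compat, sqrt_lt_R0, P).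
    assert (S1 : / sqrt (INR (m + 1) * INR (n + 1)) <= 1).
    { rewrite <- Rinv_1. apply Rinv_le_contravar; [lra|]. rewrite <- sqrt_1. apply sqrt_le_1_alt, P1. }
    assert (Pu : 0 < INR (m + 1) * INR (n + 1) / Y) by (apply Rdiv_lt_0_compat; assumption).
    specialize (HB _ Pu). replace (- (2)) with (- INR 2) in HB by (simpl; ring).
    rewrite Rpower_Ropp, Rpower_pow in HB by exact Pu.
    rewrite <- (Rmult_1_l (A * Y ^ 2 * / INR (m + 1) ^ 2 * / INR (n + 1) ^ 2)).
    apply Rmult_le_compat; [left; apply Rinv_0_lt_compat, sqrt_lt_R0, P | apply Cmod_ge_0 | exact S1 |].
    eapply Rle_trans; [exact HB|]. right. field. repeat split; lra.
  - rewrite (Rsum_prod (fun m => A * Y ^ 2 * / INR (m + 1) ^ 2)), Rsum_scal.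
    pose proof (inv_square_sum N) as I.
    assert (I0 : 0 <= Rsum (fun l => / INR (l + 1) ^ 2) N).
    { apply Rsum_nonneg. intros k _. left. apply Rinv_0_lt_compat, pow_lt, INR_add_1_pos. }
    rewrite Rmult_assoc. apply Rmult_le_compat_l; [exact HAY|]. apply Rmult_le_compat; lra.
Qed.

Lemma S_converges_pos r b Y : 0 < Y -> S_converges r b f Y.
Proof.
  intros HY. destruct (S_converges_box r b Y HY) as [B HB]. exists B. intros N.
  eapply Rle_trans; [|apply (HB (S N))]. right. unfold box_abs.
  rewrite <- Rsum_sum_n. apply Rsum_ext. intros m _. rewrite <- Rsum_sum_n. reflexivity.
Qed.

End ErrorTerm.

(** * From the finite identity to the reciprocity formula *)

Lemma main_n_S_term f a q X l n : (0 < a)%nat -> (0 < q)%nat -> 0 < X ->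
  (RtoC (sqrt (INR a / INR q)) * S_term (Z.of_nat a) (Z.of_nat q) f (INR a * X / INR q) (l + 1) (n + 1))%C
  = main_n f a q X l n.
Proof.
  intros Ha Hq HX.
  assert (Pa : 0 < INR a) by (apply lt_0_INR; exact Ha).
  assert (Pq : 0 < INR q) by (apply lt_0_INR; exact Hq).
  pose proof (INR_add_1_pos l) as Pl. pose proof (INR_add_1_pos n) as Pn.
  assert (P : 0 < INR (l + 1) * INR (n + 1)) by (apply Rmult_lt_0_compat; assumption).
  unfold S_term, main_n. destruct Zdivide_dec as [_|_]; [|ring]. unfold Phi.
  rewrite Cmult_assoc, <- RtoC_mult. f_equal; f_equal.
  - replace (INR a / INR q) with (/ (INR q / INR a)) by (field; split; lra).
    rewrite sqrt_inv, <- Rinv_mult, <- sqrt_mult_alt by (left; apply Rdiv_lt_0_compat; assumption).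
    f_equal. f_equal. field. lra.
  - field. repeat split; lra.
Qed.

Lemma main_m_k_term f q X l m : (0 < q)%nat -> 0 < X ->
  (RtoC (/ sqrt (INR q)) * k_term f (INR q / X) l m)%C = main_m f q X l m.
Proof.
  intros Hq HX. assert (Pq : 0 < INR q) by (apply lt_0_INR; exact Hq).
  pose proof (INR_add_1_pos l) as Pl. pose proof (INR_add_1_pos m) as Pm.
  assert (P : 0 < INR (l + 1) * INR (m + 1)) by (apply Rmult_lt_0_compat; assumption).
  unfold k_term, main_m, Phi. rewrite Cmult_assoc, <- RtoC_mult. f_equal; f_equal.
  - rewrite <- Rinv_mult, <- sqrt_mult_alt by lra. f_equal. f_equal. ring.
  - field. lra.
Qed.

(** All three terms are replaced by finite sums with one common [L], each to within [e / 3]. Since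
    [error_bound] does not depend on [L], its bound survives as [e] tends to [0]. *)
Lemma reciprocity_bound f F eps : smooth_pos f -> mellin_continuation f F -> 0 < eps ->
  exists K, 0 <= K /\ forall (a q : nat) (X : R), (0 < a)%nat -> (a < q)%nat -> 0 < X ->
  Cmod (S_sum (Z.of_nat q) (- Z.of_nat a) f X
        - (RtoC (sqrt (INR a / INR q)) * S_sum (Z.of_nat a) (Z.of_nat q) f (INR a * X / INR q)%R
           + RtoC (/ sqrt (INR q)) * k_fun F (INR q / X)%R))%C
  <= K * (/ sqrt X * (INR a / INR q) * (X / INR q + (X / INR q) ^ 2 * Rpower (X / INR q) eps)).
Proof.
  intros Hf HM Heps. destruct (error_bound f F eps Hf HM Heps) as (K & HK0 & HK).
  exists K. split; [exact HK0|]. intros a q X Ha Haq HX.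
  assert (Pa : 0 < INR a) by (apply lt_0_INR; exact Ha).
  assert (Pq : 1 <= INR q) by (apply (le_INR 1); lia).
  assert (Paq : INR a <= INR q) by (apply le_INR; lia).
  set (E := K * (/ sqrt X * (INR a / INR q) * (X / INR q + (X / INR q) ^ 2 * Rpower (X / INR q) eps))) in *.
  assert (HY : 0 < INR a * X / INR q) by (apply Rdiv_lt_0_compat; [apply Rmult_lt_0_compat|]; lra).
  destruct (S_converges_box f F Hf HM (Z.of_nat q) (- Z.of_nat a) X HX) as [M1 HM1].
  destruct (S_converges_box f F Hf HM (Z.of_nat a) (Z.of_nat q) _ HY) as [M2 HM2].
  destruct (k_fun_limit f F (INR q / X) Hf HM ltac:(apply Rdiv_lt_0_compat; lra)) as [_ HL3].
  apply le_of_eps. intros e He.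
  destruct (double_series _ M1 HM1 (e / 3) ltac:(lra)) as [N1 H1].
  destruct (double_series _ M2 HM2 (e / 3) ltac:(lra)) as [N2 H2].
  destruct (HL3 (e / 3) ltac:(lra)) as [N3 H3].
  set (L := (N1 + N2 + N3)%nat).
  assert (LqL : (L <= q * L)%nat) by nia.
  specialize (H1 (q * L)%nat (q * L)%nat (fun m n => (a * (m + 1) + (n + 1) <=? q * L)%nat) ltac:(lia) ltac:(lia)).
  (* The triangular region contains the box because [a + 1 <= q]: for [m, n] up to [L] one has
     [am + n <= (a + 1) L <= qL]. *)
  specialize (H1 ltac:(intros m n Hm Hn; apply Nat.leb_le; nia)).
  specialize (H2 L (q * L)%nat (fun _ _ => true) ltac:(lia) ltac:(lia) ltac:(reflexivity)).
  specialize (H3 L (q * L)%nat ltac:(lia) ltac:(lia)).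
  cbv beta iota in H1, H2. fold (S_sum (Z.of_nat q) (- Z.of_nat a) f X) in H1.
  fold (S_sum (Z.of_nat a) (Z.of_nat q) f (INR a * X / INR q)) in H2.
  rewrite reindex in H1 by assumption.
  set (c2 := RtoC (sqrt (INR a / INR q))) in *. set (c3 := RtoC (/ sqrt (INR q))) in *.
  (* Coefficients of modulus at most [1] do not magnify the approximation errors of the two main
     terms. *)
  assert (C2 : Cmod c2 <= 1).
  { unfold c2. rewrite Cmod_R, Rabs_pos_eq by apply sqrt_pos. rewrite <- sqrt_1. apply sqrt_le_1_alt.
    apply Rmult_le_reg_r with (INR q); [lra|]. unfold Rdiv. rewrite Rmult_assoc, Rinv_l; lra. }
  assert (C3 : Cmod c3 <= 1).
  { unfold c3. assert (1 <= sqrt (INR q)) by (rewrite <- sqrt_1; apply sqrt_le_1_alt; exact Pq).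
    rewrite Cmod_R, Rabs_pos_eq by (left; apply Rinv_0_lt_compat; lra).
    rewrite <- Rinv_1. apply Rinv_le_contravar; lra. }
  match type of H1 with Cmod (?x - _) <= _ => set (A1 := x) in * end.
  match type of H2 with Cmod (?x - _) <= _ => set (A2 := x) in * end.
  match type of H3 with Cmod (?x - _) <= _ => set (A3 := x) in * end.
  set (S1 := S_sum (Z.of_nat q) (- Z.of_nat a) f X) in *.
  set (S2 := S_sum (Z.of_nat a) (Z.of_nat q) f (INR a * X / INR q)) in *.
  set (S3 := k_fun F (INR q / X)) in *.
  assert (Main : Cmod (A1 - (c2 * A2 + c3 * A3)) <= E).
  { assert (E2 : (c2 * A2)%C = Csum (fun l => Csum (main_n f a q X l) (q * L)) L).
    { unfold A2. rewrite <- Csum_mult. apply Csum_ext. intros l _. rewrite <- Csum_mult.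
      apply Csum_ext. intros n _. apply main_n_S_term; [assumption | lia | assumption]. }
    assert (E3 : (c3 * A3)%C = Csum (fun l => Csum (main_m f q X l) (q * L)) L).
    { unfold A3. rewrite <- Csum_mult. apply Csum_ext. intros l _. rewrite <- Csum_mult.
      apply Csum_ext. intros n _. apply main_m_k_term; [lia | assumption]. }
    rewrite E2, E3. unfold A1. rewrite <- Csum_plus, <- Csum_minus.
    eapply Rle_trans; [apply Cmod_Csum|]. eapply Rle_trans; [|apply (HK a q X L Ha Haq HX)].
    apply Rsum_le. intros l _.
    match goal with |- Cmod (?u + ?v - (?w + ?z)) <= _ =>
      replace (u + v - (w + z))%C with ((u - w) + (v - z))%C by ring end.
    rewrite <- !Csum_minus.
    eapply Rle_trans; [apply Cmod_triangle|]. apply Rplus_le_compat; apply Cmod_Csum. }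
  replace (S1 - (c2 * S2 + c3 * S3))%C with
    (((A1 - (c2 * A2 + c3 * A3)) + - (A1 - S1)) + (c2 * (A2 - S2) + c3 * (A3 - S3)))%C by ring.
  eapply Rle_trans; [apply Cmod_triangle|].
  eapply Rle_trans; [apply Rplus_le_compat; apply Cmod_triangle|].
  rewrite Cmod_opp, !Cmod_mult.
  pose proof (Cmod_ge_0 c2). pose proof (Cmod_ge_0 c3).
  pose proof (Cmod_ge_0 (A2 - S2)). pose proof (Cmod_ge_0 (A3 - S3)).
  assert (Cmod c2 * Cmod (A2 - S2) <= e / 3) by nra.
  assert (Cmod c3 * Cmod (A3 - S3) <= e / 3) by nra.
  lra.
Qed.

Theorem theorem5p1 (f : R -> C) (F : C -> C)
  (hf : smooth_pos f) (hF : mellin_continuation f F)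
  (eps : R) (heps : 0 < eps) :
  exists K : R, forall (q a : Z) (X : R),
    (0 < a < q)%Z -> Z.gcd a q = 1%Z -> 1 <= X ->
    S_converges q (- a) f X /\
    S_converges a q f (IZR a * X / IZR q) /\
    line_integrable 2 (k_integrand F (IZR q / X)) /\
    Cmod (S_sum q (- a) f X
          - (RtoC (sqrt (IZR a / IZR q)) * S_sum a q f (IZR a * X / IZR q)%R
             + RtoC (/ sqrt (IZR q)) * k_fun F (IZR q / X)%R))%C
    <= K * (/ sqrt (IZR q) * (IZR a / IZR q) * sqrt (X / IZR q)
            * (1 + X / IZR q) * Rpower (IZR q * X) eps).
Proof.
  destruct (reciprocity_bound f F eps hf hF heps) as (K & HK0 & HK).
  exists K. intros q a X Haq _ HX.
  assert (Pa : 0 < IZR a) by (apply IZR_lt; lia).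
  assert (Pq : 1 <= IZR q) by (apply IZR_le; lia).
  split; [apply (S_converges_pos f F hf hF); lra|].
  split; [apply (S_converges_pos f F hf hF); apply Rdiv_lt_0_compat; [apply Rmult_lt_0_compat|]; lra|].
  split; [apply (k_fun_limit f F _ hf hF); apply Rdiv_lt_0_compat; lra|].
  specialize (HK (Z.to_nat a) (Z.to_nat q) X ltac:(lia) ltac:(lia) ltac:(lra)).
  rewrite !INR_IZR_INZ, !Z2Nat.id in HK by lia.
  eapply Rle_trans; [exact HK|]. apply Rmult_le_compat_l; [exact HK0|].
  set (r := X / IZR q). assert (Hr : 0 < r) by (apply Rdiv_lt_0_compat; lra).
  assert (Er : X = r * IZR q) by (unfold r; field; lra).
  assert (Sr : 0 < sqrt r) by (apply sqrt_lt_R0, Hr).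
  assert (Sq : 0 < sqrt (IZR q)) by (apply sqrt_lt_R0; lra).
  (* As [X = rq], one factor [r] turns [X^(-1/2)] into the [q^(-1/2) (X/q)^(1/2)] of the error
     term. *)
  assert (ES : / sqrt X * r = / sqrt (IZR q) * sqrt r).
  { rewrite Er at 1. rewrite sqrt_mult by lra. rewrite <- (sqrt_sqrt r) at 2 by lra. field. split; lra. }
  set (W := Rpower (IZR q * X) eps).
  assert (HW : 1 <= W).
  { unfold W. rewrite <- (Rpower_O (IZR q * X)) by nra. apply Rle_Rpower; nra. }
  assert (HWr : Rpower r eps <= W).
  { apply Rle_Rpower_l; [lra|]. split; [exact Hr|].
    apply Rmult_le_reg_r with (IZR q); [lra|]. rewrite <- Er.
    replace (IZR q * X * IZR q) with (X * (IZR q * IZR q)) by ring.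
    assert (1 <= IZR q * IZR q) by nra. nra. }
  set (al := IZR a / IZR q). assert (Hal : 0 < al) by (apply Rdiv_lt_0_compat; lra).
  (* What remains is [1 + r * r ^ eps <= (1 + r) * W], which follows from [1 <= W] and
     [r ^ eps <= W]; both hold because [q] and [X] are at least [1]. *)
  replace (/ sqrt X * al * (r + r ^ 2 * Rpower r eps)) with
    (/ sqrt X * r * al * (1 + r * Rpower r eps)) by ring.
  rewrite ES.
  replace (/ sqrt (IZR q) * al * sqrt r * (1 + r) * W) with
    (/ sqrt (IZR q) * sqrt r * al * ((1 + r) * W)) by ring.
  apply Rmult_le_compat_l.
  - pose proof (Rinv_0_lt_compat _ Sq). apply Rmult_le_pos; [apply Rmult_le_pos|]; lra.
  - nra.
Qed.
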